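(* For any fixed $t\in\mathbb{R}$, the function $z\mapsto\mathfrak{S}_t(z)$ (restricted to real $z$) belongs to $L^2(\mathbb{R})$.
   Context: Notation: $\Lambda(n)=\log p$ if $n=p^k$ with $p$ prime and $k\in\mathbb{Z}_{>0}$, and $\Lambda(n)=0$ otherwise; $\Gamma(s)$ is the gamma function; $\Phi(z,s,a)=\sum_{n=0}^\infty (n+a)^{-s}z^n$ is the Hurwitz--Lerch zeta-function; $\zeta(s)$ is the Riemann zeta-function; $Z(s):=\pi^{-s/2}\Gamma(s/2)\zeta(s)$; $\xi(s)=\tfrac12 s(s-1)\pi^{-s/2}\Gamma(s/2)\zeta(s)$. $L^2(\mathbb{R})$ is with respect to Lebesgue measure. The Riemann hypothesis is not assumed. Put $E(z):=\xi(1/2-iz)+\xi'(1/2-iz)$ and $\Theta(z):=\overline{E(\bar z)}/E(z)$ (a meromorphic function). For $t\ge0$ and $z\in\mathbb{C}$ define the meromorphic function of $z$ $$\begin{aligned}\mathfrak{P}_t(z):={}&\frac{4(e^{t/2}-1)}{1-2iz}+\frac{4(e^{-t/2}-1)}{1+2iz}-\sum_{n\le e^t}\frac{\Lambda(n)}{\sqrt n}\frac{e^{iz(t-\log n)}-1}{iz}\\&+\frac{e^{itz}-1}{iz}\Big[\frac{Z'}{Z}\Big(\frac12-iz\Big)-\frac12\log\pi+\frac12\frac{\Gamma'}{\Gamma}\Big(\frac14+\frac{iz}2\Big)\Big]\\&-\frac1{2iz}\Big[\frac{\Gamma'}{\Gamma}\Big(\frac14\Big)-\frac{\Gamma'}{\Gamma}\Big(\frac14+\frac{iz}2\Big)\Big]\\&-\frac1{2iz}e^{-t/2}\Big[\Phi(e^{-2t},1,1/4)-\Phi(e^{-2t},1,\tfrac12(\tfrac12+iz))\Big],\end{aligned}$$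 where at $t=0$ the last bracket is understood as its limit as $t\to0^+$. For $t\ge 0$ define $$\mathfrak{S}_t(z):=\frac{i(1+\Theta(z))}{2\sqrt\pi}\,\mathfrak{P}_t(z),$$ regarded as a meromorphic function of $z$ (removable singularities removed), and for $t<0$ define $\mathfrak{S}_t(z):=\mathfrak{S}_{-t}(z)$. *)

(* Defs.v *)
From HB Require Import structures.
From mathcomp Require Import all_boot all_order all_algebra.
From mathcomp Require Import all_classical all_reals all_analysis.
From mathcomp Require Import complex.

Set Implicit Arguments.
Unset Strict Implicit.
Unset Printing Implicit Defensive.

Import Order.TTheory GRing.Theory Num.Theory.
Import numFieldNormedType.Exports.

Local Open Scope classical_set_scope.
Local Open Scope ring_scope.
Local Open Scope complex_scope.

(* [R[i]] itself carries no topology; seen as a [numFieldType] it gets the     *)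
(* topology and normed module structure of [numFieldNormedType].               *)
Definition CC (R : realType) : numFieldType := R[i].

Definition ofR (R : realType) (x : R) : CC R := x%:C.
Definition im (R : realType) : CC R := 'i.
Definition cconj (R : realType) (z : CC R) : CC R := conjc z.
Definition cRe (R : realType) (z : CC R) : R := complex.Re z.
Definition cIm (R : realType) (z : CC R) : R := complex.Im z.

Definition cexp (R : realType) (z : CC R) : CC R :=
  ofR (expR (cRe z)) * (ofR (cos (cIm z)) + im R * ofR (sin (cIm z))).

(* x ^ s, for x a positive real *)
Definition cpow (R : realType) (x : R) (s : CC R) : CC R :=
  cexp (s * ofR (ln x)).

(* The value at z of a meromorphic function given by a formula valid near z    *)
(* but possibly not at z: removable singularities are removed.                 *)
Definition regular_value (R : realType) (f : CC R -> CC R) (z : CC R) : CC R :=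
  lim (f w @[w --> z^']).

Definition logderiv (R : realType) (f : CC R -> CC R) (s : CC R) : CC R :=
  derive1 f s / f s.

(* [primes n] is a singleton exactly at the prime powers p ^ k with 0 < k, see     *)
(* the two lemmas below.                                                       *)
Definition vonMangoldt (R : realType) (n : nat) : R :=
  if primes n is [:: p] then ln p%:R else 0.

Lemma vonMangoldt_primepow (R : realType) (p k : nat) :
  prime p -> (0 < k)%N -> vonMangoldt R (p ^ k) = ln p%:R.
Proof.
by move=> pp; case: k => // k _; rewrite /vonMangoldt primesX // primes_prime.
Qed.

Lemma vonMangoldt_eq0 (R : realType) (n : nat) :
  ~ (exists p k, [/\ prime p, (0 < k)%N & n = (p ^ k)%N]) ->
  vonMangoldt R n = 0.
Proof.
move=> H; rewrite /vonMangoldt.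
case E : (primes n) => [|p [|q s]] //; case: H.
have : p \in primes n by rewrite E mem_head.
rewrite mem_primes => /and3P[pp n0 pn].
exists p, (logn p n); split=> //; first by rewrite logn_gt0 E mem_head.
rewrite -p_part part_pnat_id // /pnat n0; apply/allP => q.
by rewrite E inE => /eqP->; rewrite !inE.
Qed.

(* Euler's product formula, in Gauss's form.                                   *)
Definition Gamma (R : realType) (s : CC R) : CC R :=
  lim ((n`!%:R * cpow n%:R s / \prod_(0 <= k < n.+1) (s + k%:R))
         @[n --> \oo]).

(* Hurwitz-Lerch zeta function, for a natural number exponent s.               *)
Definition Lerch (R : realType) (z : CC R) (s : nat) (a : CC R) : CC R :=
  lim ((\sum_(0 <= n < N) ((n%:R + a) ^- s * z ^+ n)) @[N --> \oo]).

(* The Riemann zeta function is the holomorphic function on C \ {1} that       *)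
(* extends the Dirichlet series; its value at the pole 1 is unspecified.       *)
Definition is_zeta (R : realType) (f : CC R -> CC R) : Prop :=
  (forall s, s != 1 -> derivable f s 1) /\
  (forall s, 1 < cRe s ->
     (\sum_(1 <= n < N) cpow n%:R (- s)) @[N --> \oo] --> f s).

Definition zeta (R : realType) : CC R -> CC R :=
  xget (fun=> 0) [set f | is_zeta f].

Definition Zcompl (R : realType) : CC R -> CC R := regular_value (fun s =>
  cpow pi (- s / 2) * Gamma (s / 2) * zeta s).

Definition xi (R : realType) : CC R -> CC R := regular_value (fun s =>
  2^-1 * s * (s - 1) * cpow pi (- s / 2) * Gamma (s / 2) * zeta s).

Definition E_xi (R : realType) (z : CC R) : CC R :=
  xi (2^-1 - im R * z) + derive1 (@xi R) (2^-1 - im R * z).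

Definition Theta (R : realType) (z : CC R) : CC R :=
  cconj (E_xi (cconj z)) / E_xi z.

Definition Lerch_diff (R : realType) (z : CC R) (t : R) : CC R :=
  Lerch (ofR (expR (- 2 * t))) 1 (1 / 4)
  - Lerch (ofR (expR (- 2 * t))) 1 (1 / 2 * (1 / 2 + im R * z)).

(* At t = 0 the two Lerch series diverge separately.                           *)
Definition Lerch_bracket (R : realType) (z : CC R) (t : R) : CC R :=
  if t == 0 then lim (Lerch_diff z u @[u --> (0 : R)^'+]) else Lerch_diff z t.

Definition frakP (R : realType) (t : R) (z : CC R) : CC R :=
  let iz := im R * z in
  let psi := logderiv (@Gamma R) in
  4 * (ofR (expR (t / 2)) - 1) / (1 - 2 * iz)
  + 4 * (ofR (expR (- t / 2)) - 1) / (1 + 2 * iz)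
  - \sum_(1 <= n < (Num.truncn (expR t)).+1)
      ofR (vonMangoldt R n / Num.sqrt n%:R)
      * ((cexp (iz * ofR (t - ln n%:R)) - 1) / iz)
  + (cexp (im R * ofR t * z) - 1) / iz
    * (logderiv (@Zcompl R) (1 / 2 - iz) - 1 / 2 * ofR (ln pi)
       + 1 / 2 * psi (1 / 4 + iz / 2))
  - 1 / (2 * iz) * (psi (1 / 4) - psi (1 / 4 + iz / 2))
  - 1 / (2 * iz) * ofR (expR (- t / 2)) * Lerch_bracket z t.

(* frakP is given by its formula, singular at isolated points such as z = 0 or *)
(* the zeros of xi (1/2 - iz), and is only meaningful for 0 <= t; hence the    *)
(* regularization and the absolute value.                                      *)
Definition frakS (R : realType) (t : R) : CC R -> CC R := regular_value (fun z =>
  im R * (1 + Theta z) / (2 * ofR (Num.sqrt pi)) * frakP `|t| z).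

(* L^2 for complex-valued functions.                                           *)
Definition in_L2 (R : realType) (f : R -> CC R) : Prop :=
  [/\ measurable_fun setT (fun x => cRe (f x)),
      measurable_fun setT (fun x => cIm (f x)) &
      finite_norm (@lebesgue_measure R) 2%:E
        (fun x => cRe `|f x|)].

(* Main.v *)
From HB Require Import structures.
Require Import Defs.
From mathcomp Require Import all_boot all_order all_algebra.
From mathcomp Require Import all_classical all_reals all_analysis.
From mathcomp Require Import measurable_realfun.
From mathcomp Require Import complex.
From mathcomp Require Import ring lra.

Set Implicit Arguments.
Unset Strict Implicit.
Unset Printing Implicit Defensive.

Import Order.TTheory GRing.Theory Num.Theory.
Import numFieldNormedType.Exports.

Local Open Scope classical_set_scope.
Local Open Scope ring_scope.

(** The function [frakS t] is the regularization of an explicit formula [G]. For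
    any [G] whatsoever the regularized values on the real axis form a Borel
    function, because the points at which a punctured limit exists make up a
    countable intersection of open sets ([measurable_regular_value]), and a
    continuous bound for [G] on the axis off the origin passes to them
    ([regular_value_le]). So it is enough to show that, for real [w <> 0],
    [(1 + Theta w) * frakP t w] is at most a constant, depending on [t], times
    [decay w = (1 + |w|) ^ (- 3 / 4)], whose square is integrable
    ([in_L2_decay], [bnd_frakP]).

    The elementary terms of [frakP] are [O (1 / (1 + |w|))]. Gauss's product for
    Gamma, and the definition of the Lerch function, express the digamma and
    Lerch differences as limits of sums that are bounded by [|w| / 2] times the
    sum over [n] of [1 / (a |a + i w / 2|)], with [a = n + 1 / 4]; splitting the
    exponent of the second factor bounds this sum by a multiple of [decay w]
    ([sum_reciprocal], [psi_diff_le], [Lerch_bracket_le]). Gauss's product is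
    handled as the Laplace transform of a profile that converges, dominated, to
    Euler's integrand ([GammaE], [cvg_digam]).

    The remaining term is [Z'/Z] at [s = 1/2 - i w], which is unbounded near the
    zeros of zeta on the critical line. There the completed function is real, so
    [xi s] is real and [xi' s] is imaginary, and [1 + Theta] is
    [2 xi / (xi + xi')]: it cancels the zeros, and its product with [Z'/Z] is
    bounded by an absolute constant ([Theta_logderiv_le]).

    What this uses of zeta is that [Z] is differentiable in the half plane
    [Re s > 0] off the real axis, and real on the critical line ([Zcompl_xi]).
    This is Riemann's argument. For [Re s > 1], [Z] is a Laplace transform of a
    theta series ([zeta_lap]); the theta identity rewrites it as a function [Lam]
    that is symmetric under [s -> 1 - s] and differentiable off 0 and 1
    ([lap_wsum], [derivable_Lam]); and unique continuation along horizontal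
    segments, from Goursat's theorem and Cauchy's formula on rectangles, extends
    the equality to the left ([unique_continuation], [zeta_Lam]).

    The theta identity comes from Polya's argument. The sum of the numbers
    [(2 cos (pi j / m)) ^ (2 n)] over [j] modulo [m] is [m] times the number of
    subsets of a set with [2 n] elements whose size lies in the residue class of
    [n] modulo [m] ([cos_sum]). For [n] close to [a m ^ 2], both expressions converge term by
    term, under a domination, to theta series at reciprocal parameters
    ([tannery], [gsum_identity]); the constant left over is found by evaluating
    the identity at its fixed point ([wsumN]). *)

(** * Complex numbers: modulus, limits and derivatives *)

Section ComplexBasics.
Context {R : realType}.
Implicit Types (z w : CC R) (x y : R).

HB.instance Definition _ := GRing.RMorphism.copy (@ofR R) (real_complex R).
HB.instance Definition _ := GRing.RMorphism.copy (@cconj R) (@conjc R).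

Lemma cReD z w : cRe (z + w) = cRe z + cRe w.
Proof. by case: z w => [a b] [c d]. Qed.
Lemma cImD z w : cIm (z + w) = cIm z + cIm w.
Proof. by case: z w => [a b] [c d]. Qed.

Lemma cRe_zmod_morphism : zmod_morphism (@cRe R).
Proof. by case=> [a b] [c d]. Qed.
Lemma cIm_zmod_morphism : zmod_morphism (@cIm R).
Proof. by case=> [a b] [c d]. Qed.
HB.instance Definition _ :=
  GRing.isZmodMorphism.Build (CC R) R (@cRe R) cRe_zmod_morphism.
HB.instance Definition _ :=
  GRing.isZmodMorphism.Build (CC R) R (@cIm R) cIm_zmod_morphism.

Lemma cRe_ofR x : cRe (ofR x) = x. Proof. by []. Qed.
Lemma cIm_ofR x : cIm (ofR x) = 0. Proof. by []. Qed.
Lemma cRe_im : cRe (im R) = 0. Proof. by []. Qed.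
Lemma cIm_im : cIm (im R) = 1. Proof. by []. Qed.
Lemma cReM z w : cRe (z * w) = cRe z * cRe w - cIm z * cIm w.
Proof. by case: z w => [a b] [c d]. Qed.
Lemma cImM z w : cIm (z * w) = cRe z * cIm w + cIm z * cRe w.
Proof. by case: z w => [a b] [c d]. Qed.
Lemma cRe1 : cRe (1 : CC R) = 1. Proof. by []. Qed.
Lemma cIm1 : cIm (1 : CC R) = 0. Proof. by []. Qed.
Lemma cRe_nat n : cRe (n%:R : CC R) = n%:R.
Proof. by rewrite -(rmorph_nat (@ofR R)). Qed.
Lemma cIm_nat n : cIm (n%:R : CC R) = 0.
Proof. by rewrite -(rmorph_nat (@ofR R)). Qed.
Lemma ceqP z w : cRe z = cRe w -> cIm z = cIm w -> z = w.
Proof. by case: z w => [a b] [c d] /= -> ->. Qed.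
Lemma ccE z : z = ofR (cRe z) + im R * ofR (cIm z).
Proof. by apply: ceqP; rewrite ?cReD ?cImD ?cReM ?cImM /=; ring. Qed.
Lemma cRe_conj z : cRe (cconj z) = cRe z. Proof. by case: z. Qed.
Lemma cIm_conj z : cIm (cconj z) = - cIm z. Proof. by case: z. Qed.
Lemma cconj_ofR x : cconj (ofR x) = ofR x.
Proof. by apply: ceqP; rewrite ?cRe_conj ?cIm_conj //= oppr0. Qed.

Lemma cReB z w : cRe (z - w) = cRe z - cRe w. Proof. exact: raddfB. Qed.
Lemma cImB z w : cIm (z - w) = cIm z - cIm w. Proof. exact: raddfB. Qed.
Lemma cReN z : cRe (- z) = - cRe z. Proof. exact: raddfN. Qed.
Lemma cImN z : cIm (- z) = - cIm z. Proof. exact: raddfN. Qed.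
Lemma cRe0 : cRe (0 : CC R) = 0. Proof. by []. Qed.
Lemma cIm0 : cIm (0 : CC R) = 0. Proof. by []. Qed.

Definition cE := (cReB, cImB, cReN, cImN, cReD, cImD, cReM, cImM, cRe_ofR, cIm_ofR, cRe_im, cIm_im, cRe1, cIm1,
  cRe_nat, cIm_nat, cRe0, cIm0, cRe_conj, cIm_conj).

Definition cabs z : R := cRe `|z|.

Lemma normCE z : `|z| = ofR (cabs z).
Proof. by rewrite /cabs normc_def. Qed.
Lemma cabsE z : cabs z = Num.sqrt (cRe z ^+ 2 + cIm z ^+ 2).
Proof. by rewrite /cabs normc_def. Qed.
Lemma sqr_cabs z : cabs z ^+ 2 = cRe z ^+ 2 + cIm z ^+ 2.
Proof. by rewrite cabsE sqr_sqrtr// addr_ge0 ?sqr_ge0. Qed.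
Lemma ofR_inj : injective (@ofR R).
Proof. by move=> x y /(congr1 (@cRe R)). Qed.
Lemma ltC x y : (ofR x < ofR y) = (x < y). Proof. exact: ltcR. Qed.
Lemma leC x y : (ofR x <= ofR y) = (x <= y). Proof. exact: lecR. Qed.
Lemma cabs_ge0 z : 0 <= cabs z. Proof. by rewrite cabsE sqrtr_ge0. Qed.
Lemma cabs0 : cabs 0 = 0. Proof. by rewrite /cabs normr0. Qed.
Lemma cabs1 : cabs 1 = 1. Proof. by rewrite /cabs normr1. Qed.
Lemma cabsN z : cabs (- z) = cabs z. Proof. by rewrite /cabs normrN. Qed.
Lemma cabsM z w : cabs (z * w) = cabs z * cabs w.
Proof. by apply: ofR_inj; rewrite rmorphM /= -!normCE normrM. Qed.
Lemma cabsV z : cabs z^-1 = (cabs z)^-1.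
Proof. by apply: ofR_inj; rewrite fmorphV /= -!normCE normfV. Qed.
Lemma cabsX z n : cabs (z ^+ n) = cabs z ^+ n.
Proof. by apply: ofR_inj; rewrite rmorphXn /= -!normCE normrX. Qed.
Lemma cabsD z w : cabs (z + w) <= cabs z + cabs w.
Proof. by rewrite -leC rmorphD /= -!normCE ler_normD. Qed.
Lemma cabsB z w : cabs (z - w) <= cabs z + cabs w.
Proof. by rewrite (le_trans (cabsD _ _))// cabsN. Qed.
Lemma cabsBC z w : cabs (z - w) = cabs (w - z).
Proof. by rewrite -cabsN opprB. Qed.
Lemma cabs_dist z w : `|cabs z - cabs w| <= cabs (z - w).
Proof.
have := cabsD (z - w) w; have := cabsD (w - z) z.
by rewrite !subrK (cabsBC w) ler_norml => *; apply/andP; split; lra.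
Qed.
Lemma cabs_sum (I : Type) (r : seq I) (P : pred I) (F : I -> CC R) :
  cabs (\sum_(i <- r | P i) F i) <= \sum_(i <- r | P i) cabs (F i).
Proof.
elim/big_ind2: _ => //; first by rewrite cabs0.
by move=> a b c d ab cd; rewrite (le_trans (cabsD _ _))// lerD.
Qed.
Lemma cabs_prod (I : Type) (r : seq I) (P : pred I) (F : I -> CC R) :
  cabs (\prod_(i <- r | P i) F i) = \prod_(i <- r | P i) cabs (F i).
Proof. by elim/big_ind2: _ => [|a b c d <- <-|]//; rewrite ?cabs1 ?cabsM. Qed.
Lemma cabs_ofR x : cabs (ofR x) = `|x|.
Proof. by rewrite cabsE /= expr0n addr0 sqrtr_sqr. Qed.
Lemma cabs_im : cabs (im R) = 1.
Proof. by rewrite cabsE /= expr0n expr1n add0r sqrtr1. Qed.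
Lemma cabs_nat n : cabs n%:R = n%:R.
Proof. by rewrite -(rmorph_nat (@ofR R)) cabs_ofR ger0_norm. Qed.
Lemma cabs_conj z : cabs (cconj z) = cabs z.
Proof. by rewrite !cabsE cRe_conj cIm_conj sqrrN. Qed.
Lemma cabs_eq0 z : (cabs z == 0) = (z == 0).
Proof. by rewrite -(inj_eq ofR_inj) -normCE rmorph0 normr_eq0. Qed.
Lemma cabs_gt0 z : (0 < cabs z) = (z != 0).
Proof. by rewrite lt_neqAle eq_sym cabs_eq0 cabs_ge0 andbT. Qed.
Lemma normRe_le z : `|cRe z| <= cabs z.
Proof. by rewrite cabsE -sqrtr_sqr ler_sqrt ?addr_ge0 ?sqr_ge0// lerDl sqr_ge0. Qed.
Lemma normIm_le z : `|cIm z| <= cabs z.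
Proof. by rewrite cabsE -sqrtr_sqr ler_sqrt ?addr_ge0 ?sqr_ge0// lerDr sqr_ge0. Qed.
Lemma cRe_le z : cRe z <= cabs z.
Proof. by rewrite (le_trans (ler_norm _))// normRe_le. Qed.
Lemma cabs_le z : cabs z <= `|cRe z| + `|cIm z|.
Proof.
rewrite {1}[z]ccE (le_trans (cabsD _ _))// cabsM cabs_im mul1r !cabs_ofR//.
Qed.

Lemma gtC0 (e : CC R) : 0 < e -> exists2 r : R, 0 < r & e = ofR r.
Proof.
case: e => a b; rewrite ltcE /= => /andP[/eqP -> a0]; exists a => //.
Qed.

Lemma nbhsCP z (A : set (CC R)) :
  nbhs z A <-> exists2 e : R, 0 < e & forall w, cabs (w - z) < e -> A w.
Proof.
split.
  move=> /nbhs_ballP[e /= /gtC0[r r0 ->]] zA; exists r => // w wr.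
  by apply: zA; rewrite /ball /= distrC normCE ltC.
move=> [e e0 zA]; apply/nbhs_ballP; exists (ofR e); first by rewrite /= ltC.
by move=> w; rewrite /ball /= distrC normCE ltC; exact: zA.
Qed.

Lemma dnbhsCP z (A : set (CC R)) :
  (z^' A) <-> exists2 e : R, 0 < e & forall w, w != z -> cabs (w - z) < e -> A w.
Proof.
rewrite /dnbhs /within /=; split.
  by move=> /nbhsCP[e e0 H]; exists e => // w wz /H; apply.
by move=> [e e0 H]; apply/nbhsCP; exists e => // w wz wne; apply: H.
Qed.

Lemma cvgCP {T : Type} (F : set_system T) {FF : Filter F} (f : T -> CC R) (l : CC R) :
  (f @ F --> l) <-> forall e : R, 0 < e -> \forall x \near F, cabs (f x - l) < e.
Proof.
split.
  move=> H e e0; have := H [set w | cabs (w - l) < e]; apply.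
  by apply/nbhsCP; exists e.
move=> H A /nbhsCP[e e0 eA].
near=> x; apply: eA; near: x; exact: H.
Unshelve. all: by end_near. Qed.

Lemma cvgRP {T : Type} (F : set_system T) {FF : Filter F} (f : T -> R) (l : R) :
  (f @ F --> l) <-> forall e : R, 0 < e -> \forall x \near F, `|f x - l| < e.
Proof.
split; first by move=> /cvgrPdistC_lt.
by move=> H; apply/cvgrPdistC_lt.
Qed.

Lemma cvg_cReIm {T : Type} (F : set_system T) {FF : Filter F} (f : T -> CC R) (l : CC R) :
  cRe (f x) @[x --> F] --> cRe l -> cIm (f x) @[x --> F] --> cIm l ->
  f @ F --> l.
Proof.
move=> /cvgRP H1 /cvgRP H2; apply/cvgCP => e e0.
have e2 : 0 < e / 2 by rewrite divr_gt0.
near=> x; apply: le_lt_trans (cabs_le _) _; rewrite (splitr e) !raddfB ltrD//.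
  by near: x; exact: H1.
by near: x; exact: H2.
Unshelve. all: by end_near. Qed.
Lemma cvg_cabs {T : Type} (F : set_system T) {FF : Filter F} (f : T -> CC R) (l : CC R) :
  f @ F --> l -> cabs (f x) @[x --> F] --> cabs l.
Proof.
move=> /cvgCP H; apply/cvgRP => e e0; move: (H e e0); apply: filterS => x.
by apply: le_lt_trans; exact: cabs_dist.
Qed.

Lemma cauchyC {T : Type} (F : set_system T) {FF : ProperFilter F} (f : T -> CC R) :
  (forall e : R, 0 < e -> exists2 A, F A & forall u v, A u -> A v -> cabs (f u - f v) < e) ->
  exists l : CC R, f @ F --> l.
Proof.
move=> H.
have key (p : CC R -> R) : (forall z w, `|p z - p w| <= cabs (z - w)) ->
    cvg (p (f u) @[u --> F]).
  move=> pE; apply: (@cauchy_cvg R); apply/cauchy_exP => e e0.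
  have [A FA AH] := H _ e0; have [x0 Ax0] := @filter_ex _ _ FF _ FA.
  exists (p (f x0)); rewrite /= /fmap /=; apply: filterS FA => y Ay.
  by rewrite /ball /=; apply: le_lt_trans (pE _ _) _; exact: AH.
have /cvg_ex[/= a ca] := key (@cRe R) (fun z w => ltac:(by rewrite -raddfB normRe_le)).
have /cvg_ex[/= b cb] := key (@cIm R) (fun z w => ltac:(by rewrite -raddfB normIm_le)).
exists (Complex a b); exact: cvg_cReIm.
Qed.

(** Derivatives are used through the first order expansion, measured by the
    real modulus. *)
Lemma is_deriveCP (f : CC R -> CC R) (s l : CC R) :
  is_derive s (1 : CC R) f l <->
  forall e : R, 0 < e -> exists2 d : R, 0 < d & forall h, cabs h < d ->
    cabs (f (s + h) - f s - l * h) <= e * cabs h.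
Proof.
have E : is_derive s (1 : CC R) f l <->
    (fun h => h^-1 *: ((f \o shift s) (h *: (1 : CC R)) - f s)) @ 0^' --> l.
  split; first by case=> df <-; exact: df.
  by move=> H; split; [apply/cvg_ex; exists l | apply/cvg_lim].
have Q (h : CC R) : h != 0 -> cabs (h^-1 *: ((f \o shift s) (h *: (1 : CC R)) - f s) - l)
    = cabs (f (s + h) - f s - l * h) / cabs h.
  move=> h0; rewrite -cabsV -cabsM /=; congr cabs.
  rewrite [h *: 1]mulr1 (addrC h) -[_ *: _]/(h^-1 * _).
  by field.
rewrite E; split.
  move=> /cvgCP H e e0; have /dnbhsCP[d d0 dH] := H _ e0; exists d => // h hd.
  have [->|h0] := eqVneq h 0; first by rewrite addr0 subrr mulr0 subrr cabs0 mulr0.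
  have := dH h h0; rewrite subr0 => /(_ hd); rewrite Q// ltr_pdivrMr ?cabs_gt0//.
  exact: ltW.
move=> H; apply/cvgCP => e e0; apply/dnbhsCP.
have [d d0 dH] := H _ (divr_gt0 e0 (ltr0n R 2)).
exists d => // h h0; rewrite subr0 => hd; rewrite Q// ltr_pdivrMr ?cabs_gt0//.
apply: le_lt_trans (dH _ hd) _; rewrite ltr_pM2r ?cabs_gt0//.
by rewrite ltr_pdivrMr// ltr_pMr// ltr1n.
Qed.

Lemma derivable_is_deriveC (f : CC R -> CC R) (s : CC R) :
  derivable f s 1 -> is_derive s (1 : CC R) f (derive1 f s).
Proof. by move=> df; exact: (DeriveDef df (esym (derive1E f s))). Qed.
Lemma is_derive_derive1C (f : CC R -> CC R) (s l : CC R) :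
  is_derive s (1 : CC R) f l -> derive1 f s = l.
Proof. by case=> _ E; exact: (eq_trans (derive1E f s) E). Qed.

Lemma is_derive_continuousC (f : CC R -> CC R) (s l : CC R) :
  is_derive s (1 : CC R) f l -> {for s, continuous f}.
Proof.
case=> df _; exact/differentiable_continuous/derivable1_diffP.
Qed.

Lemma continuousCP (f : CC R -> CC R) (s : CC R) :
  {for s, continuous f} <-> forall e : R, 0 < e -> exists2 d : R, 0 < d &
    forall w, cabs (w - s) < d -> cabs (f w - f s) < e.
Proof.
split.
  by move=> /(@cvgCP _ (nbhs s) _ f (f s)) H e e0; have /nbhsCP := H _ e0.
by move=> H; apply/(@cvgCP _ (nbhs s) _ f (f s)) => e e0; exact/nbhsCP/H.
Qed.

Lemma is_derive_nbhsC (f g : CC R -> CC R) (s l : CC R) :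
  (\forall w \near s, f w = g w) -> is_derive s (1 : CC R) f l -> is_derive s (1 : CC R) g l.
Proof.
move=> /nbhsCP[e e0 fg] /is_deriveCP H; apply/is_deriveCP => e' e'0.
have [d d0 dH] := H _ e'0; exists (Num.min d e); first by rewrite lt_min d0.
move=> h; rewrite lt_min => /andP[hd he].
rewrite -!fg ?subrr ?cabs0//; last by rewrite addrAC subrr add0r.
exact: dH.
Qed.

Lemma regular_value_continuous (f g : CC R -> CC R) (s : CC R) :
  {for s, continuous g} -> (\forall w \near s^', f w = g w) -> regular_value f s = g s.
Proof.
move=> cg fg; rewrite /regular_value; apply/cvg_lim => //.
have gf : {near s^', g =1 f} by apply: filterS fg => w ->.
apply: cvg_trans (near_eq_cvg gf) _; exact: cvg_within_filter.
Qed.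

(** ** The exponential *)

Lemma cRe_cexp z : cRe (cexp z) = expR (cRe z) * cos (cIm z).
Proof. by rewrite /cexp !cE; ring. Qed.
Lemma cIm_cexp z : cIm (cexp z) = expR (cRe z) * sin (cIm z).
Proof. by rewrite /cexp !cE; ring. Qed.
Lemma cexpD z w : cexp (z + w) = cexp z * cexp w.
Proof.
apply: ceqP; rewrite ?(cReM, cImM, cRe_cexp, cIm_cexp) !cE expRD ?cosD ?sinD; ring.
Qed.
Lemma cexp0 : cexp (0 : CC R) = 1.
Proof. by apply: ceqP; rewrite ?(cRe_cexp, cIm_cexp) !cE expR0 ?cos0 ?sin0; ring. Qed.
Lemma cabs_cexp z : cabs (cexp z) = expR (cRe z).
Proof.
rewrite cabsE cRe_cexp cIm_cexp !exprMn -mulrDr cos2Dsin2 mulr1 sqrtr_sqr.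
by rewrite ger0_norm// expR_ge0.
Qed.
Lemma cexp_neq0 z : cexp z != 0.
Proof. by rewrite -cabs_gt0 cabs_cexp expR_gt0. Qed.
Lemma cexp_ofR x : cexp (ofR x) = ofR (expR x).
Proof. by apply: ceqP; rewrite ?cRe_cexp ?cIm_cexp !cE ?cos0 ?sin0; ring. Qed.
Lemma cexpX z n : cexp z ^+ n = cexp (n%:R * z).
Proof.
elim: n => [|n IH]; first by rewrite expr0 mul0r cexp0.
by rewrite exprS IH -cexpD -natr1 mulrDl mul1r addrC.
Qed.
Lemma cabs_cpow x z : cabs (cpow x z) = expR (cRe z * ln x).
Proof. by rewrite /cpow cabs_cexp !cE mulr0 subr0. Qed.

Lemma sin_le_abs x : `|sin x| <= `|x|.
Proof.
have [->|x0] := eqVneq x 0; first by rewrite sin0.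
have H y : 0 < y -> `|sin y| <= y.
  move=> y0; have [|c _] := @MVT R sin cos 0 y y0 (fun x _ => is_derive_sin x).
  - by move=> z; apply: continuous_subspaceT => u; exact: continuous_sin.
  rewrite sin0 !subr0 => ->; rewrite normrM (gtr0_norm y0).
  by rewrite ler_piMl ?(ltW y0)// ler_norml cos_geN1 cos_le1.
have [xp|xn] := ltrP 0 x; first by rewrite (gtr0_norm xp) H.
by rewrite (ler0_norm xn) -normrN -sinN H// oppr_gt0 lt_neqAle x0.
Qed.

Lemma cosB1 x : 1 - cos x = 2 * sin (x / 2) ^+ 2.
Proof.
by rewrite {1}(splitr x) cosD -!expr2 cos2sin2; ring.
Qed.

Lemma cos_lb x : 1 - x ^+ 2 / 2 <= cos x.
Proof.
rewrite lerBlDr -lerBlDl cosB1.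
have : sin (x / 2) ^+ 2 <= (x / 2) ^+ 2.
  rewrite -(real_normK (num_real (sin (x / 2)))) -(real_normK (num_real (x / 2))).
  by rewrite lerXn2r ?nnegrE ?normr_ge0// sin_le_abs.
by nra.
Qed.

Lemma sinB_le x : `|sin x - x| <= x ^+ 2.
Proof.
have H y : 0 < y -> `|sin y - y| <= y ^+ 2.
  move=> y0; have [|c] := @MVT R (fun u => sin u - u) (fun u => cos u - 1) 0 y y0
      (fun x _ => is_deriveB (is_derive_sin x) (is_derive_id x 1)).
  - move=> z; apply: continuous_subspaceT => u.
    by apply: cvgB; [exact: continuous_sin | exact: cvg_id].
  rewrite in_itv /= => /andP[c0 cy].
  rewrite sin0 !subr0 => ->; rewrite normrM (gtr0_norm y0) expr2.
  rewrite ler_pM2r//; apply: le_trans (ltW cy).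
  rewrite -opprB normrN cosB1 normrM normrX (ger0_norm (ler0n R 2)).
  have s1 : `|sin (c / 2)| <= 1 by rewrite ler_norml sin_geN1 sin_le1.
  have := sin_le_abs (c / 2); rewrite (ger0_norm (_ : 0 <= c / 2)); last by lra.
  move: s1 (normr_ge0 (sin (c / 2))); set q := `|_|; move=> s1 s2 s3.
  have : q ^+ 2 <= q by rewrite expr2 ler_piMl.
  by lra.
have [->|x0] := eqVneq x 0; first by rewrite sin0 subrr normr0 expr0n.
have [xp|xn] := ltrP 0 x; first by rewrite H.
have : 0 < - x by rewrite oppr_gt0 lt_neqAle x0.
by move=> /H; rewrite sinN -opprD normrN sqrrN.
Qed.

Lemma expR_sub1_ub x : expR x - 1 <= x * expR x.
Proof.
have h : (1 - x) * expR x <= 1.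
  by rewrite -ler_pdivlMr ?expR_gt0// div1r -expRN expR_ge1Dx.
by lra.
Qed.

Lemma expR_sub1_le x : `|expR x - 1| <= `|x| * expR `|x|.
Proof.
have [xp|xn] := leP 0 x.
  by rewrite (ger0_norm xp) ger0_norm ?expR_sub1_ub// subr_ge0 -expR0 ler_expR.
rewrite (ltr0_norm xn) ltr0_norm; last by rewrite subr_lt0 -expR0 ltr_expR.
have := expR_ge1Dx x; have : 1 <= expR (- x) by rewrite -expR0 ler_expR; lra.
by nra.
Qed.

Lemma expR_sub1B_le x : `|expR x - 1 - x| <= x ^+ 2 * expR `|x|.
Proof.
rewrite ger0_norm; last by have := expR_ge1Dx x; lra.
have h1 : expR x - 1 - x <= x * (expR x - 1) by have := expR_sub1_ub x; lra.
apply: le_trans h1 _; apply: le_trans (ler_norm _) _; rewrite normrM.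
rewrite -(real_normK (num_real x)) expr2 -mulrA ler_wpM2l//.
exact: expR_sub1_le.
Qed.

(** The real and imaginary parts reduce to the remainders of [expR], [cos] and
    [sin]. *)
Lemma cexp_sub1B_le z : cabs (cexp z - 1 - z) <= 5 * cabs z ^+ 2 * expR (cabs z).
Proof.
set x := cRe z; set y := cIm z.
pose e := cexp (im R * ofR y).
have zE : z = ofR x + im R * ofR y by exact: ccE.
have -> : cexp z - 1 - z = e * ofR (expR x - 1 - x) + (1 + ofR x) * (e - 1 - im R * ofR y)
    + im R * ofR (x * y).
  rewrite {1 2}zE cexpD cexp_ofR -/e !rmorphB rmorphM rmorph1 /=; ring.
have xz : `|x| <= cabs z := normRe_le z.
have yz : `|y| <= cabs z := normIm_le z.
have E1 : 1 <= expR (cabs z) by rewrite -expR0 ler_expR cabs_ge0.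
have E2 : 1 + `|x| <= expR (cabs z).
  by rewrite (le_trans (expR_ge1Dx _))// ler_expR.
have Ee : cabs e = 1 by rewrite cabs_cexp !cE; rewrite !(mul0r, mulr0, mul1r, subr0, expR0).
have e1 : cabs (e - 1 - im R * ofR y) <= 2 * cabs z ^+ 2.
  apply: le_trans (cabs_le _) _; rewrite /e !(cE, cRe_cexp, cIm_cexp).
  rewrite !(mul0r, mul1r, mulr0, subr0, add0r, expR0, addr0, subrr).
  have := sinB_le y; have := cos_lb y; have := cos_le1 y => h1 h2 h3.
  have : `|cos y - 1| <= y ^+ 2.
    by rewrite -opprB normrN ger0_norm ?subr_ge0//; have := sqr_ge0 y; lra.
  have : y ^+ 2 <= cabs z ^+ 2 by rewrite -(real_normK (num_real y)) lerXn2r// nnegrE cabs_ge0.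
  by lra.
have zz := cabs_ge0 z.
have x2 : x ^+ 2 <= cabs z ^+ 2 by rewrite -(real_normK (num_real x)) lerXn2r// nnegrE.
have T1 : cabs (e * ofR (expR x - 1 - x)) <= cabs z ^+ 2 * expR (cabs z).
  rewrite cabsM Ee mul1r cabs_ofR (le_trans (expR_sub1B_le _))//.
  by rewrite ler_pM ?sqr_ge0 ?expR_ge0// ler_expR.
have T2 : cabs ((1 + ofR x) * (e - 1 - im R * ofR y)) <= 2 * cabs z ^+ 2 * expR (cabs z).
  rewrite cabsM mulrC ler_pM ?cabs_ge0//.
  by rewrite (le_trans (cabsD _ _))// cabs1 cabs_ofR.
have T3 : cabs (im R * ofR (x * y)) <= cabs z ^+ 2 * expR (cabs z).
  rewrite cabsM cabs_im mul1r cabs_ofR normrM expr2.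
  by rewrite -[leLHS]mulr1 ler_pM// ?mulr_ge0// ler_pM.
apply: le_trans (cabsD _ _) _; apply: le_trans (lerD (cabsD _ _) (lexx _)) _.
have : 0 <= cabs z ^+ 2 * expR (cabs z) by rewrite mulr_ge0 ?sqr_ge0 ?expR_ge0.
by lra.
Qed.

(** The form in which integrals deliver a derivative: a quadratic remainder. *)
Lemma is_derive_quad (f : CC R -> CC R) (s l : CC R) (K r : R) : 0 < r ->
  (forall h, cabs h < r -> cabs (f (s + h) - f s - l * h) <= K * cabs h ^+ 2) ->
  is_derive s (1 : CC R) f l.
Proof.
move=> r0 H; apply/is_deriveCP => e e0.
have K0 : 0 < `|K| + 1 by have := normr_ge0 K; lra.
exists (Num.min r (e / (`|K| + 1))); first by rewrite lt_min r0 divr_gt0.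
move=> h; rewrite lt_min => /andP[hr he].
apply: le_trans (H _ hr) _; rewrite expr2 mulrA ler_wpM2r ?cabs_ge0//.
move: he; rewrite ltr_pdivlMr// => he; apply: le_trans (ltW he).
rewrite mulrC ler_wpM2l ?cabs_ge0//.
by have := ler_norm K; lra.
Qed.

Lemma is_derive_cexp z : is_derive z (1 : CC R) (@cexp R) (cexp z).
Proof.
apply: (@is_derive_quad _ _ _ (cabs (cexp z) * (5 * expR 1)) 1) => // h h1.
rewrite cexpD.
have -> : cexp z * cexp h - cexp z - cexp z * h = cexp z * (cexp h - 1 - h) by ring.
rewrite cabsM -mulrA ler_wpM2l ?cabs_ge0//.
apply: le_trans (cexp_sub1B_le _) _.
rewrite mulrAC ler_wpM2r ?sqr_ge0// ler_wpM2l// ler_expR ltW//.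
Qed.

Lemma is_derive_scaleC (f : CC R -> CC R) (b s l : CC R) :
  is_derive (b * s) (1 : CC R) f l ->
  is_derive s (1 : CC R) (fun w => f (b * w)) (l * b).
Proof.
move=> /is_deriveCP H; apply/is_deriveCP => e e0.
have b0 : 0 < cabs b + 1 by have := cabs_ge0 b; lra.
have [d d0 dH] := H _ (divr_gt0 e0 b0); exists (d / (cabs b + 1)).
  by rewrite divr_gt0.
move=> h; rewrite ltr_pdivlMr// => hd.
have bh : cabs (b * h) <= cabs h * (cabs b + 1).
  by rewrite cabsM mulrC ler_wpM2l ?cabs_ge0//; lra.
have := dH _ (le_lt_trans bh hd); rewrite -mulrDr -mulrA => /le_trans; apply.
rewrite mulrAC ler_pdivrMr// -mulrA ler_wpM2l// ltW//.
Qed.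

End ComplexBasics.

(** * Values of a punctured limit along the real axis *)

Section PuncturedLimit.
Context {R : realType}.
Implicit Types (G : CC R -> CC R).

Definition punctured_values G (x d : R) : set (CC R) :=
  [set v | exists w, [/\ w != ofR x, cabs (w - ofR x) < d & v = G w]].

(** After a move from [x] to a nearby [y], a smaller disc about [y] lies in the
    old one; its radius is also kept below [|x - y|], so that it avoids [x], at
    which [G] is not sampled by the old set. *)
Lemma punctured_values_open G (Q : set (CC R) -> Prop) :
  (forall A B : set (CC R), A `<=` B -> Q B -> Q A) ->
  open [set x : R | exists2 d, 0 < d & Q (punctured_values G x d)].
Proof.
move=> Qm; rewrite openE => x [d d0 Qd]; rewrite /interior /=.
apply/nbhs_ballP; exists d => // y; rewrite /ball /= => xy.
have [->|yx] := eqVneq y x; first by exists d.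
have xy0 : 0 < `|x - y| by rewrite normr_gt0 subr_eq0 eq_sym.
exists (Num.min `|x - y| (d - `|x - y|)).
  by rewrite lt_min xy0 subr_gt0.
apply: Qm Qd => v [w [wy wd ->]]; exists w.
move: wd; rewrite lt_min => /andP[w1 w2]; split => //.
  apply/eqP => wx; move: w1; rewrite wx -rmorphB cabs_ofR.
  by rewrite ltxx.
have -> : w - ofR x = (w - ofR y) + ofR (y - x) by rewrite rmorphB; ring.
apply: le_lt_trans (cabsD _ _) _; rewrite cabs_ofR distrC.
by rewrite -ltrBrDr.
Qed.

Lemma punctured_near G (x : R) (P : set (CC R)) :
  (\forall w \near (ofR x)^', P (G w)) <->
  exists2 d, 0 < d & punctured_values G x d `<=` P.
Proof.
split.
  move=> /dnbhsCP[d d0 H]; exists d => // v [w [wx wd ->]]; exact: H.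
move=> [d d0 H]; apply/dnbhsCP; exists d => // w wx wd; apply: H; exists w.
by split.
Qed.

Let osc (e : R) (S : set (CC R)) := forall a b, S a -> S b -> cabs (a - b) < e.

(** Cauchy's criterion, with the oscillations compared with a sequence, so that
    the points of convergence form a countable intersection. *)
Lemma punctured_cvgP G (x : R) :
  (cvg (G w @[w --> (ofR x)^'])) <->
  forall n, exists2 d, 0 < d & osc n.+1%:R^-1 (punctured_values G x d).
Proof.
split.
  move=> /cvg_ex[/= l /(@cvgCP _ _ ((ofR x)^') _ G l) H] n.
  have e0 : 0 < (n.+1%:R^-1 / 2 : R) by rewrite divr_gt0 ?invr_gt0.
  have /(punctured_near G x [set v | cabs (v - l) < n.+1%:R^-1 / 2])[d d0 dP] := H _ e0; exists d => // a b /dP ha /dP hb.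
  have -> : a - b = (a - l) - (b - l) by ring.
  by apply: le_lt_trans (cabsB _ _) _; rewrite (splitr n.+1%:R^-1) ltrD.
move=> H; have [e e0|l lP] := @cauchyC R _ ((ofR x)^') _ G; last by apply/cvg_ex; exists l.
have [n ne] : exists n, n.+1%:R^-1 < e.
  exists (Num.truncn e^-1); rewrite -[ltRHS]invrK ltf_pV2 ?posrE ?invr_gt0//.
  by rewrite truncnS_gt// ?ltW ?invr_gt0.
have [d d0 dP] := H n.
exists [set w | w != ofR x /\ cabs (w - ofR x) < d].
  by apply/dnbhsCP; exists d.
move=> u v [u1 u2] [v1 v2]; apply: lt_trans ne; apply: dP.
- by exists u.
- by exists v.
Qed.

(** Whatever the function [G], the points of the axis at which it has a limit
    form a countable intersection of open sets, on which the limit is a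
    continuous function of the point. *)
Lemma measurable_regular_value G (p : CC R -> R) :
  (forall z w, `|p z - p w| <= cabs (z - w)) ->
  measurable_fun [set: R] (fun x => p (regular_value G (ofR x))).
Proof.
move=> pL; apply: (measurability _ (measurable_realfun.RGenOInfty.measurableE R)) => //.
move=> /= _ [_ [a ->] <-]; rewrite setTI preimage_itvoy.
pose D := \bigcap_n [set x : R | exists2 d, 0 < d & osc n.+1%:R^-1 (punctured_values G x d)].
pose above (S : set (CC R)) := exists2 e, 0 < e & forall v, S v -> a + e < p v.
pose V := [set x : R | exists2 d, 0 < d & above (punctured_values G x d)].
have mV : measurable V.
  apply: open_measurable; apply: punctured_values_open => A B AB [e e0 H].
  by exists e => // v /AB /H.
have mD : measurable D.
  apply: bigcapT_measurable => n; apply: open_measurable.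
  by apply: punctured_values_open => A B AB H u v /AB Bu /AB; exact: H.
have DP x : D x <-> cvg (G w @[w --> (ofR x)^']).
  by rewrite punctured_cvgP; split => [H n|H n _]; exact: H.
have inD x : D x -> (a < p (regular_value G (ofR x))) <-> V x.
  move=> /DP/cvg_ex[/= l Gl].
  have -> : regular_value G (ofR x) = l by apply/cvg_lim.
  have pl (e : R) : 0 < e -> \forall w \near (ofR x)^', `|p (G w) - p l| < e.
    move=> e0; move/(@cvgCP _ _ ((ofR x)^') _ G l): Gl => /(_ _ e0).
    by apply: filterS => w; exact: le_lt_trans.
  split.
    move=> al; have e0 : 0 < (p l - a) / 2 by rewrite divr_gt0// subr_gt0.
    have /(punctured_near G x [set v | `|p v - p l| < _])[d d0 dP] := pl _ e0.
    exists d => //; exists ((p l - a) / 2) => // v /dP /=.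
    by rewrite ltr_norml => /andP[h _]; lra.
  move=> [d d0 [e e0 dP]].
  have : \forall w \near (ofR x)^', a + e < p (G w).
    by apply/(punctured_near G x [set v | a + e < p v]); exists d.
  move=> H; have := @filter_ex _ _ (Proper_dnbhs_numFieldType (ofR x)) _ (filterI H (pl _ e0)).
  by move=> [w [/= h1]]; rewrite ltr_norml => /andP[h2 h3]; lra.
have [a0|a0] := boolP (a < p 0).
  rewrite (_ : [set x | _] = (D `&` V) `|` ~` D).
    by apply: measurableU; [exact: measurableI | exact: measurableC].
  apply/seteqP; split => x /=.
    by move=> H; have [Dx|Dx] := pselect (D x); [left; split => //; exact/inD | right].
  move=> [[Dx Vx]|Dx]; first exact/inD.
  rewrite /regular_value dvgP//; exact: contra_not (DP x).2 Dx.
rewrite (_ : [set x | _] = (D `&` V)); first exact: measurableI.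
apply/seteqP; split => x /=.
  move=> H; have [Dx|Dx] := pselect (D x); first by split => //; exact/inD.
  move: H; rewrite /regular_value dvgP ?(negbTE a0)//; exact: contra_not (DP x).2 Dx.
by move=> [Dx Vx]; exact/inD.
Qed.

(** The limit can be computed along points of the axis other than the origin;
    where there is none the regularized value is 0. *)
Lemma regular_value_le G (B : R -> R) (x : R) : continuous B -> (forall y, 0 <= B y) ->
  (forall y, y != 0 -> cabs (G (ofR y)) <= B y) ->
  cabs (regular_value G (ofR x)) <= B x.
Proof.
move=> cB B0 GB.
have [/cvg_ex[/= l Gl]|dv] := pselect (cvg (G w @[w --> (ofR x)^'])); last first.
  by rewrite /regular_value dvgP// cabs0.
have -> : regular_value G (ofR x) = l by apply/cvg_lim.
apply/ler_addgt0Pr => e e0.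
move/(@cvgCP _ _ ((ofR x)^') _ G l): Gl => /(_ _ (divr_gt0 e0 (ltr0n R 2))).
move=> /dnbhsCP[d d0 dP].
have /cvgRP/(_ _ (divr_gt0 e0 (ltr0n R 2)))/nbhs_ballP[d' /= d'0 d'P] := cB x.
have [y [y0 yx yd]] : exists y : R, [/\ y != 0, y != x & `|y - x| < Num.min d d'].
  pose m := Num.min d d'; have m0 : 0 < m by rewrite lt_min d0.
  have [x0|x0] := eqVneq (x + m / 2) 0.
    exists (x + m / 3); split.
    - by apply/eqP => h; move: x0 => /eqP; rewrite -subr_eq0 => /eqP; lra.
    - by rewrite -subr_eq0 addrAC subrr add0r lt0r_neq0// divr_gt0.
    - by rewrite addrAC subrr add0r gtr0_norm ?divr_gt0//; rewrite -/m; lra.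
  exists (x + m / 2); split => //.
  - by rewrite -subr_eq0 addrAC subrr add0r lt0r_neq0// divr_gt0.
  - by rewrite addrAC subrr add0r gtr0_norm ?divr_gt0//; rewrite -/m; lra.
move: yd; rewrite lt_min => /andP[yd yd'].
have := dP (ofR y); rewrite -rmorphB cabs_ofR (inj_eq (@ofR_inj R)) => /(_ yx yd) h1.
have := d'P y; rewrite /ball /= distrC => /(_ yd') h2.
have -> : l = G (ofR y) - (G (ofR y) - l) by ring.
apply: le_trans (cabsB _ _) _.
move: h2; rewrite ltr_norml => /andP[_ h2]; have := GB y y0.
by lra.
Qed.

End PuncturedLimit.

(** * A square integrable majorant *)

Section Decay.
Context {R : realType}.

(** This is [(1 + |x|) ^ (- 3 / 4)]: its square is integrable, and it is the rate
    at which the digamma and Lerch differences are controlled. *)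
Definition decay (x : R) : R := (Num.sqrt (Num.sqrt (1 + `|x|)))^-1 ^+ 3.

Lemma decay_sqrt_gt0 (x : R) : 0 < Num.sqrt (Num.sqrt (1 + `|x|)).
Proof. by rewrite !sqrtr_gt0 ltr_wpDr. Qed.

Lemma decay_gt0 (x : R) : 0 < decay x.
Proof. by apply: exprn_gt0; rewrite invr_gt0 decay_sqrt_gt0. Qed.

Lemma decay_ge0 (x : R) : 0 <= decay x.
Proof. exact: ltW (decay_gt0 x). Qed.

Lemma cvg_sqrt {T : Type} (F : set_system T) {FF : Filter F} (f : T -> R) (l : R) :
  f u @[u --> F] --> l -> Num.sqrt (f u) @[u --> F] --> Num.sqrt l.
Proof. by move=> fl; apply: (cvg_comp _ _ fl (@sqrt_continuous R l)). Qed.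

Lemma continuous_decay : continuous decay.
Proof.
move=> x.
have c1 : (1 + `|u|) @[u --> x] --> (1 + `|x|).
  by apply: cvgD; [exact: cvg_cst | exact: norm_continuous].
have c2 : (Num.sqrt (Num.sqrt (1 + `|u|)))^-1 @[u --> x] --> (Num.sqrt (Num.sqrt (1 + `|x|)))^-1.
  by apply: cvgV; [exact: lt0r_neq0 (decay_sqrt_gt0 _) | apply: cvg_sqrt; apply: cvg_sqrt; exact: c1].
exact: (cvgM c2 (cvgM c2 c2)).
Qed.

Lemma continuous_sqr_decay : continuous (fun x => decay x ^+ 2).
Proof.
rewrite (_ : (fun x => _) = (fun x => decay x * decay x)); last first.
  by apply/funext => x; rewrite expr2.
by move=> x; apply: cvgM; exact: continuous_decay.
Qed.

Lemma sqr_decay (x : R) : decay x ^+ 2 = (Num.sqrt (1 + `|x|))^-1 ^+ 3.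
Proof.
by rewrite /decay exprAC; congr (_ ^+ 3); rewrite exprVn sqr_sqrtr ?sqrtr_ge0.
Qed.

(** A primitive of the square of [decay] on the positive axis. *)
Lemma is_derive_invsqrt (x : R) : 0 < x ->
  is_derive x (1 : R) (fun u => - 2 * (Num.sqrt (1 + u))^-1) ((Num.sqrt (1 + x))^-1 ^+ 3).
Proof.
move=> x0; have s0 : 0 < Num.sqrt (1 + x) by rewrite sqrtr_gt0; lra.
have d1 : is_derive x (1 : R) (fun u => 1 + u) (0 + 1) by exact: is_deriveD.
have d2 : is_derive x (1 : R) (Num.sqrt \o (fun u => 1 + u)) ((2 * Num.sqrt (1 + x))^-1 * (0 + 1)).
  by apply: is_derive1_comp; apply: is_derive1_sqrt; lra.
have d3 := @is_deriveV R (Num.sqrt \o (fun u => 1 + u)) _ _ _ (lt0r_neq0 s0) d2.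
have d4 := is_deriveZ (- 2) d3.
apply: is_derive_eq d4 _; rewrite /GRing.scale /=.
by field; rewrite lt0r_neq0.
Qed.

Lemma integral_sqr_decay : (\int[lebesgue_measure]_x ((decay x ^+ 2)%:E) < +oo)%E.
Proof.
have mf : measurable_fun [set: R] (fun x => (decay x ^+ 2)%:E).
  apply/measurable_EFinP; apply: continuous_measurable_fun.
  exact: continuous_sqr_decay.
have f0 x : (0 <= (decay x ^+ 2)%:E)%E by rewrite lee_fin sqr_ge0.
have I1 : (\int[lebesgue_measure]_(x in `[0%R, +oo[) ((decay x ^+ 2)%:E) < +oo)%E.
  rewrite (@ge0_continuous_FTC2y _ (fun x => decay x ^+ 2)
     (fun u => - 2 * (Num.sqrt (1 + u))^-1) 0 0); first exact: ltry.
  - by move=> x _; exact: sqr_ge0.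
  - exact/continuous_subspaceT/continuous_sqr_decay.
  - rewrite -[X in _ --> X](mulr0 (- 2)); apply: cvgM; first exact: cvg_cst.
    apply/cvgRP => e e0; exists ((e^-1) ^+ 2); split; first by rewrite num_real.
    move=> x ex; rewrite subr0 gtr0_norm ?invr_gt0 ?sqrtr_gt0; last first.
      by have := sqr_ge0 e^-1; lra.
    rewrite -[ltRHS]invrK ltf_pV2 ?posrE ?invr_gt0 ?sqrtr_gt0//; last first.
      by have := sqr_ge0 e^-1; lra.
    rewrite -[ltLHS]ger0_norm ?invr_ge0 ?(ltW e0)// -sqrtr_sqr ltr_sqrt; first by lra.
    by have := sqr_ge0 e^-1; lra.
  - by move=> x x0; case: (is_derive_invsqrt x0).
  - apply: cvg_at_right_filter.
    apply: cvgM; first exact: cvg_cst.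
    apply: cvgV; first by rewrite addr0 sqrtr1 oner_neq0.
    by apply: cvg_sqrt; apply: cvgD; [exact: cvg_cst | exact: cvg_id].
  - move=> x; rewrite in_itv /= andbT => x0.
    rewrite derive1E (@derive_val _ _ _ _ _ _ _ (is_derive_invsqrt x0)) sqr_decay.
    by rewrite gtr0_norm.
have E : [set: R] = `]-oo, 0%R[ `|` `[0%R, +oo[.
  by rewrite -setCitvl setUv.
rewrite [X in integral _ X]E ge0_integral_setU//=.
- apply: lte_add_pinfty => //.
  apply: (@le_lt_trans _ _ (\int[lebesgue_measure]_(x in `]-oo, 0%R]) ((decay x ^+ 2)%:E))%E).
    apply: ge0_subset_integral => //; first exact: measurable_funTS.
    by move=> x /=; rewrite !in_itv /=; exact: ltW.
  move: I1; rewrite (ge0_integration_by_substitution0 mf f0).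
  by under eq_integral do rewrite sqr_decay normrN -sqr_decay.
- by rewrite -E.
- by apply/disj_setPS => y [/=]; rewrite 2!in_itv/= andbT ltNge => /negP.
Qed.

Lemma in_L2_decay (f : R -> CC R) (C : R) :
  measurable_fun [set: R] (fun x => cRe (f x)) ->
  measurable_fun [set: R] (fun x => cIm (f x)) ->
  (forall x, cabs (f x) <= C * decay x) -> in_L2 f.
Proof.
move=> m1 m2 fC; split => //.
have mc : measurable_fun [set: R] (fun x => cRe `|f x|).
  under eq_fun do rewrite [cRe _]cabsE.
  have ms : measurable_fun [set: R] (fun x => cRe (f x) ^+ 2 + cIm (f x) ^+ 2).
    by apply: measurable_funD; exact: measurable_funX.
  exact: (measurableT_comp (continuous_measurable_fun (@sqrt_continuous R)) ms).
have C0 : 0 <= C.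
  by have := le_trans (cabs_ge0 _) (fC 0); rewrite pmulr_lge0 ?decay_gt0.
have gC x : `|cRe `|f x| | <= C * decay x 
  by move: (fC x); rewrite -[X in X <= _ -> _](ger0_norm (cabs_ge0 (f x))).
set g := (fun x => cRe `|f x|) in mc *; have mg : measurable_fun [set: R] g := mc.
have {}gC x : `|g x| <= C * decay x := gC x; clearbody g.
have {mg}mg : measurable_fun [set: R] (fun x => (`|g x| `^ 2)%:E).
  apply/measurable_EFinP.
  exact: (measurableT_comp (measurable_powR 2) (measurableT_comp (@normr_measurable R setT) mg)).
have md : measurable_fun [set: R] (fun x => (decay x ^+ 2)%:E).
  apply/measurable_EFinP; exact: continuous_measurable_fun continuous_sqr_decay.
rewrite /finite_norm unlock poweR_lty//.
apply: (@le_lt_trans _ _ (\int[lebesgue_measure]_x ((C ^+ 2)%:E * (decay x ^+ 2)%:E))%E).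
  apply: ge0_le_integral => //.
  - by move=> x _; rewrite lee_fin powR_ge0.
  - by apply: emeasurable_funM => //; exact: measurable_cst.
  - move=> x _.
    rewrite -EFinM lee_fin powR_mulrn ?normr_ge0// -exprMn.
    by rewrite lerXn2r ?nnegrE ?normr_ge0 ?mulr_ge0 ?decay_ge0.
rewrite ge0_integralZl//.
- by apply: lte_mul_pinfty; rewrite ?lee_fin ?sqr_ge0//; exact: integral_sqr_decay.
- by move=> x _; rewrite lee_fin sqr_ge0.
- by rewrite lee_fin sqr_ge0.
Qed.

End Decay.

(** * Integrals of complex valued functions of a real variable *)

Section ComplexIntegral.
Context {R : realType}.
Notation mu := (@lebesgue_measure R).
Implicit Types (D : set R) (f g : R -> R) (F G : R -> CC R).

Definition rintegrable D f := mu.-integrable D (EFin \o f).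
Definition rint D f : R := \int[mu]_(x in D) f x.

Definition cmeasurable D F :=
  measurable_fun D (fun x => cRe (F x)) /\ measurable_fun D (fun x => cIm (F x)).
Definition cintegrable D F :=
  rintegrable D (fun x => cRe (F x)) /\ rintegrable D (fun x => cIm (F x)).
Definition cint D F : CC R :=
  Complex (rint D (fun x => cRe (F x))) (rint D (fun x => cIm (F x))).

Lemma cRe_cint D F : cRe (cint D F) = rint D (fun x => cRe (F x)). Proof. by []. Qed.
Lemma cIm_cint D F : cIm (cint D F) = rint D (fun x => cIm (F x)). Proof. by []. Qed.

Lemma eq_rint D f g : (forall x, D x -> f x = g x) -> rint D f = rint D g.
Proof. by move=> fg; apply: eq_Rintegral => x /[!inE]; exact: fg. Qed.

Lemma eq_rintegrable D f g : (forall x, D x -> f x = g x) -> measurable D ->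
  rintegrable D f -> rintegrable D g.
Proof.
move=> fg mD; apply: (@eq_integrable _ _ R mu D mD) => x /[!inE] Dx; rewrite /= fg//.
Qed.

Lemma rintegrable_measurable D f : rintegrable D f -> measurable_fun D f.
Proof. by move=> /integrableP[] /measurable_EFinP. Qed.

Lemma rintegrable_le D f g : measurable D -> measurable_fun D f ->
  (forall x, D x -> `|f x| <= g x) -> rintegrable D g -> rintegrable D f.
Proof.
move=> mD mf fg; apply: le_integrable => //; first exact/measurable_EFinP.
by move=> x Dx /=; rewrite lee_fin (le_trans (fg _ Dx))// ler_norm.
Qed.

Lemma rintegrableD D f g : measurable D -> rintegrable D f -> rintegrable D g ->
  rintegrable D (fun x => f x + g x).
Proof. by move=> mD If Ig; exact: (@integrableD _ _ R mu D mD _ _ If Ig). Qed.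
Lemma rintegrableB D f g : measurable D -> rintegrable D f -> rintegrable D g ->
  rintegrable D (fun x => f x - g x).
Proof. by move=> mD If Ig; exact: (@integrableB _ _ R mu D mD _ _ If Ig). Qed.
Lemma rintegrableZ D (k : R) f : measurable D -> rintegrable D f ->
  rintegrable D (fun x => k * f x).
Proof. by move=> mD If; exact: (@integrableZl _ _ R mu D mD k _ If). Qed.

Lemma rintD D f g : measurable D -> rintegrable D f -> rintegrable D g ->
  rint D (fun x => f x + g x) = rint D f + rint D g.
Proof. by move=> *; exact: RintegralD. Qed.
Lemma rintB D f g : measurable D -> rintegrable D f -> rintegrable D g ->
  rint D (fun x => f x - g x) = rint D f - rint D g.
Proof. by move=> *; exact: RintegralB. Qed.
Lemma rintZ D (k : R) f : measurable D -> rintegrable D f ->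
  rint D (fun x => k * f x) = k * rint D f.
Proof. by move=> *; exact: RintegralZl. Qed.
Lemma le_rint D f g : measurable D -> rintegrable D f -> rintegrable D g ->
  (forall x, D x -> f x <= g x) -> rint D f <= rint D g.
Proof. by move=> *; exact: le_Rintegral. Qed.
Lemma rint_ge0 D f : (forall x, D x -> 0 <= f x) -> 0 <= rint D f.
Proof. by move=> f0; rewrite /rint; apply: Rintegral_ge0. Qed.

Lemma eq_cint D F G : (forall x, D x -> F x = G x) -> cint D F = cint D G.
Proof. by move=> FG; congr Complex; apply: eq_rint => x Dx; rewrite FG. Qed.
Lemma eq_cintegrable D F G : (forall x, D x -> F x = G x) -> measurable D ->
  cintegrable D F -> cintegrable D G.
Proof.
move=> FG mD [I1 I2]; split.
  by apply: eq_rintegrable I1 => // x Dx; rewrite FG.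
by apply: eq_rintegrable I2 => // x Dx; rewrite FG.
Qed.

Lemma cintegrable_le D F g : measurable D -> cmeasurable D F ->
  (forall x, D x -> cabs (F x) <= g x) -> rintegrable D g -> cintegrable D F.
Proof.
move=> mD [m1 m2] Fg Ig; split; apply: (rintegrable_le (g := g)) => // x Dx.
  exact: le_trans (normRe_le _) (Fg _ Dx).
exact: le_trans (normIm_le _) (Fg _ Dx).
Qed.

Lemma cintegrableD D F G : measurable D -> cintegrable D F -> cintegrable D G ->
  cintegrable D (fun x => F x + G x).
Proof.
move=> mD [F1 F2] [G1 G2]; split.
  by apply: eq_rintegrable (rintegrableD mD F1 G1) => // x _; rewrite cReD.
by apply: eq_rintegrable (rintegrableD mD F2 G2) => // x _; rewrite cImD.
Qed.
Lemma cintegrableZ D (c : CC R) F : measurable D -> cintegrable D F ->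
  cintegrable D (fun x => c * F x).
Proof.
move=> mD [F1 F2]; split.
  apply: eq_rintegrable (rintegrableB mD (rintegrableZ (cRe c) mD F1)
    (rintegrableZ (cIm c) mD F2)) => // x _; by rewrite cReM.
apply: eq_rintegrable (rintegrableD mD (rintegrableZ (cRe c) mD F2)
  (rintegrableZ (cIm c) mD F1)) => // x _; by rewrite cImM.
Qed.
Lemma cintegrableN D F : measurable D -> cintegrable D F -> cintegrable D (fun x => - F x).
Proof.
move=> mD IF; apply: eq_cintegrable (cintegrableZ (-1) mD IF) => // x _.
by rewrite mulN1r.
Qed.
Lemma cintegrableB D F G : measurable D -> cintegrable D F -> cintegrable D G ->
  cintegrable D (fun x => F x - G x).
Proof. by move=> mD IF IG; exact: cintegrableD (cintegrableN _ _). Qed.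

Lemma cintD D F G : measurable D -> cintegrable D F -> cintegrable D G ->
  cint D (fun x => F x + G x) = cint D F + cint D G.
Proof.
move=> mD [F1 F2] [G1 G2]; apply: ceqP; rewrite ?cE !(cRe_cint, cIm_cint) -rintD//;
  by apply: eq_rint => x _; rewrite ?cE.
Qed.
Lemma cintZ D (c : CC R) F : measurable D -> cintegrable D F ->
  cint D (fun x => c * F x) = c * cint D F.
Proof.
move=> mD [F1 F2]; apply: ceqP; rewrite ?cE !(cRe_cint, cIm_cint).
  rewrite -!rintZ// -rintB; try exact: rintegrableZ; last by [].
  by apply: eq_rint => x _; rewrite cReM.
rewrite -!rintZ// -rintD; try exact: rintegrableZ; last by [].
by apply: eq_rint => x _; rewrite cImM.
Qed.
Lemma cintN D F : measurable D -> cintegrable D F -> cint D (fun x => - F x) = - cint D F.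
Proof.
move=> mD IF; rewrite -mulN1r -cintZ//; apply: eq_cint => x _; by rewrite mulN1r.
Qed.
Lemma cintB D F G : measurable D -> cintegrable D F -> cintegrable D G ->
  cint D (fun x => F x - G x) = cint D F - cint D G.
Proof. by move=> mD IF IG; rewrite cintD// ?cintN//; exact: cintegrableN. Qed.

Lemma cint_ofR D f : cint D (fun x => ofR (f x)) = ofR (rint D f).
Proof.
apply: ceqP; rewrite ?cE ?cRe_cint ?cIm_cint; first exact: eq_rint.
rewrite (@eq_rint _ _ (cst 0)) /rint; last by [].
by rewrite /Rintegral integral0_eq.
Qed.
Lemma cintegrable_ofR D f : measurable D -> rintegrable D f -> cintegrable D (fun x => ofR (f x)).
Proof.
move=> mD If; split => //; apply: eq_rintegrable (rintegrableZ 0 mD If) => // x _.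
by rewrite mul0r cIm_ofR.
Qed.

(** Rotating the integral to the positive axis reduces the triangle inequality
    to the monotonicity of the real integral. *)
Lemma cabs_cint_le D F g : measurable D -> cintegrable D F -> rintegrable D g ->
  (forall x, D x -> cabs (F x) <= g x) -> cabs (cint D F) <= rint D g.
Proof.
move=> mD IF Ig Fg; set z := cint D F.
have [z0|z0] := eqVneq z 0.
  rewrite z0 cabs0; apply: rint_ge0 => x Dx; exact: le_trans (cabs_ge0 _) (Fg _ Dx).
pose c := cconj z / ofR (cabs z).
have az : cabs z != 0 by rewrite cabs_eq0.
have oz : ofR (cabs z) != 0 by rewrite -(rmorph0 (@ofR R)) (inj_eq (@ofR_inj R)).
have cc : cabs c = 1.
  by rewrite cabsM cabs_conj cabsV cabs_ofR ger0_norm ?cabs_ge0// divff.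
have -> : cabs z = cRe (c * z).
  have -> : c * z = ofR (cabs z).
    apply: (mulIf oz); rewrite /c mulrAC divfK//.
    apply: ceqP; rewrite !cE; last by ring.
    by have := sqr_cabs z; rewrite !expr2 => ->; ring.
  by [].
rewrite -cintZ// cRe_cint; apply: le_rint => //.
  by case: (cintegrableZ c mD IF).
by move=> x Dx; rewrite (le_trans (cRe_le _))// cabsM cc mul1r Fg.
Qed.

Lemma rintegrable_compact (a b : R) f : {within `[a, b], continuous f} -> rintegrable `[a, b] f.
Proof. by move=> cf; apply: continuous_compact_integrable => //; exact: segment_compact. Qed.

Lemma cintegrable_compact (a b : R) F :
  {within `[a, b], continuous (fun x => cRe (F x))} ->
  {within `[a, b], continuous (fun x => cIm (F x))} -> cintegrable `[a, b] F.
Proof. by move=> c1 c2; split; exact: rintegrable_compact. Qed.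

Lemma rint_split (a m b : R) f : a <= m -> m <= b -> rintegrable `[a, b] f ->
  rint `[a, b] f = rint `[a, m] f + rint `[m, b] f.
Proof.
move=> am mb If; have := @Rintegral_itvB R f (BLeft a) (BRight b) m If.
rewrite !bnd_simp => /(_ am mb) E; rewrite /rint.
rewrite -(@Rintegral_itv_obnd_cbnd _ m (BRight b)); last first.
  apply: integrableS If => //; apply: subset_itvr; rewrite bnd_simp//.
by rewrite -E addrC subrK.
Qed.

Lemma cint_split (a m b : R) F : a <= m -> m <= b -> cintegrable `[a, b] F ->
  cint `[a, b] F = cint `[a, m] F + cint `[m, b] F.
Proof.
move=> am mb [I1 I2]; apply: ceqP; rewrite ?cE !(cRe_cint, cIm_cint); exact: rint_split.
Qed.

Lemma rint_cst (a b k : R) : a <= b -> rint `[a, b] (fun=> k) = k * (b - a).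
Proof.
move=> ab; rewrite /rint Rintegral_cst//= lebesgue_measure_itv/= lte_fin.
case: ltP => //= ba; rewrite (@le_anti _ _ b a) ?ab ?ba// subrr//.
Qed.
Lemma rintegrable_cst (a b k : R) : rintegrable `[a, b] (fun=> k).
Proof. by apply: rintegrable_compact; apply: continuous_subspaceT => x; exact: cst_continuous. Qed.
Lemma cint_cst (a b : R) (k : CC R) : a <= b -> cint `[a, b] (fun=> k) = k * ofR (b - a).
Proof.
move=> ab; apply: ceqP; rewrite !cE ?(cRe_cint, cIm_cint) rint_cst//; ring.
Qed.

(** Measure preserving changes of variable; below, translations and the
    reflection. *)
Lemma rint_comp (phi : R -> R) f : measurable_fun [set: R] phi ->
  (forall A : set (measurableTypeR R), measurable A ->
     pushforward mu (phi : measurableTypeR R -> measurableTypeR R) A = mu A) ->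
  measurable_fun [set: R] f ->
  rintegrable setT (fun x => f (phi x)) ->
  rintegrable setT f /\ rint setT f = rint setT (fun x => f (phi x)).
Proof.
move=> mphi mmu mf If; have mf' : measurable_fun [set: measurableTypeR R] (EFin \o f) by exact/measurable_EFinP.
have I1 := @integrable_pushforward _ _ (measurableTypeR R) (measurableTypeR R) R
  (phi : measurableTypeR R -> measurableTypeR R) mphi mu setT (EFin \o f) mf' If measurableT.
have E1 := @integral_pushforward _ _ (measurableTypeR R) (measurableTypeR R) R
  (phi : measurableTypeR R -> measurableTypeR R) mphi mu setT (EFin \o f) mf' If measurableT.
have Em (g : R -> \bar R) : (\int[pushforward mu (phi : measurableTypeR R -> measurableTypeR R)]_(y in setT) g y
     = \int[mu]_(y in setT) g y)%E.
  by apply: eq_measure_integral => A mA _; exact: mmu.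
split.
  move/integrableP : I1 => [m1 i1]; apply/integrableP; split => //.
  by rewrite -Em.
by rewrite /rint /Rintegral -Em E1.
Qed.

Lemma lebesgue_measure_shift (a : R) (A : set (measurableTypeR R)) : measurable A ->
  pushforward mu ((fun x => x + a) : measurableTypeR R -> measurableTypeR R) A = mu A.
Proof.
move=> mA; apply/esym.
have mphi : measurable_fun [set: measurableTypeR R] ((fun x => x + a) : measurableTypeR R -> measurableTypeR R).
  by apply: measurable_funD.
have := @lebesgue_measure_unique R (pushforward mu ((fun x => x + a) : measurableTypeR R -> measurableTypeR R)).
apply => // _ [[u v]] _ <-.
have E : (fun x : R => x + a) @^-1` `]u, v]%classic = `]u - a, v - a]%classic.
  by apply/seteqP; split => x /=; rewrite !in_itv /= ltrBlDr lerBrDr.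
rewrite [RHS](_ : _ = mu ((fun x : R => x + a) @^-1` `]u, v]%classic)) // E.
rewrite !lebesgue_measure_itv /= !lte_fin ltrD2r; case: ltP => // _.
by rewrite -!EFinD; congr (_%:E); ring.
Qed.

Lemma rint_shift (a : R) f : measurable_fun [set: R] f ->
  rintegrable setT (fun x => f (x + a)) ->
  rintegrable setT f /\ rint setT f = rint setT (fun x => f (x + a)).
Proof.
move=> mf If; apply: rint_comp => //; first exact: measurable_funD.
exact: lebesgue_measure_shift.
Qed.

Lemma cint_shift (a : R) F : cmeasurable setT F ->
  cintegrable setT (fun x => F (x + a)) ->
  cintegrable setT F /\ cint setT F = cint setT (fun x => F (x + a)).
Proof.
move=> [m1 m2] [I1 I2]; have [J1 E1] := rint_shift m1 I1; have [J2 E2] := rint_shift m2 I2.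
by split; [split | congr Complex].
Qed.

Lemma rint_opp f : measurable_fun [set: R] f ->
  rintegrable setT (fun x => f (- x)) ->
  rintegrable setT f /\ rint setT f = rint setT (fun x => f (- x)).
Proof.
move=> mf If; apply: rint_comp => //; exact: lebesgue_measureN.
Qed.

Lemma cint_opp F : cmeasurable setT F ->
  cintegrable setT (fun x => F (- x)) ->
  cintegrable setT F /\ cint setT F = cint setT (fun x => F (- x)).
Proof.
move=> [m1 m2] [I1 I2]; have [J1 E1] := rint_opp m1 I1; have [J2 E2] := rint_opp m2 I2.
by split; [split | congr Complex].
Qed.

End ComplexIntegral.

(** * Cauchy's theorem on rectangles and unique continuation *)

Section Cauchy.
Context {R : realType}.
Implicit Types (f g : CC R -> CC R) (p : CC R) (a b c d : R).

Definition zc (x y : R) : CC R := ofR x + im R * ofR y.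

Lemma cRe_zc x y : cRe (zc x y) = x. Proof. by rewrite /zc !cE; ring. Qed.
Lemma cIm_zc x y : cIm (zc x y) = y. Proof. by rewrite /zc !cE; ring. Qed.
Lemma zcE p : p = zc (cRe p) (cIm p). Proof. exact: ccE. Qed.

Definition in_rect a b c d p := [&& a <= cRe p, cRe p <= b, c <= cIm p & cIm p <= d].

Lemma in_rect_zc a b c d x y :
  in_rect a b c d (zc x y) = [&& a <= x, x <= b, c <= y & y <= d].
Proof. by rewrite /in_rect cRe_zc cIm_zc. Qed.

Definition hint f a b y := cint `[a, b] (fun x => f (zc x y)).
Definition vint f c d x := cint `[c, d] (fun y => f (zc x y)).

(** The integral of [f] along the boundary of the rectangle [a, b] x [c, d],
    in the positive direction. *)
Definition rect f a b c d : CC R :=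
  hint f a b c + im R * vint f c d b - hint f a b d - im R * vint f c d a.

Lemma continuous_zc_h y : continuous (fun x => zc x y).
Proof.
move=> x; apply/(@cvgCP _ _ (nbhs x)) => e e0.
apply/nbhs_ballP; exists e => // u; rewrite /ball /= => xu.
have -> : zc u y - zc x y = ofR (u - x) by rewrite /zc rmorphB; ring.
by rewrite cabs_ofR distrC.
Qed.
Lemma continuous_zc_v x : continuous (zc x).
Proof.
move=> y; apply/(@cvgCP _ _ (nbhs y)) => e e0.
apply/nbhs_ballP; exists e => // u; rewrite /ball /= => xu.
have -> : zc x u - zc x y = im R * ofR (u - y) by rewrite /zc rmorphB; ring.
by rewrite cabsM cabs_im mul1r cabs_ofR distrC.
Qed.

Lemma continuous_path f (phi : R -> CC R) (h : CC R -> R) a b : continuous phi ->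
  (forall z w, `|h z - h w| <= cabs (z - w)) ->
  (forall x, a <= x <= b -> {for phi x, continuous f}) ->
  {within `[a, b], continuous (fun x => h (f (phi x)))}.
Proof.
move=> cphi hL cf; apply: continuous_in_subspaceT => x; rewrite inE /= in_itv /= => xab.
have /continuousCP H := cf _ xab.
apply/(@cvgRP _ _ (nbhs x)) => e e0; have [dl d0 dH] := H _ e0.
have /(@cvgCP _ _ (nbhs x))/(_ _ d0) := cphi x; apply: filterS => u ud.
exact: le_lt_trans (hL _ _) (dH _ ud).
Qed.

Lemma cRe_lip (z w : CC R) : `|cRe z - cRe w| <= cabs (z - w).
Proof. by rewrite -cReB normRe_le. Qed.
Lemma cIm_lip (z w : CC R) : `|cIm z - cIm w| <= cabs (z - w).
Proof. by rewrite -cImB normIm_le. Qed.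

Lemma cintegrable_path f (phi : R -> CC R) a b : continuous phi ->
  (forall x, a <= x <= b -> {for phi x, continuous f}) ->
  cintegrable `[a, b] (fun x => f (phi x)).
Proof.
move=> cphi cf; apply: cintegrable_compact; apply: continuous_path => //.
  exact: cRe_lip.
exact: cIm_lip.
Qed.

Lemma bounded_path f (phi : R -> CC R) a b : continuous phi ->
  (forall x, a <= x <= b -> {for phi x, continuous f}) ->
  exists2 M : R, 0 <= M & forall x, a <= x <= b -> cabs (f (phi x)) <= M.
Proof.
move=> cphi cf; have [ab|ba] := leP a b; last first.
  by exists 0 => // x /andP[ax xb]; have := le_trans ax xb; rewrite leNgt ba.
have [m mab mM] := EVT_max ab (continuous_path cphi (@cabs_dist R) cf).
exists (cabs (f (phi m))); first exact: cabs_ge0.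
by move=> x xab; apply: mM; rewrite in_itv.
Qed.

Definition cont_on f a b c d := forall p, in_rect a b c d p -> {for p, continuous f}.

Lemma hintegrable f a b c d y : cont_on f a b c d -> c <= y -> y <= d ->
  cintegrable `[a, b] (fun x => f (zc x y)).
Proof.
move=> cf cy yd; apply: (@cintegrable_path f (fun x => zc x y)); first exact: continuous_zc_h.
by move=> x /andP[ax xb]; apply: cf; rewrite in_rect_zc ax xb cy.
Qed.
Lemma vintegrable f a b c d x : cont_on f a b c d -> a <= x -> x <= b ->
  cintegrable `[c, d] (fun y => f (zc x y)).
Proof.
move=> cf ax xb; apply: (@cintegrable_path f (zc x)); first exact: continuous_zc_v.
by move=> y /andP[cy yd]; apply: cf; rewrite in_rect_zc ax xb cy.
Qed.

Lemma cont_onS f a b c d a' b' c' d' : a <= a' -> b' <= b -> c <= c' -> d' <= d ->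
  cont_on f a b c d -> cont_on f a' b' c' d'.
Proof.
move=> aa bb cc dd cf p /and4P[p1 p2 p3 p4]; apply: cf.
by rewrite /in_rect (le_trans aa) ?(le_trans p2) ?(le_trans cc) ?(le_trans p4).
Qed.

Lemma rect_hsplit f a m b c d : a <= m -> m <= b -> c <= d -> cont_on f a b c d ->
  rect f a b c d = rect f a m c d + rect f m b c d.
Proof.
move=> am mb cd cf; rewrite /rect /hint !(cint_split am mb); last 2 first.
- exact: hintegrable cf _ _.
- exact: hintegrable cf _ _.
ring.
Qed.

Lemma rect_vsplit f a b c m d : a <= b -> c <= m -> m <= d -> cont_on f a b c d ->
  rect f a b c d = rect f a b c m + rect f a b m d.
Proof.
move=> ab cm md cf; rewrite /rect /vint !(cint_split cm md); last 2 first.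
- exact: vintegrable cf _ _.
- exact: vintegrable cf _ _.
ring.
Qed.

Lemma itvmem (a b x : R) : `[a, b]%classic x -> a <= x /\ x <= b.
Proof. by rewrite /= in_itv /= => /andP. Qed.

(** The boundary of the rectangle, for a point of the rectangle. *)
Definition on_side a b c d p := cRe p = a \/ cRe p = b \/ cIm p = c \/ cIm p = d.

Definition cont_bd f a b c d :=
  forall p, in_rect a b c d p -> on_side a b c d p -> {for p, continuous f}.

Lemma cont_on_bd f a b c d : cont_on f a b c d -> cont_bd f a b c d.
Proof. by move=> cf p pin _; exact: cf. Qed.

Lemma hintegrable_bd f a b c d y : cont_bd f a b c d -> c <= d -> y = c \/ y = d ->
  cintegrable `[a, b] (fun x => f (zc x y)).
Proof.
move=> cf cd ycd; apply: (@cintegrable_path f (fun x => zc x y)); first exact: continuous_zc_h.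
move=> x /andP[ax xb]; apply: cf.
  by rewrite in_rect_zc ax xb; case: ycd => ->; rewrite lexx cd.
by rewrite /on_side cIm_zc; tauto.
Qed.
Lemma vintegrable_bd f a b c d x : cont_bd f a b c d -> a <= b -> x = a \/ x = b ->
  cintegrable `[c, d] (fun y => f (zc x y)).
Proof.
move=> cf ab xab; apply: (@cintegrable_path f (zc x)); first exact: continuous_zc_v.
move=> y /andP[cy yd]; apply: cf.
  by rewrite in_rect_zc cy yd; case: xab => ->; rewrite lexx ab.
by rewrite /on_side cRe_zc; tauto.
Qed.

Lemma rect_le f a b c d (M : R) : a <= b -> c <= d -> cont_bd f a b c d ->
  (forall p, in_rect a b c d p -> on_side a b c d p -> cabs (f p) <= M) ->
  cabs (rect f a b c d) <= M * (2 * ((b - a) + (d - c))).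
Proof.
move=> ab cd cf fM.
have h y : y = c \/ y = d -> cabs (hint f a b y) <= M * (b - a).
  move=> ycd; rewrite -(rint_cst M ab); apply: cabs_cint_le => //.
  - exact: hintegrable_bd cf cd ycd.
  - exact: rintegrable_cst.
  - move=> x /itvmem[ax xb]; apply: fM; last by rewrite /on_side cIm_zc; tauto.
    by rewrite in_rect_zc ax xb; case: ycd => ->; rewrite lexx cd.
have v x : x = a \/ x = b -> cabs (im R * vint f c d x) <= M * (d - c).
  move=> xab; rewrite cabsM cabs_im mul1r -(rint_cst M cd); apply: cabs_cint_le => //.
  - exact: vintegrable_bd cf ab xab.
  - exact: rintegrable_cst.
  - move=> y /itvmem[cy yd]; apply: fM; last by rewrite /on_side cRe_zc; tauto.
    by rewrite in_rect_zc cy yd; case: xab => ->; rewrite lexx ab.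
rewrite /rect.
have h1 := h c (or_introl erefl); have h2 := h d (or_intror erefl).
have v1 := v a (or_introl erefl); have v2 := v b (or_intror erefl).
apply: le_trans (cabsB _ _) _; apply: le_trans (lerD (cabsB _ _) (lexx _)) _.
apply: le_trans (lerD (lerD (cabsD _ _) (lexx _)) (lexx _)) _.
have -> : M * (2 * ((b - a) + (d - c))) =
  M * (b - a) + M * (d - c) + M * (b - a) + M * (d - c) by ring.
by apply: lerD v1; apply: lerD h2; apply: lerD v2.
Qed.

Lemma eq_rect_int f g a b c d : a <= b -> c <= d ->
  (forall p, in_rect a b c d p -> on_side a b c d p -> f p = g p) ->
  rect f a b c d = rect g a b c d.
Proof.
move=> ab cd fg; rewrite /rect /hint /vint.
congr (_ + im R * _ - _ - im R * _); apply: eq_cint => x /itvmem[x1 x2]; apply: fg;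
  rewrite /on_side ?in_rect_zc ?cRe_zc ?cIm_zc ?x1 ?x2 ?lexx ?ab ?cd //; tauto.
Qed.

Lemma rectB f g a b c d : a <= b -> c <= d -> cont_bd f a b c d -> cont_bd g a b c d ->
  rect (fun z => f z - g z) a b c d = rect f a b c d - rect g a b c d.
Proof.
move=> ab cd cf cg; rewrite /rect /hint /vint !cintB//; try by
  first [apply: (hintegrable_bd cf) => //; tauto | apply: (hintegrable_bd cg) => //; tauto
    | apply: (vintegrable_bd cf) => //; tauto | apply: (vintegrable_bd cg) => //; tauto].
ring.
Qed.

Lemma rectZ (k : CC R) f a b c d : a <= b -> c <= d -> cont_bd f a b c d ->
  rect (fun z => k * f z) a b c d = k * rect f a b c d.
Proof.
move=> ab cd cf; rewrite /rect /hint /vint !cintZ//; try by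
  first [apply: (hintegrable_bd cf) => //; tauto | apply: (vintegrable_bd cf) => //; tauto].
ring.
Qed.

Lemma continuous_affine (al be : CC R) p : {for p, continuous (fun z => al + be * z)}.
Proof.
apply/continuousCP => e e0; have b0 : 0 < cabs be + 1 by have := cabs_ge0 be; lra.
exists (e / (cabs be + 1)); first by rewrite divr_gt0.
move=> w; rewrite ltr_pdivlMr// => H.
have -> : al + be * w - (al + be * p) = be * (w - p) by ring.
rewrite cabsM; have := cabs_ge0 (w - p); nra.
Qed.

(** With this, only the first order remainder of a function matters in its
    integral along a small rectangle. *)
Lemma rect_affine (al be : CC R) a b c d : a <= b -> c <= d ->
  rect (fun z => al + be * z) a b c d = 0.
Proof.
move=> ab cd; have cf : cont_on (fun z => al + be * z) a b c d.
  by move=> p _; exact: continuous_affine.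
have H : hint (fun z => al + be * z) a b c - hint (fun z => al + be * z) a b d
    = be * im R * ofR (c - d) * ofR (b - a).
  rewrite -cintB//; [|exact: hintegrable cf _ _|exact: hintegrable cf _ _].
  rewrite -(cint_cst _ ab); apply: eq_cint => x _.
  by rewrite /zc rmorphB; ring.
have V : vint (fun z => al + be * z) c d b - vint (fun z => al + be * z) c d a
    = be * ofR (b - a) * ofR (d - c).
  rewrite -cintB//; [|exact: vintegrable cf _ _|exact: vintegrable cf _ _].
  rewrite -(cint_cst _ cd); apply: eq_cint => x _.
  by rewrite /zc rmorphB; ring.
have -> : rect (fun z => al + be * z) a b c d =
   (hint (fun z => al + be * z) a b c - hint (fun z => al + be * z) a b d) +
   im R * (vint (fun z => al + be * z) c d b - vint (fun z => al + be * z) c d a).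
  by rewrite /rect; move: (hint _ _ _ _) (hint _ _ _ _) (vint _ _ _ _) (vint _ _ _ _) => ? ? ? ?; ring.
by rewrite H V !rmorphB /=; ring.
Qed.

Definition diff_on f a b c d := forall p, in_rect a b c d p -> exists l, is_derive p (1 : CC R) f l.

Lemma diff_cont_on f a b c d : diff_on f a b c d -> cont_on f a b c d.
Proof. by move=> df p /df[l]; exact: is_derive_continuousC. Qed.

(** Near a point of differentiability, only the remainder of the first order
    expansion contributes to the integral along a small rectangle. *)
Lemma rect_local f (p l : CC R) (e dl : R) a b c d : a <= b -> c <= d ->
  cont_on f a b c d -> in_rect a b c d p -> (b - a) + (d - c) < dl -> 0 <= e ->
  (forall h, cabs h < dl -> cabs (f (p + h) - f p - l * h) <= e * cabs h) ->
  cabs (rect f a b c d) <= e * 2 * ((b - a) + (d - c)) ^+ 2.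
Proof.
move=> ab cd cf /and4P[p1 p2 p3 p4] S e0 H.
pose g := fun z => (f p - l * p) + l * z.
have cg : cont_on g a b c d by move=> q _; exact: continuous_affine.
have cfg : cont_on (fun z => f z - g z) a b c d.
  by move=> q /[dup] /cf cfq /cg cgq; exact: (cvgB cfq cgq).
have -> : rect f a b c d = rect (fun z => f z - g z) a b c d.
  by rewrite rectB// ?rect_affine// ?subr0//; exact: cont_on_bd.
have -> : e * 2 * ((b - a) + (d - c)) ^+ 2 =
    (e * ((b - a) + (d - c))) * (2 * ((b - a) + (d - c))) by ring.
apply: rect_le => //; first exact: cont_on_bd.
move=> q /and4P[q1 q2 q3 q4] _.
have Q : cabs (q - p) <= (b - a) + (d - c).
  apply: le_trans (cabs_le _) _; rewrite cReB cImB; apply: lerD;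
    by rewrite ler_norml; apply/andP; split; lra.
have := H (q - p) (le_lt_trans Q S).
have -> : p + (q - p) = q by ring.
have -> : f q - f p - l * (q - p) = f q - g q by rewrite /g; ring.
by move=> /le_trans; apply; rewrite ler_wpM2l.
Qed.

Lemma rect_quarters f a w c h : 0 <= w -> 0 <= h -> cont_on f a (a + 2 * w) c (c + 2 * h) ->
  rect f a (a + 2 * w) c (c + 2 * h) =
  (rect f a (a + w) c (c + h) + rect f a (a + w) (c + h) (c + h + h)) +
  (rect f (a + w) (a + w + w) c (c + h) + rect f (a + w) (a + w + w) (c + h) (c + h + h)).
Proof.
move=> w0 h0 cf.
have -> : a + w + w = a + 2 * w by ring.
have -> : c + h + h = c + 2 * h by ring.
rewrite (@rect_hsplit f a (a + w)) //; [|lra|lra|lra].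
rewrite (@rect_vsplit f a (a + w) c (c + h)); [|lra|lra|lra|]; last first.
  by apply: cont_onS cf; lra.
rewrite (@rect_vsplit f (a + w) _ c (c + h)); [|lra|lra|lra|]; last first.
  by apply: cont_onS cf; lra.
by [].
Qed.

(** Goursat's bisection: were the integral non zero, one of the four quarters
    would keep at least a fourth of its modulus, and so on forever, against the
    quadratic decay that differentiability forces at the limit point. *)
Lemma goursat f a b c d : a < b -> c < d -> diff_on f a b c d -> rect f a b c d = 0.
Proof.
move=> ab cd df; have cf := diff_cont_on df.
apply/eqP; rewrite -cabs_eq0; apply/negP => /negP K0.
have K : 0 < cabs (rect f a b c d) by rewrite lt_neqAle eq_sym K0 cabs_ge0.
pose W n : R := (b - a) / 2 ^+ n; pose H n : R := (d - c) / 2 ^+ n.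
have W0 n : 0 < W n by rewrite divr_gt0 ?exprn_gt0// subr_gt0.
have H0 n : 0 < H n by rewrite divr_gt0 ?exprn_gt0// subr_gt0.
have WS n : W n = 2 * W n.+1 by rewrite /W exprS; field; rewrite expf_neq0.
have HS n : H n = 2 * H n.+1 by rewrite /H exprS; field; rewrite expf_neq0.
pose eps := cabs (rect f a b c d) / ((b - a) + (d - c)) ^+ 2.
have S0 : 0 < (b - a) + (d - c) by lra.
have eps0 : 0 < eps by rewrite divr_gt0// exprn_gt0.
pose bad n (q : R * R) := [&& a <= q.1, q.1 + W n <= b, c <= q.2, q.2 + H n <= d &
  eps * (W n + H n) ^+ 2 <= cabs (rect f q.1 (q.1 + W n) q.2 (q.2 + H n))].
have step n q : exists q', bad n q -> bad n.+1 q' /\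
    [&& q.1 <= q'.1, q'.1 + W n.+1 <= q.1 + W n, q.2 <= q'.2 & q'.2 + H n.+1 <= q.2 + H n].
  have [/and5P[q1 q2 q3 q4 qb]|nb] := boolP (bad n q); last by exists q.
  case: q q1 q2 q3 q4 qb => x y /= q1 q2 q3 q4 qb.
  have w0 := W0 n.+1; have h0 := H0 n.+1; have w2 := WS n; have h2 := HS n.
  have cq : cont_on f x (x + 2 * W n.+1) y (y + 2 * H n.+1).
    by rewrite -WS -HS; apply: cont_onS cf.
  move: qb; rewrite WS HS (rect_quarters (ltW w0) (ltW h0) cq) => qb.
  suff : exists q', bad n.+1 q' /\ ((q'.1 = x \/ q'.1 = x + W n.+1) /\
      (q'.2 = y \/ q'.2 = y + H n.+1)).
    move=> [[x' y'] /= [B [X Y]]]; exists (x', y') => _; split => //=.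
    by clear -X Y w0 h0; apply/and4P; split; move: X Y => [X|X] [Y|Y]; lra.
  apply: contrapT => nq.
  have N x' y' : (x' = x \/ x' = x + W n.+1) -> (y' = y \/ y' = y + H n.+1) ->
      cabs (rect f x' (x' + W n.+1) y' (y' + H n.+1)) < eps * (W n.+1 + H n.+1) ^+ 2.
    move=> X Y; rewrite ltNge; apply/negP => B; apply: nq; exists (x', y'); split => //.
    apply/and5P; split => //=; clear -q1 q2 q3 q4 w0 h0 w2 h2 X Y;
      [case: X => ->|case: X => ->|case: Y => ->|case: Y => ->]; lra.
  have := N x y (or_introl erefl) (or_introl erefl).
  have := N x (y + H n.+1) (or_introl erefl) (or_intror erefl).
  have := N (x + W n.+1) y (or_intror erefl) (or_introl erefl).
  have := N (x + W n.+1) (y + H n.+1) (or_intror erefl) (or_intror erefl).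
  move: qb.
  have -> : eps * (2 * W n.+1 + 2 * H n.+1) ^+ 2 = 4 * (eps * (W n.+1 + H n.+1) ^+ 2) by ring.
  set e4 := eps * _ => qb n1 n2 n3 n4; move: qb; apply/negP; rewrite -ltNge.
  apply: le_lt_trans (cabsD _ _) _.
  apply: le_lt_trans (lerD (cabsD _ _) (cabsD _ _)) _.
  have -> : 4 * e4 = (e4 + e4) + (e4 + e4) by ring.
  exact: ltrD (ltrD n4 n3) (ltrD n2 n1).
have [nx nxP] := choice (fun nq => step nq.1 nq.2).
pose q := fix q n : R * R := if n is m.+1 then nx (m, q m) else (a, c).
have qbad n : bad n (q n).
  elim: n => [|n IH]; last by have [] := nxP (n, q n) IH.
  apply/and5P; rewrite /W /H !expr0 !divr1 /= ; split; rewrite ?subrKC ?lexx//.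
  rewrite /eps divfK// expf_neq0// lt0r_neq0//.
have qS n : [&& (q n).1 <= (q n.+1).1, (q n.+1).1 + W n.+1 <= (q n).1 + W n,
    (q n).2 <= (q n.+1).2 & (q n.+1).2 + H n.+1 <= (q n).2 + H n].
  by have [] := nxP (n, q n) (qbad n).
have mono (u v : nat -> R) : (forall n, u n <= u n.+1) -> (forall n, v n.+1 <= v n) ->
    (forall n, u n <= v n) -> exists x, forall n, u n <= x <= v n.
  move=> uS vS uv.
  have um : {homo u : n m / (n <= m)%N >-> n <= m} by exact: homo_leq (@lexx _ R) (@le_trans _ R) uS.
  have vm : {homo v : n m / (n <= m)%N >-> m <= n}.
    by apply: (homo_leq (r := fun x y => y <= x)) => // x y z h1 h2; exact: le_trans h2 h1.
  have uvm n m : u n <= v m.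
    have [nm|mn] := leqP n m; first exact: le_trans (um _ _ nm) (uv _).
    exact: le_trans (uv _) (vm _ _ (ltnW mn)).
  exists (sup (range u)) => n; apply/andP; split.
    by apply: ub_le_sup; [exists (v 0%N) => _ [m _ <-] | exists n].
  by apply: ge_sup; [exists (u 0%N), 0%N | move=> _ [m _ <-]].
have [X XP] := mono (fun n => (q n).1) (fun n => (q n).1 + W n)
  (fun n => let: And4 h _ _ _ := and4P (qS n) in h)
  (fun n => let: And4 _ h _ _ := and4P (qS n) in h)
  (fun n => ltac:(by rewrite lerDl ltW)).
have [Y YP] := mono (fun n => (q n).2) (fun n => (q n).2 + H n)
  (fun n => let: And4 _ _ h _ := and4P (qS n) in h)
  (fun n => let: And4 _ _ _ h := and4P (qS n) in h)
  (fun n => ltac:(by rewrite lerDl ltW)).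
have pin n : in_rect (q n).1 ((q n).1 + W n) (q n).2 ((q n).2 + H n) (zc X Y).
  by rewrite in_rect_zc; have /andP[-> ->] := XP n; have /andP[-> ->] := YP n.
have [l /is_deriveCP dl] : exists l, is_derive (zc X Y) (1 : CC R) f l.
  apply: df; have := pin 0%N; rewrite /W /H !expr0 !divr1 /=.
  by rewrite !subrKC.
have [dt dt0 dtP] := dl (eps / 4) (divr_gt0 eps0 (ltr0n R 4)).
have [n nP] : exists n, W n + H n < dt.
  pose m := Num.truncn (((b - a) + (d - c)) / dt).
  exists m; rewrite /W /H -mulrDl ltr_pdivrMr ?exprn_gt0// mulrC -ltr_pdivrMr//.
  apply: (@lt_le_trans _ _ m.+1%:R).
    by rewrite truncnS_gt.
  by rewrite -natrX ler_nat ltn_expl.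
have /and5P[b1 b2 b3 b4 b5] := qbad n.
have := @rect_local f (zc X Y) l (eps / 4) dt (q n).1 ((q n).1 + W n) (q n).2 ((q n).2 + H n).
have e1 x y : x + y - x = y :> R by ring.
rewrite !e1 => /(_ _ _ _ (pin n) nP _ dtP) B.
have : cabs (rect f (q n).1 ((q n).1 + W n) (q n).2 ((q n).2 + H n)) <=
    eps / 4 * 2 * (W n + H n) ^+ 2.
  apply: B; [by rewrite lerDl ltW|by rewrite lerDl ltW| |exact: ltW (divr_gt0 eps0 (ltr0n R 4))].
  exact: cont_onS cf.
move=> B'; have := le_trans b5 B'.
have : 0 < eps * (W n + H n) ^+ 2 by rewrite mulr_gt0// exprn_gt0// addr_gt0.
have -> : eps / 4 * 2 * (W n + H n) ^+ 2 = eps * (W n + H n) ^+ 2 / 2 by field.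
by clear; move: (eps * _) => u u0 u1; lra.
Qed.

End Cauchy.

(** * Cauchy's formula and unique continuation *)

Section Continuation.
Context {R : realType}.
Implicit Types (f g : CC R -> CC R) (p : CC R) (a b c d : R).

(** Cutting out a small square about [p] leaves rectangles on which Goursat's
    theorem applies; on that square the function is bounded and the perimeter
    is arbitrarily small. *)
Lemma goursat_punctured g p a b c d :
  a < cRe p -> cRe p < b -> c < cIm p -> cIm p < d -> cont_on g a b c d ->
  (forall q, in_rect a b c d q -> q != p -> exists l, is_derive q (1 : CC R) g l) ->
  rect g a b c d = 0.
Proof.
move=> ap pb cp pd cg dg.
apply/eqP; rewrite -cabs_eq0; apply/eqP/le_anti; rewrite cabs_ge0 andbT.
apply/ler_addgt0Pr => e e0; rewrite add0r.
have [d1 d10 d1P] : exists2 r : R, 0 < r & forall q, cabs (q - p) < r -> cabs (g q) <= cabs (g p) + 1.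
  have pin : in_rect a b c d p by rewrite /in_rect !ltW.
  have /continuousCP/(_ _ ltr01)[r r0 rP] := cg _ pin; exists r => // q /rP gq.
  have -> : g q = g p + (g q - g p) by ring.
  by apply: le_trans (cabsD _ _) _; rewrite lerD2l ltW.
set M := cabs (g p) + 1; have M0 : 0 < M by have := cabs_ge0 (g p); rewrite /M; lra.
pose x := cRe p; pose y := cIm p.
have [h [h0 hd he [h1 h2] [h3 h4]]] : exists h : R, [/\ 0 < h, 2 * h < d1, M * (8 * h) <= e,
    h < x - a /\ h < b - x & h < y - c /\ h < d - y].
  pose u := Num.min (x - a) (b - x); pose v := Num.min (y - c) (d - y).
  have u0 : 0 < u by rewrite lt_min !subr_gt0 ap pb.
  have v0 : 0 < v by rewrite lt_min !subr_gt0 cp pd.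
  pose h := Num.min (Num.min (u / 2) (v / 2)) (Num.min (d1 / 3) (e / (8 * M))).
  have h1 : h <= u / 2 by rewrite /h !ge_min lexx.
  have h2 : h <= v / 2 by rewrite /h !ge_min lexx !orbT.
  have h3 : h <= d1 / 3 by rewrite /h !ge_min lexx !orbT.
  have h4 : h <= e / (8 * M) by rewrite /h !ge_min lexx !orbT.
  have : u <= x - a by rewrite /u ge_min lexx.
  have : u <= b - x by rewrite /u ge_min lexx orbT.
  have : v <= y - c by rewrite /v ge_min lexx.
  have : v <= d - y by rewrite /v ge_min lexx orbT.
  move: h4; rewrite ler_pdivlMr ?mulr_gt0// => *.
  exists h; split; [|lra|lra|split; lra|split; lra].
  by rewrite /h !lt_min !divr_gt0// mulr_gt0.
have outer a' b' c' d' : a <= a' -> b' <= b -> c <= c' -> d' <= d -> a' < b' -> c' < d' ->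
    (b' < x \/ x < a' \/ d' < y \/ y < c') -> rect g a' b' c' d' = 0.
  move=> aa bb cc dd ab cd O; apply: goursat => // q /and4P[q1 q2 q3 q4]; apply: dg.
    by apply/and4P; split; lra.
  apply/eqP => qp; move: q1 q2 q3 q4 O; rewrite qp -/x -/y => *; lra.
have pq : zc x y = p by rewrite -zcE.
rewrite (@rect_hsplit _ g a (x - h)) //; [|lra|lra|lra].
rewrite (@rect_hsplit _ g (x - h) (x + h)) //; [|lra|lra|lra|apply: cont_onS cg; lra].
rewrite (@rect_vsplit _ g (x - h) (x + h) c (y - h)); [|lra|lra|lra|apply: cont_onS cg; lra].
rewrite (@rect_vsplit _ g (x - h) (x + h) (y - h) (y + h)); [|lra|lra|lra|apply: cont_onS cg; lra].
rewrite (@outer a (x - h)) //; [|lra|lra|lra|lra].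
rewrite (@outer (x + h) b) //; [|lra|lra|lra|lra].
rewrite (@outer (x - h) (x + h) c (y - h)) //; [|lra|lra|lra|lra|lra|lra].
rewrite (@outer (x - h) (x + h) (y + h) d) //; [|lra|lra|lra|lra|lra|lra].
rewrite !(add0r, addr0); apply: le_trans he.
have -> : M * (8 * h) = M * (2 * ((x + h - (x - h)) + (y + h - (y - h)))) by ring.
apply: rect_le; [lra|lra|apply: cont_on_bd; apply: cont_onS cg; lra|].
move=> q /and4P[q1 q2 q3 q4] _; apply: d1P.
apply: le_lt_trans (cabs_le _) _; rewrite cReB cImB -/x -/y.
apply: le_lt_trans hd; have -> : 2 * h = h + h by ring.
by apply: lerD; rewrite ler_norml; apply/andP; split; lra.
Qed.

Lemma derivableCP f p : derivable f p 1 <-> exists l, is_derive p (1 : CC R) f l.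
Proof.
split; first by move=> /derivable_is_deriveC; exists (derive1 f p).
by move=> [l []].
Qed.

Lemma continuous_derivableC f p : derivable f p 1 -> {for p, continuous f}.
Proof. by move=> /derivable_is_deriveC /is_derive_continuousC. Qed.

Lemma derivable_idC p : derivable (fun z => z : CC R) p 1.
Proof. exact: derivable_id. Qed.
Lemma derivable_cstC (k : CC R) p : derivable (fun=> k) p 1.
Proof. exact: derivable_cst. Qed.
Lemma derivableBC f g p : derivable f p 1 -> derivable g p 1 -> derivable (fun z => f z - g z) p 1.
Proof. by move=> df dg; exact: (derivableB df dg). Qed.
Lemma derivableDC f g p : derivable f p 1 -> derivable g p 1 -> derivable (fun z => f z + g z) p 1.
Proof. by move=> df dg; exact: (derivableD df dg). Qed.
Lemma derivableMC f g p : derivable f p 1 -> derivable g p 1 -> derivable (fun z => f z * g z) p 1.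
Proof. by move=> df dg; exact: (derivableM df dg). Qed.
Lemma derivableVC f p : f p != 0 -> derivable f p 1 -> derivable (fun z => (f z)^-1) p 1.
Proof. by move=> f0 df; exact: (derivableV f0 df). Qed.
Lemma derivableXC f p n : derivable f p 1 -> derivable (fun z => (f z) ^+ n) p 1.
Proof.
move=> df; elim: n => [|n IH].
  by rewrite (_ : (fun _ => _) = (fun=> 1)); [exact: derivable_cstC | apply/funext => z; rewrite expr0].
rewrite (_ : (fun _ => _) = (fun z => f z * f z ^+ n)); first exact: derivableMC.
by apply/funext => z; rewrite exprS.
Qed.
Lemma derivable_nbhsC f g p : (\forall w \near p, f w = g w) -> derivable f p 1 -> derivable g p 1.
Proof. by move=> fg /derivableCP[l dl]; apply/derivableCP; exists l; exact: is_derive_nbhsC dl. Qed.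

Lemma near_neqC p q : q != p -> \forall w \near q, w != p.
Proof.
move=> qp; apply/nbhsCP; exists (cabs (q - p)); first by rewrite cabs_gt0 subr_eq0.
by move=> w H; apply/eqP => wp; move: H; rewrite wp cabsBC ltxx.
Qed.

(** The difference quotient at an interior point [p] is differentiable except
    perhaps at [p], where it is continuous, so its integral is zero. *)
Lemma cauchy_formula f p a b c d :
  a < cRe p -> cRe p < b -> c < cIm p -> cIm p < d -> diff_on f a b c d ->
  rect (fun z => f z * (z - p)^-1) a b c d = f p * rect (fun z => (z - p)^-1) a b c d.
Proof.
move=> ap pb cp pd df; have cf := diff_cont_on df.
have ab : a <= b by lra. have cd : c <= d by lra.
have pin : in_rect a b c d p by rewrite /in_rect !ltW.
have [l dl] := df _ pin.
pose g z := if z == p then l else (f z - f p) * (z - p)^-1.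
have gE q : q != p -> \forall w \near q, (f w - f p) * (w - p)^-1 = g w.
  by move=> qp; apply: filterS (near_neqC qp) => w; rewrite /g => /negbTE ->.
have dg q : in_rect a b c d q -> q != p -> derivable g q 1.
  move=> qin qp; apply: derivable_nbhsC (gE _ qp) _.
  apply: derivableMC; first by apply: derivableBC; [exact/derivableCP/df | exact: derivable_cstC].
  apply: derivableVC; first by rewrite subr_eq0.
  by apply: derivableBC; [exact: derivable_idC | exact: derivable_cstC].
have cg : cont_on g a b c d.
  move=> q qin; have [->|qp] := eqVneq q p; last exact/continuous_derivableC/dg.
  apply/continuousCP => e e0; move/is_deriveCP: dl => /(_ _ (divr_gt0 e0 (ltr0n R 2)))[r r0 rP].
  exists r => // w wr; have [->|wp] := eqVneq w p; first by rewrite subrr cabs0.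
  rewrite /g eqxx (negbTE wp).
  have := rP _ wr; have -> : p + (w - p) = w by ring.
  have w0 : w - p != 0 by rewrite subr_eq0.
  have -> : (f w - f p) * (w - p)^-1 - l = (f w - f p - l * (w - p)) * (w - p)^-1 by field.
  rewrite cabsM cabsV => H; rewrite ltr_pdivrMr ?cabs_gt0//.
  apply: le_lt_trans H _; rewrite ltr_pM2r ?cabs_gt0//; lra.
have side q : in_rect a b c d q -> on_side a b c d q -> q != p.
  by move=> _ qs; apply/eqP => qp; move: qs; rewrite qp /on_side; lra.
have ci : cont_bd (fun z => - f p * (z - p)^-1) a b c d.
  move=> q qin qs; apply: continuous_derivableC; apply: derivableMC; first exact: derivable_cstC.
  apply: derivableVC; first by rewrite subr_eq0 side.
  by apply: derivableBC; [exact: derivable_idC | exact: derivable_cstC].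
have ci' : cont_bd (fun z => (z - p)^-1) a b c d.
  move=> q qin qs; apply: continuous_derivableC; apply: derivableVC; first by rewrite subr_eq0 side.
  by apply: derivableBC; [exact: derivable_idC | exact: derivable_cstC].
have -> : rect (fun z => f z * (z - p)^-1) a b c d =
    rect (fun z => g z - (- f p * (z - p)^-1)) a b c d.
  apply: eq_rect_int => // q qin qs; rewrite /g (negbTE (side q qin qs)); ring.
have g0 : rect g a b c d = 0.
  apply: (goursat_punctured ap pb cp pd cg) => q qin qp.
  by apply/derivableCP; exact: dg.
rewrite (rectB ab cd (cont_on_bd cg) ci) (rectZ _ ab cd ci') g0.
by move: (rect _ _ _ _ _) => k; ring.
Qed.

Lemma cRe_inv (z : CC R) : cRe z^-1 = cRe z / cabs z ^+ 2.
Proof. by rewrite sqr_cabs; case: z => x y; rewrite /GRing.inv /= mulrC. Qed.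
Lemma cIm_inv (z : CC R) : cIm z^-1 = - cIm z / cabs z ^+ 2.
Proof. by rewrite sqr_cabs; case: z => x y; rewrite /GRing.inv /= mulNr mulrC. Qed.

(** On each of the four sides the integrand contributes a positive imaginary
    part. *)
Lemma rect_inv_neq0 p a b c d :
  a < cRe p -> cRe p < b -> c < cIm p -> cIm p < d ->
  rect (fun z => (z - p)^-1) a b c d != 0.
Proof.
move=> ap pb cp pd; have ab : a <= b by lra. have cd : c <= d by lra.
have side q : in_rect a b c d q -> on_side a b c d q -> q != p.
  by move=> _ qs; apply/eqP => qp; move: qs; rewrite qp /on_side; lra.
have ci : cont_bd (fun z => (z - p)^-1) a b c d.
  move=> q qin qs; apply: continuous_derivableC; apply: derivableVC; first by rewrite subr_eq0 side.
  by apply: derivableBC; [exact: derivable_idC | exact: derivable_cstC].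
suff H : 0 < cIm (rect (fun z => (z - p)^-1) a b c d).
  by apply/eqP => E; move: H; rewrite E cIm0 ltxx.
rewrite /rect !cImB cImD !cImM cRe_im cIm_im !(mul0r, mul1r, add0r).
rewrite !(cRe_cint, cIm_cint) /=.
have hb : 0 <= rint `[c, d] (fun y => cRe (zc b y - p)^-1).
  apply: rint_ge0 => y _; rewrite cRe_inv divr_ge0 ?sqr_ge0// cReB cRe_zc; lra.
have ha : rint `[c, d] (fun y => cRe (zc a y - p)^-1) <= 0.
  rewrite -oppr_ge0 -mulN1r -rintZ//; last first.
    by case: (vintegrable_bd ci ab (or_introl (erefl a))).
  apply: rint_ge0 => y _; rewrite cRe_inv mulN1r -mulNr divr_ge0 ?sqr_ge0// cReB cRe_zc; lra.
have hd : rint `[a, b] (fun x => cIm (zc x d - p)^-1) <= 0.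
  rewrite -oppr_ge0 -mulN1r -rintZ//; last first.
    by case: (hintegrable_bd ci cd (or_intror (erefl d))).
  apply: rint_ge0 => y _; rewrite cIm_inv mulN1r mulNr opprK divr_ge0 ?sqr_ge0// cImB cIm_zc; lra.
pose M := (b - a) + (d - c).
have hc : 0 < rint `[a, b] (fun x => cIm (zc x c - p)^-1).
  apply: (@lt_le_trans _ _ (rint `[a, b] (fun=> (cIm p - c) / M ^+ 2))).
    by rewrite rint_cst// mulr_gt0 ?divr_gt0 ?exprn_gt0//; rewrite /M; lra.
  apply: le_rint => //.
  - exact: rintegrable_cst.
  - by case: (hintegrable_bd ci cd (or_introl (erefl c))).
  move=> x /itvmem[ax xb]; rewrite cIm_inv cImB cIm_zc opprB.
  have z0 : zc x c - p != 0.
    apply/eqP => /(congr1 (@cIm R)); rewrite cImB cIm_zc cIm0; lra.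
  rewrite ler_wpM2l ?subr_ge0 ?(ltW cp)// lef_pV2 ?posrE ?exprn_gt0 ?cabs_gt0//; last by rewrite /M; lra.
  rewrite lerXn2r ?nnegrE ?cabs_ge0//; first by rewrite /M; lra.
  apply: le_trans (cabs_le _) _; rewrite cReB cImB cRe_zc cIm_zc /M; apply: lerD;
    by rewrite ler_norml; apply/andP; split; lra.
by lra.
Qed.

(** Dividing by a high power of [z - q] does not spoil differentiability, since
    [f] is zero near [q]; in Cauchy's formula it makes the boundary negligible. *)
Lemma vanish_ball f (q : CC R) (r : R) : 0 < r ->
  diff_on f (cRe q - r) (cRe q + r) (cIm q - r) (cIm q + r) ->
  (\forall z \near q, f z = 0) -> forall p, cabs (p - q) < r -> f p = 0.
Proof.
move=> r0 df fq p pr.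
have [->|pq] := eqVneq p q; first exact: nbhs_singleton fq.
set a := cRe q - r in df *; set b := cRe q + r in df *.
set c := cIm q - r in df *; set d := cIm q + r in df *.
have P1 : `|cRe p - cRe q| < r by apply: le_lt_trans (cRe_lip _ _) pr.
have P2 : `|cIm p - cIm q| < r by apply: le_lt_trans (cIm_lip _ _) pr.
move: P1 P2; rewrite !ltr_norml => /andP[p1 p2] /andP[p3 p4].
have ap : a < cRe p by rewrite /a; lra.
have pb : cRe p < b by rewrite /b; lra.
have cp : c < cIm p by rewrite /c; lra.
have pd : cIm p < d by rewrite /d; lra.
have ab : a <= b by lra. have cd : c <= d by lra.
pose D n z := f z * ((z - q)^-1) ^+ n.
have dD n : diff_on (D n) a b c d.
  move=> z zin; apply/derivableCP; have [->|zq] := eqVneq z q.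
    apply: (@derivable_nbhsC (fun=> 0)); last exact: derivable_cstC.
    by apply: filterS fq => w fw; rewrite /D fw mul0r.
  apply: derivableMC; first exact/derivableCP/df.
  apply: derivableXC; apply: derivableVC; first by rewrite subr_eq0.
  by apply: derivableBC; [exact: derivable_idC | exact: derivable_cstC].
have side z : on_side a b c d z -> z != p.
  by move=> qs; apply/eqP => qp; move: qs; rewrite qp /on_side; lra.
have sider z : on_side a b c d z -> r <= cabs (z - q).
  rewrite /on_side /a /b /c /d => -[E|[E|[E|E]]].
  - by apply: le_trans (normRe_le _); rewrite cReB E ler0_norm; lra.
  - by apply: le_trans (normRe_le _); rewrite cReB E ger0_norm; lra.
  - by apply: le_trans (normIm_le _); rewrite cImB E ler0_norm; lra.
  - by apply: le_trans (normIm_le _); rewrite cImB E ger0_norm; lra.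
pose F z := f z * (z - p)^-1.
have dinv z : on_side a b c d z -> derivable (fun z => (z - p)^-1) z 1.
  move=> zs; apply: derivableVC; first by rewrite subr_eq0 side.
  by apply: derivableBC; [exact: derivable_idC | exact: derivable_cstC].
have cF z : in_rect a b c d z -> on_side a b c d z -> {for z, continuous F}.
  move=> zin zs; apply: continuous_derivableC; apply: derivableMC (dinv _ zs).
  exact/derivableCP/df.
have [M M0 FM] : exists2 M, 0 <= M & forall z, in_rect a b c d z -> on_side a b c d z -> cabs (F z) <= M.
  have H y : y = c \/ y = d -> exists2 M, 0 <= M & forall x, a <= x <= b -> cabs (F (zc x y)) <= M.
    move=> ycd; apply: (@bounded_path _ F (fun x => zc x y)); first exact: continuous_zc_h.
    move=> x /andP[ax xb]; apply: cF; last by rewrite /on_side cIm_zc; tauto.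
    by rewrite in_rect_zc ax xb; case: ycd => ->; rewrite lexx cd.
  have V x : x = a \/ x = b -> exists2 M, 0 <= M & forall y, c <= y <= d -> cabs (F (zc x y)) <= M.
    move=> xab; apply: (@bounded_path _ F (zc x)); first exact: continuous_zc_v.
    move=> y /andP[cy yd]; apply: cF; last by rewrite /on_side cRe_zc; tauto.
    by rewrite in_rect_zc cy yd; case: xab => ->; rewrite lexx ab.
  have [M1 M10 M1P] := V a (or_introl erefl); have [M2 M20 M2P] := V b (or_intror erefl).
  have [M3 M30 M3P] := H c (or_introl erefl); have [M4 M40 M4P] := H d (or_intror erefl).
  exists (M1 + M2 + M3 + M4); first by lra.
  move=> z /and4P[z1 z2 z3 z4] zs; rewrite (zcE z).
  suff HM : [\/ cabs (F (zc (cRe z) (cIm z))) <= M1, cabs (F (zc (cRe z) (cIm z))) <= M2,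
     cabs (F (zc (cRe z) (cIm z))) <= M3 | cabs (F (zc (cRe z) (cIm z))) <= M4].
    by clear -HM M10 M20 M30 M40; case: HM => ?; lra.
  case: zs => [->|[->|[->|->]]].
  - by apply: Or41; apply: M1P; rewrite z3.
  - by apply: Or42; apply: M2P; rewrite z3.
  - by apply: Or43; apply: M3P; rewrite z1.
  - by apply: Or44; apply: M4P; rewrite z1.
pose k := rect (fun z => (z - p)^-1) a b c d.
have k0 : 0 < cabs k by rewrite cabs_gt0 rect_inv_neq0.
have main n : cabs (f p) * cabs k <= (8 * r * M) * (cabs (p - q) / r) ^+ n.
  have := cauchy_formula ap pb cp pd (dD n).
  move=> /(congr1 cabs); rewrite cabsM -/k => E.
  have B : cabs (rect (fun z => D n z * (z - p)^-1) a b c d) <= (M * r^-1 ^+ n) * (2 * ((b - a) + (d - c))).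
    apply: (rect_le ab cd).
      move=> z zin zs; apply: continuous_derivableC; apply: derivableMC (dinv _ zs).
      exact/derivableCP/dD.
    move=> z zin zs.
    have -> : D n z * (z - p)^-1 = F z * ((z - q)^-1) ^+ n by rewrite /D /F; ring.
    rewrite cabsM cabsX cabsV ler_pM ?cabs_ge0 ?exprn_ge0 ?invr_ge0 ?cabs_ge0 ?FM//.
    rewrite lerXn2r ?nnegrE ?invr_ge0 ?cabs_ge0 ?(ltW r0)//.
    by rewrite lef_pV2 ?posrE ?sider// (lt_le_trans r0) ?sider.
  move: B; rewrite E /D cabsM cabsX cabsV.
  have u0 : 0 < cabs (p - q) by rewrite cabs_gt0 subr_eq0.
  have un0 : 0 < cabs (p - q) ^+ n by rewrite exprn_gt0.
  have -> : 2 * ((b - a) + (d - c)) = 8 * r by rewrite /a /b /c /d; ring.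
  rewrite !exprVn -mulrA (mulrC _ (cabs k)) mulrA ler_pdivrMr// => H.
  apply: le_trans H _; rewrite exprMn exprVn le_eqVlt; apply/orP; left; apply/eqP; ring.
apply/eqP; rewrite -cabs_eq0; apply/eqP/le_anti; rewrite cabs_ge0 andbT.
rewrite -(ler_pM2r k0) mul0r.
apply: (@closed_cvg _ _ \oo _ (fun n => (8 * r * M) * (cabs (p - q) / r) ^+ n) _ (@closed_ge R (cabs (f p) * cabs k))).
  by near=> n; exact: main.
rewrite -[X in _ --> X](mulr0 (8 * r * M)); apply: cvgM; first exact: cvg_cst.
apply: cvg_expr; rewrite ger0_norm ?divr_ge0 ?cabs_ge0 ?(ltW r0)//.
by rewrite ltr_pdivrMr// mul1r.
Unshelve. all: by end_near. Qed.

Lemma vanish_near f (q : CC R) (r : R) : 0 < r ->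
  diff_on f (cRe q - r) (cRe q + r) (cIm q - r) (cIm q + r) ->
  (\forall z \near q, f z = 0) ->
  forall p, cabs (p - q) < r -> \forall z \near p, f z = 0.
Proof.
move=> r0 df fq p pr; apply/nbhsCP; exists (r - cabs (p - q)); first by rewrite subr_gt0.
move=> w wp; apply: (vanish_ball r0 df fq).
have -> : w - q = (w - p) + (p - q) by ring.
by apply: le_lt_trans (cabsD _ _) _; rewrite -ltrBrDr.
Qed.

(** The vanishing propagates from [x1] down to [x0] in equal steps shorter than
    [r], each of which stays in a square on which the function is
    differentiable. *)
Lemma unique_continuation f (x0 x1 y r : R) : 0 < r -> x0 <= x1 ->
  (forall x, x0 <= x <= x1 -> diff_on f (x - r) (x + r) (y - r) (y + r)) ->
  (\forall z \near zc x1 y, f z = 0) -> f (zc x0 y) = 0.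
Proof.
move=> r0 x01 df f1.
pose N := (Num.truncn ((x1 - x0) / r)).+1.
have N0 : 0 < N%:R :> R by rewrite ltr0n.
pose x k := x1 - k%:R * ((x1 - x0) / N%:R).
have step : (x1 - x0) / N%:R < r.
  by rewrite ltr_pdivrMr// mulrC -ltr_pdivrMr// truncnS_gt.
have st0 : 0 <= (x1 - x0) / N%:R by rewrite divr_ge0// subr_ge0.
have xin k : (k <= N)%N -> x0 <= x k <= x1.
  move=> kN; rewrite /x; have k0 : (0 : R) <= k%:R by [].
  have kN' : k%:R <= N%:R :> R by rewrite ler_nat.
  have E : (x1 - x0) = N%:R * ((x1 - x0) / N%:R) by field; rewrite lt0r_neq0.
  have : k%:R * ((x1 - x0) / N%:R) <= N%:R * ((x1 - x0) / N%:R) by rewrite ler_wpM2r.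
  have : 0 <= k%:R * ((x1 - x0) / N%:R) by rewrite mulr_ge0.
  by rewrite -E => *; apply/andP; split; lra.
have H k : (k <= N)%N -> \forall z \near zc (x k) y, f z = 0.
  elim: k => [|k IH] kN; first by rewrite /x mul0r subr0.
  apply: (@vanish_near f (zc (x k) y) r r0).
  - by rewrite cRe_zc cIm_zc; apply: df; apply: xin; exact: ltnW.
  - exact: IH (ltnW kN).
  - have -> : zc (x k.+1) y - zc (x k) y = ofR (- ((x1 - x0) / N%:R)).
      rewrite /zc /x -natr1 !(rmorphB, rmorphN, rmorphM, rmorphD, rmorph1) /=; ring.
    by rewrite cabs_ofR normrN ger0_norm.
have := nbhs_singleton (H N (leqnn N)).
by rewrite /x (_ : x1 - _ = x0)//; field; rewrite lt0r_neq0.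
Qed.

End Continuation.

(** * Laplace transforms of non negative functions *)

Section Laplace.
Context {R : realType}.
Implicit Types (h g : R -> R) (s z : CC R).

(** In the variable [exp u] this is the Mellin transform of [h]: a translation of
    [h] multiplies it by an exponential of [s]. *)
Definition lap h s : CC R := cint setT (fun u => ofR (h u) * cexp (s * ofR u)).

(** The absolute convergence of [lap h] at abscissa [sg], for a non negative [h]. *)
Definition Lint h (sg : R) := rintegrable setT (fun u => h u * expR (sg * u)).

Lemma measurable_expRM (sg : R) : measurable_fun [set: R] (fun u => expR (sg * u)).
Proof. by apply: measurableT_comp => //; exact: measurable_funM. Qed.

Lemma cmeasurable_lap h s : measurable_fun [set: R] h ->
  cmeasurable setT (fun u => ofR (h u) * cexp (s * ofR u)).
Proof.
move=> mh.
have mlin (t : R) : measurable_fun [set: R] (fun u => t * u) by exact: measurable_funM.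
have mc (t : R) : measurable_fun [set: R] (fun u => cos (t * u)).
  exact: (measurableT_comp (continuous_measurable_fun (@continuous_cos R)) (mlin t)).
have ms (t : R) : measurable_fun [set: R] (fun u => sin (t * u)).
  exact: (measurableT_comp (continuous_measurable_fun (@continuous_sin R)) (mlin t)).
split.
- rewrite (_ : (fun _ => _) = (fun u => h u * (expR (cRe s * u) * cos (cIm s * u)))).
    by apply: measurable_funM => //; apply: measurable_funM => //; exact: measurable_expRM.
  by apply/funext => u; rewrite !(cE, cRe_cexp, cIm_cexp) !(mulr0, subr0, mul0r, add0r, addr0).
- rewrite (_ : (fun _ => _) = (fun u => h u * (expR (cRe s * u) * sin (cIm s * u)))).
    by apply: measurable_funM => //; apply: measurable_funM => //; exact: measurable_expRM.
  by apply/funext => u; rewrite !(cE, cRe_cexp, cIm_cexp) !(mulr0, subr0, mul0r, add0r, addr0).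
Qed.

Lemma cabs_lap_integrand h s u : cabs (ofR (h u) * cexp (s * ofR u)) = `|h u| * expR (cRe s * u).
Proof. by rewrite cabsM cabs_ofR cabs_cexp !cE mulr0 subr0. Qed.

Lemma lap_integrable h s : measurable_fun [set: R] h ->
  Lint (fun u => `|h u|) (cRe s) -> cintegrable setT (fun u => ofR (h u) * cexp (s * ofR u)).
Proof.
move=> mh Ih; apply: (@cintegrable_le _ _ _ (fun u => `|h u| * expR (cRe s * u))) => //.
  exact: cmeasurable_lap.
by move=> u _; rewrite cabs_lap_integrand.
Qed.

Lemma eq_Lint h g sg : h =1 g -> Lint h sg -> Lint g sg.
Proof. by move=> hg; apply: eq_rintegrable => // u _; rewrite hg. Qed.

Lemma Lint_norm h sg : (forall u, 0 <= h u) -> Lint h sg -> Lint (fun u => `|h u|) sg.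
Proof. by move=> h0; apply: eq_Lint => u; rewrite ger0_norm. Qed.

Lemma lap_integrable0 h s : measurable_fun [set: R] h -> (forall u, 0 <= h u) ->
  Lint h (cRe s) -> cintegrable setT (fun u => ofR (h u) * cexp (s * ofR u)).
Proof. by move=> mh h0 Ih; apply: lap_integrable => //; exact: Lint_norm. Qed.

Lemma Lint_le h g sg : measurable_fun [set: R] h -> (forall u, 0 <= h u) ->
  (forall u, h u <= g u) -> Lint g sg -> Lint h sg.
Proof.
move=> mh h0 hg; apply: rintegrable_le => //.
  by apply: measurable_funM => //; exact: measurable_expRM.
by move=> u _; rewrite ger0_norm ?mulr_ge0 ?expR_ge0// ler_wpM2r ?expR_ge0.
Qed.

Lemma Lint_between h (s1 s2 sg : R) : measurable_fun [set: R] h -> (forall u, 0 <= h u) ->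
  s1 <= sg -> sg <= s2 -> Lint h s1 -> Lint h s2 -> Lint h sg.
Proof.
move=> mh h0 l1 l2 I1 I2.
apply: (rintegrable_le (g := fun u => h u * expR (s1 * u) + h u * expR (s2 * u))) => //.
- by apply: measurable_funM => //; exact: measurable_expRM.
- move=> u _; rewrite ger0_norm ?mulr_ge0 ?expR_ge0// -mulrDr ler_wpM2l//.
  have [u0|u0] := leP 0 u.
    by rewrite -[leLHS]add0r lerD ?expR_ge0// ler_expR ler_wpM2r.
  by rewrite -[leLHS]addr0 lerD ?expR_ge0// ler_expR ler_wnM2r// ltW.
- exact: rintegrableD.
Qed.

Lemma LintD h g sg : Lint h sg -> Lint g sg -> Lint (fun u => h u + g u) sg.
Proof.
move=> Ih Ig; apply: eq_rintegrable (rintegrableD _ Ih Ig) => // u _; by rewrite mulrDl.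
Qed.
Lemma LintZ h (k : R) sg : Lint h sg -> Lint (fun u => k * h u) sg.
Proof.
move=> Ih; apply: eq_rintegrable (rintegrableZ k _ Ih) => // u _; by rewrite mulrA.
Qed.
Lemma Lint_exp h (t sg : R) : Lint h (sg + t) -> Lint (fun u => h u * expR (t * u)) sg.
Proof.
apply: eq_rintegrable => // u _; by rewrite -mulrA -expRD mulrDl addrC.
Qed.

Lemma eq_lap h g s : h =1 g -> lap h s = lap g s.
Proof. by move=> hg; apply: eq_cint => u _; rewrite hg. Qed.

Lemma lapB h g s : measurable_fun [set: R] h -> measurable_fun [set: R] g ->
  Lint (fun u => `|h u|) (cRe s) -> Lint (fun u => `|g u|) (cRe s) ->
  lap (fun u => h u - g u) s = lap h s - lap g s.
Proof.
move=> mh mg Ih Ig; rewrite /lap -(cintB measurableT (lap_integrable mh Ih) (lap_integrable mg Ig)).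
by apply: eq_cint => u _; rewrite rmorphB mulrBl.
Qed.

Lemma lapD h g s : measurable_fun [set: R] h -> measurable_fun [set: R] g ->
  Lint (fun u => `|h u|) (cRe s) -> Lint (fun u => `|g u|) (cRe s) ->
  lap (fun u => h u + g u) s = lap h s + lap g s.
Proof.
move=> mh mg Ih Ig; rewrite /lap -(cintD measurableT (lap_integrable mh Ih) (lap_integrable mg Ig)).
by apply: eq_cint => u _; rewrite rmorphD mulrDl.
Qed.

Lemma lapZ h (k : R) s : measurable_fun [set: R] h -> Lint (fun u => `|h u|) (cRe s) ->
  lap (fun u => k * h u) s = ofR k * lap h s.
Proof.
move=> mh Ih; rewrite /lap -(cintZ _ measurableT (lap_integrable mh Ih)).
by apply: eq_cint => u _; rewrite rmorphM mulrA.
Qed.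

(** A real shift of the argument is absorbed in the profile; this is how the
    functional equation is carried out below. *)
Lemma lap_exp h (t : R) s : lap (fun u => h u * expR (t * u)) s = lap h (s + ofR t).
Proof.
apply: eq_cint => u _; rewrite mulrDl cexpD rmorphM /=.
have -> : ofR t * ofR u = ofR (t * u) by rewrite rmorphM.
by rewrite cexp_ofR; ring.
Qed.

Lemma lap_shift h (a : R) s : measurable_fun [set: R] h -> (forall u, 0 <= h u) ->
  Lint h (cRe s) -> lap (fun u => h (u - a)) s = cexp (s * ofR a) * lap h s /\
  Lint (fun u => h (u - a)) (cRe s).
Proof.
move=> mh h0 Ih.
have ms : measurable_fun [set: R] (fun u : R => u - a) by exact: measurable_funB.
have mh' : measurable_fun [set: R] (fun u => h (u - a)) by exact: measurableT_comp.
have I' : Lint (fun u => h (u - a)) (cRe s).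
  have m1 : measurable_fun [set: R] (fun u => h (u - a) * expR (cRe s * u)).
    by apply: measurable_funM => //; exact: measurable_expRM.
  have [] := @rint_shift R a _ m1; last by [].
  apply: eq_rintegrable (rintegrableZ (expR (cRe s * a)) _ Ih) => // u _.
  by rewrite addrK mulrDr expRD; ring.
split=> //; rewrite /lap -(cintZ _ measurableT (lap_integrable0 mh h0 Ih)).
have [] := @cint_shift R a _ (cmeasurable_lap s mh').
  apply: eq_cintegrable (cintegrableZ (cexp (s * ofR a)) _ (lap_integrable0 mh h0 Ih)) => // u _.
  by rewrite addrK rmorphD mulrDr cexpD; ring.
move=> _ ->; apply: eq_cint => u _; by rewrite addrK rmorphD mulrDr cexpD; ring.
Qed.

Lemma lap_opp h s : measurable_fun [set: R] h -> (forall u, 0 <= h u) ->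
  Lint h (cRe s) -> lap (fun u => h (- u)) (- s) = lap h s /\
  Lint (fun u => h (- u)) (- cRe s).
Proof.
move=> mh h0 Ih.
have mh' : measurable_fun [set: R] (fun u => h (- u)) by exact: measurableT_comp.
have I' : Lint (fun u => h (- u)) (- cRe s).
  have m1 : measurable_fun [set: R] (fun u => h (- u) * expR (- cRe s * u)).
    by apply: measurable_funM => //; exact: measurable_expRM.
  have [] := @rint_opp R _ m1; last by [].
  by apply: eq_rintegrable Ih => // u _; rewrite opprK mulrNN.
split=> //.
have [] := @cint_opp R _ (cmeasurable_lap (- s) mh').
  apply: eq_cintegrable (lap_integrable0 mh h0 Ih) => // u _.
  by rewrite opprK rmorphN mulrNN.
move=> _; rewrite /lap => ->; apply: eq_cint => u _; by rewrite opprK rmorphN mulrNN.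
Qed.

Lemma cabs_lap_le h g s : measurable_fun [set: R] h -> (forall u, `|h u| <= g u) ->
  Lint g (cRe s) -> cabs (lap h s) <= rint setT (fun u => g u * expR (cRe s * u)).
Proof.
move=> mh hg Ig; apply: cabs_cint_le => //.
- apply: lap_integrable => //; apply: rintegrable_le Ig => //.
    by apply: measurable_funM; [exact: measurableT_comp | exact: measurable_expRM].
  by move=> u _; rewrite ger0_norm ?mulr_ge0 ?expR_ge0// ler_wpM2r ?expR_ge0.
- by move=> u _; rewrite cabs_lap_integrand ler_wpM2r ?expR_ge0.
Qed.

(** ** Exponential weights *)

Lemma expR_weight (sg dl u : R) : expR (sg * u) * expR (dl * `|u|) <=
  expR ((sg + dl) * u) + expR ((sg - dl) * u).
Proof.
rewrite -expRD; have [u0|u0] := leP 0 u.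
  by rewrite ger0_norm// -mulrDl lerDl expR_ge0.
by rewrite ltr0_norm// mulrN -mulNr -mulrDl lerDr expR_ge0.
Qed.

Lemma sqr_le_expR (x : R) : 0 <= x -> x ^+ 2 / 4 <= expR x.
Proof.
move=> x0; rewrite [x in expR x](splitr x) expRD -expr2.
have h := expR_ge1Dx (x / 2).
have : (x / 2) ^+ 2 <= expR (x / 2) ^+ 2.
  by rewrite lerXn2r ?nnegrE ?expR_ge0 ?divr_ge0//; lra.
by lra.
Qed.

Lemma le_expRM (dl u : R) : 0 < dl -> `|u| <= dl^-1 * expR (dl * `|u|).
Proof.
move=> d0; rewrite mulrC ler_pdivlMr//; have := expR_ge1Dx (dl * `|u|); lra.
Qed.

Lemma sqr_le_expRM (dl u : R) : 0 < dl -> u ^+ 2 <= (4 / dl ^+ 2) * expR (dl * `|u|).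
Proof.
move=> d0; have h := @sqr_le_expR (dl * `|u|) (mulr_ge0 (ltW d0) (normr_ge0 u)).
rewrite mulrAC ler_pdivlMr ?exprn_gt0//.
move: h; rewrite exprMn real_normK ?num_real//; lra.
Qed.

(** Room on both sides of the abscissa [sg], as needed to differentiate under the
    integral sign. *)
Definition wLint h (sg dl : R) := Lint h (sg + dl) /\ Lint h (sg - dl).

Lemma wLint_weight h (sg dl : R) : wLint h sg dl ->
  rintegrable setT (fun u => h u * (expR ((sg + dl) * u) + expR ((sg - dl) * u))).
Proof.
move=> [I1 I2]; apply: eq_rintegrable (rintegrableD _ I1 I2) => // u _; by rewrite mulrDr.
Qed.

Lemma Lint_mulu h (sg dl : R) : 0 < dl -> measurable_fun [set: R] h -> (forall u, 0 <= h u) ->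
  wLint h sg dl -> Lint (fun u => `|u * h u|) sg.
Proof.
move=> d0 mh h0 Ih.
apply: (rintegrable_le (g := fun u => dl^-1 * (h u * (expR ((sg + dl) * u) + expR ((sg - dl) * u))))) => //.
- apply: measurable_funM; last exact: measurable_expRM.
  by apply: measurableT_comp => //; exact: measurable_funM.
- move=> u _; rewrite ger0_norm ?mulr_ge0 ?expR_ge0// normrM (ger0_norm (h0 u)).
  rewrite (mulrC `|u|) -mulrA [leRHS]mulrCA; apply: ler_wpM2l => //.
  apply: le_trans (_ : (dl^-1 * expR (dl * `|u|)) * expR (sg * u) <= _).
    by rewrite ler_wpM2r ?expR_ge0// le_expRM.
  by rewrite -mulrA ler_wpM2l ?invr_ge0 ?(ltW d0)// mulrC expR_weight.
- by apply: rintegrableZ => //; exact: wLint_weight.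
Qed.

(** Differentiation under the integral sign, with an explicit quadratic
    remainder coming from the one of the exponential. *)
Lemma is_derive_lap h s (dl : R) : 0 < dl -> measurable_fun [set: R] h -> (forall u, 0 <= h u) ->
  wLint h (cRe s) dl -> is_derive s (1 : CC R) (lap h) (lap (fun u => u * h u) s).
Proof.
move=> d0 mh h0 Ih; pose e := dl / 2; have e0 : 0 < e by rewrite divr_gt0.
pose wt u := h u * (expR ((cRe s + dl) * u) + expR ((cRe s - dl) * u)).
have [I1 I2] := Ih.
have Ib (sg : R) : cRe s - dl <= sg -> sg <= cRe s + dl -> Lint h sg.
  by move=> *; apply: Lint_between I2 I1.
have Iw : rintegrable setT wt := wLint_weight Ih.
pose K := 5 * (4 / e ^+ 2).
apply: (@is_derive_quad _ _ _ _ (K * rint setT wt) e e0) => w we.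
have mu : measurable_fun [set: R] (fun u => u * h u) by exact: measurable_funM.
have J0 : cintegrable setT (fun u => ofR (h u) * cexp (s * ofR u)).
  by apply: lap_integrable0 => //; apply: Ib; lra.
have J1 : cintegrable setT (fun u => ofR (h u) * cexp ((s + w) * ofR u)).
  apply: lap_integrable0 => //; rewrite cReD; have := normRe_le w; rewrite ler_norml.
  by move=> /andP[w1 w2]; apply: Ib; move: we; rewrite /e; lra.
have J2 : cintegrable setT (fun u => ofR (u * h u) * cexp (s * ofR u)).
  by apply: lap_integrable => //; exact: (Lint_mulu d0).
rewrite (mulrC _ w) /lap -(cintZ w measurableT J2) -(cintB measurableT J1 J0).
rewrite -(cintB measurableT (cintegrableB measurableT J1 J0) (cintegrableZ w measurableT J2)).
have E (a : R) : a * cabs w ^+ 2 = cabs w ^+ 2 * a by rewrite mulrC.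
rewrite mulrAC -rintZ//; apply: cabs_cint_le => //.
- exact: (cintegrableB measurableT (cintegrableB measurableT J1 J0) (cintegrableZ w measurableT J2)).
- exact: rintegrableZ.
move=> u _.
have -> : ofR (h u) * cexp ((s + w) * ofR u) - ofR (h u) * cexp (s * ofR u)
   - w * (ofR (u * h u) * cexp (s * ofR u)) =
   (ofR (h u) * cexp (s * ofR u)) * (cexp (w * ofR u) - 1 - w * ofR u).
  by rewrite mulrDl cexpD rmorphM; ring.
rewrite cabsM cabs_lap_integrand (ger0_norm (h0 u)).
have B1 := cexp_sub1B_le (w * ofR u); rewrite cabsM cabs_ofR in B1.
have B2 : cabs (cexp (w * ofR u) - 1 - w * ofR u) <= K * cabs w ^+ 2 * expR (dl * `|u|).
  apply: le_trans B1 _.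
  have -> : dl * `|u| = e * `|u| + e * `|u| by rewrite /e; field.
  rewrite expRD exprMn real_normK ?num_real//.
  have -> : K * cabs w ^+ 2 * (expR (e * `|u|) * expR (e * `|u|)) =
    5 * (cabs w ^+ 2 * (4 / e ^+ 2 * expR (e * `|u|))) * expR (e * `|u|) by rewrite /K; ring.
  have P : 0 <= cabs w ^+ 2 * u ^+ 2 by apply: mulr_ge0; exact: sqr_ge0.
  apply: ler_pM; [exact: mulr_ge0|exact: expR_ge0| |].
    by rewrite ler_pM2l// ler_wpM2l ?sqr_ge0// sqr_le_expRM.
  by rewrite ler_expR ler_wpM2r// ltW.
apply: le_trans (ler_wpM2l _ B2) _; first by rewrite mulr_ge0 ?expR_ge0.
rewrite /wt; have -> : h u * expR (cRe s * u) * (K * cabs w ^+ 2 * expR (dl * `|u|)) =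
  K * cabs w ^+ 2 * (h u * (expR (cRe s * u) * expR (dl * `|u|))) by ring.
have K0 : 0 <= K by rewrite /K mulr_ge0 ?divr_ge0 ?sqr_ge0.
have Kw : 0 <= K * cabs w ^+ 2 by apply: mulr_ge0 => //; exact: sqr_ge0.
apply: (ler_wpM2l Kw); apply: (ler_wpM2l (h0 u)); exact: expR_weight.
Qed.

(** ** Dominated convergence *)

Lemma rint_dominated (F : nat -> R -> R) (f g : R -> R) :
  (forall n, measurable_fun [set: R] (F n)) -> measurable_fun [set: R] f ->
  rintegrable setT g -> (forall n u, `|F n u| <= g u) ->
  (forall u, F n u @[n --> \oo] --> f u) ->
  rint setT (fun u => `|F n u - f u|) @[n --> \oo] --> 0.
Proof.
move=> mF mf Ig Fg Ff.
have mF' n : measurable_fun [set: R] (EFin \o F n) by exact/measurable_EFinP.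
have mf' : measurable_fun [set: R] (EFin \o f) by exact/measurable_EFinP.
have Ff' u : (EFin \o (F ^~ u)) n @[n --> \oo] --> (f u)%:E.
  by apply: cvg_EFin; [exact: nearW | exact: Ff].
have Fg' u n : (`|(F n u)%:E| <= (g u)%:E)%E by rewrite lee_fin.
have [| |If H _] := @dominated_convergence _ _ R (@lebesgue_measure R) setT measurableT
   (fun n => EFin \o F n) (EFin \o f) (EFin \o g) mF' mf' _ Ig _.
- by apply: aeW => u _; exact: Ff'.
- by apply: aeW => u n _; exact: Fg'.
rewrite /rint /Rintegral; apply/fine_cvg.
rewrite (_ : (fun _ => _) = (fun n => (\int[@lebesgue_measure R]_(x in setT) `|(F n x)%:E - (f x)%:E|)%E)) //.
Unshelve. all: by end_near. Qed.

(** Lebesgue's theorem for the real and imaginary parts, through the integral of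
    [|h_ n - h|]. *)
Lemma cvg_lap_dominated (h_ : nat -> R -> R) h g s :
  (forall n, measurable_fun [set: R] (h_ n)) -> measurable_fun [set: R] h ->
  (forall n u, `|h_ n u| <= g u) -> (forall u, `|h u| <= g u) ->
  (forall u, h_ n u @[n --> \oo] --> h u) -> Lint g (cRe s) ->
  lap (h_ n) s @[n --> \oo] --> lap h s.
Proof.
move=> mh_ mh hg_ hg hh Ig.
have me := measurable_expRM (cRe s).
have IA (f : R -> R) : measurable_fun [set: R] f -> (forall u, `|f u| <= g u) -> Lint (fun u => `|f u|) (cRe s).
  move=> mf fg; apply: rintegrable_le Ig => //.
    by apply: measurable_funM => //; exact: measurableT_comp.
  by move=> u _; rewrite ger0_norm ?mulr_ge0 ?expR_ge0// ler_wpM2r ?expR_ge0.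
have D : rint setT (fun u => `|h_ n u * expR (cRe s * u) - h u * expR (cRe s * u)|) @[n --> \oo] --> 0.
  apply: (@rint_dominated _ _ (fun u => g u * expR (cRe s * u))) => //.
  - by move=> n; exact: measurable_funM.
  - exact: measurable_funM.
  - by move=> n u; rewrite normrM (ger0_norm (expR_ge0 _)) ler_wpM2r ?expR_ge0.
  - by move=> u; apply: cvgM; [exact: hh | exact: cvg_cst].
apply/(@cvgCP _ _ \oo) => e e0; move/(@cvgRP _ _ \oo): D => /(_ _ e0).
apply: filterS => n; rewrite subr0; apply: le_lt_trans; apply: le_trans (ler_norm _).
have E : (fun u => `|h_ n u * expR (cRe s * u) - h u * expR (cRe s * u)|) =
    (fun u => `|h_ n u - h u| * expR (cRe s * u)).
  by apply/funext => u; rewrite -mulrBl normrM (ger0_norm (expR_ge0 _)).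
rewrite E -lapB ?IA//; apply: cabs_lap_le => //; first exact: measurable_funB.
have I2 : Lint (fun u => g u + g u) (cRe s) by exact: LintD.
apply: rintegrable_le I2 => //.
  by apply: measurable_funM => //; apply: measurableT_comp => //; exact: measurable_funB.
move=> u _; rewrite ger0_norm ?mulr_ge0 ?expR_ge0// ler_wpM2r ?expR_ge0//.
by rewrite (le_trans (ler_normB _ _))// lerD.
Qed.

Lemma negligible_point (f g : R -> R) (a : R) :
  measurable_fun [set: R] f -> measurable_fun [set: R] g ->
  (forall u, u != a -> f u = g u) -> rint setT f = rint setT g.
Proof.
move=> mf mg fg; rewrite /rint /Rintegral; congr fine.
apply: ae_eq_integral => //; [exact/measurable_EFinP|exact/measurable_EFinP|].
exists [set a]; split => //; first exact: lebesgue_measure_set1.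
move=> u /=; apply: contra_notP => /eqP ua _; by rewrite fg.
Qed.

(** Points are negligible; used at the origin, where half lines meet. *)
Lemma eq_lap_point h g (a : R) s : measurable_fun [set: R] h -> measurable_fun [set: R] g ->
  (forall u, u != a -> h u = g u) -> lap h s = lap g s.
Proof.
move=> mh mg hg; have [h1 h2] := cmeasurable_lap s mh; have [g1 g2] := cmeasurable_lap s mg.
congr Complex; apply: (negligible_point (a := a)) => // u ua; by rewrite hg.
Qed.

(** ** Integrability of exponential profiles *)

Lemma rintegrable_expR_abs (c : R) : 0 < c -> rintegrable setT (fun u => expR (- (c * `|u|))).
Proof.
move=> c0; pose pdf := @exponential_pdf R c.
have I1 : rintegrable setT pdf by exact: integrable_exponential_pdf.
have m1 : measurable_fun [set: R] pdf by exact: rintegrable_measurable I1.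
have I2 : rintegrable setT (fun u => pdf (- u)).
  have m2 : measurable_fun [set: R] (fun u => pdf (- u)) by exact: measurableT_comp.
  have [] := rint_opp m2; last by [].
  by apply: eq_rintegrable I1 => // u _; rewrite opprK.
apply: (rintegrable_le (g := fun u => c^-1 * (pdf u + pdf (- u)))) => //.
- apply: measurableT_comp => //; apply: measurableT_comp => //.
  by apply: measurable_funM => //; exact: measurableT_comp.
- move=> u _; rewrite ger0_norm ?expR_ge0// [leRHS]mulrC ler_pdivlMr// [leLHS]mulrC.
  have E v : 0 <= v -> pdf v = c * expR (- (c * v)).
    by move=> v0; rewrite /pdf (exponential_pdfE _ v0) mulNr.
  have [u0|u0] := leP 0 u.
    by rewrite ger0_norm// -E// lerDl exponential_pdf_ge0// ltW.
  have u1 : 0 <= - u by rewrite oppr_ge0 ltW.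
  by rewrite ltr0_norm// -E// lerDr exponential_pdf_ge0// ltW.
- by apply: rintegrableZ => //; exact: rintegrableD.
Qed.

Lemma Lint_of_decay h (C c sg : R) : 0 < c -> measurable_fun [set: R] h -> (forall u, 0 <= h u) ->
  (forall u, h u * expR (sg * u) <= C * expR (- (c * `|u|))) -> Lint h sg.
Proof.
move=> c0 mh h0 hC; apply: rintegrable_le (rintegrableZ C _ (rintegrable_expR_abs c0)) => //.
  by apply: measurable_funM => //; exact: measurable_expRM.
by move=> u _; rewrite ger0_norm// mulr_ge0 ?expR_ge0.
Qed.

End Laplace.

(** * The Gamma function as a Laplace transform *)

Section DeriveRules.
Context {R : realType}.
Implicit Types (f g : CC R -> CC R) (p : CC R).

Lemma is_derive_cstC (k p : CC R) : is_derive p (1 : CC R) (fun=> k : CC R) 0.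
Proof. exact: is_derive_cst. Qed.
Lemma is_derive_idC p : is_derive p (1 : CC R) (fun z : CC R => z) 1.
Proof. exact: is_derive_id. Qed.
Lemma is_deriveDC f g p (a b : CC R) : is_derive p (1 : CC R) f a -> is_derive p (1 : CC R) g b ->
  is_derive p (1 : CC R) (fun z => f z + g z) (a + b).
Proof. by move=> df dg; exact: (is_deriveD df dg). Qed.
Lemma is_deriveBC f g p (a b : CC R) : is_derive p (1 : CC R) f a -> is_derive p (1 : CC R) g b ->
  is_derive p (1 : CC R) (fun z => f z - g z) (a - b).
Proof. by move=> df dg; exact: (is_deriveB df dg). Qed.
Lemma is_deriveMC f g p (a b : CC R) : is_derive p (1 : CC R) f a -> is_derive p (1 : CC R) g b ->
  is_derive p (1 : CC R) (fun z => f z * g z) (a * g p + f p * b).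
Proof.
move=> df dg; have dm := is_deriveM df dg.
suff -> : a * g p + f p * b = f p *: (b : CC R) + g p *: (a : CC R) by exact: dm.
by rewrite addrC (mulrC a).
Qed.
Lemma is_deriveVC f p (a : CC R) : f p != 0 -> is_derive p (1 : CC R) f a ->
  is_derive p (1 : CC R) (fun z => (f z)^-1) (- a / f p ^+ 2).
Proof.
move=> f0 [dd da]; apply: (DeriveDef (derivableV f0 dd)).
transitivity (- (f p) ^- 2 *: derive f p (1 : CC R)); first exact: (deriveV f0 dd).
rewrite da; transitivity (- (f p) ^- 2 * a); first by [].
by rewrite mulrC mulrN mulNr.
Qed.

End DeriveRules.

Section GammaFunction.
Context {R : realType}.
Implicit Types (s z : CC R) (u x y : R).

Lemma onem_lb y : 0 <= y -> y < 1 -> expR (- (y / (1 - y))) <= 1 - y.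
Proof.
move=> y0 y1; have p : 0 < 1 - y by rewrite subr_gt0.
rewrite expRN -[leRHS]invrK lef_pV2 ?posrE ?expR_gt0 ?invr_gt0//.
apply: le_trans (expR_ge1Dx _); rewrite le_eqVlt; apply/orP; left; apply/eqP.
by field; rewrite lt0r_neq0.
Qed.

Lemma onem_ub y : 1 - y <= expR (- y).
Proof. exact: expR_ge1Dx. Qed.

Definition h0 u : R := (u <= 0 :> R)%R%:R.

Lemma measurable_h0 : measurable_fun [set: R] h0.
Proof.
rewrite (_ : h0 = \1_(`]-oo, 0%R]%classic)); first exact: measurable_indic.
by apply/funext => u; rewrite indicE /h0; congr (_%:R); rewrite mem_setE in_itv.
Qed.

Lemma h0_ge0 u : 0 <= h0 u. Proof. by rewrite /h0. Qed.

Lemma Lint_h0 (sg : R) : 0 < sg -> Lint h0 sg.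
Proof.
move=> sg0; apply: (@Lint_of_decay _ _ 1 sg) => //; first exact: measurable_h0.
move=> u; rewrite mul1r /h0; have [u0|u0] := leP u 0; last by rewrite mul0r expR_ge0.
by rewrite mul1r ler0_norm// mulrN opprK.
Qed.

Lemma h0_shift (a u : R) : 0 < a -> h0 (u - a) - h0 u = \1_(`]0%R, a]%classic) u.
Proof.
move=> a0; rewrite indicE mem_setE in_itv /= /h0 subr_le0.
by have [u0|u0] := leP u 0; have [ua|ua] := leP u a; rewrite ?subrr ?subr0 //; lra.
Qed.

(** Translating the half line by [a] multiplies its Laplace transform [F] by
    [exp (s a)], and adds an interval of length [a]; at first order in [a]
    this reads [s F = 1]. *)
Lemma lap_h0 s : 0 < cRe s -> lap h0 s = s^-1.
Proof.
move=> s0; set F := lap h0 s.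
have sn0 : s != 0 by apply/eqP => E; move: s0; rewrite E cRe0 ltxx.
have IF := Lint_h0 s0.
pose K := cabs s + 5 * cabs s ^+ 2 * expR (cabs s).
have c5 : 0 <= 5 * cabs s ^+ 2 * expR (cabs s).
  by apply: mulr_ge0; [apply: mulr_ge0 => //; exact: sqr_ge0 | exact: expR_ge0].
have K0 : 0 <= K by apply: addr_ge0; [exact: cabs_ge0 | exact: c5].
have expb (u : R) : 0 <= u -> u <= 1 -> cabs (cexp (s * ofR u) - 1 - s * ofR u) <=
    (5 * cabs s ^+ 2 * expR (cabs s)) * u ^+ 2.
  move=> u0 u1; apply: le_trans (cexp_sub1B_le _) _.
  rewrite cabsM cabs_ofR (ger0_norm u0) exprMn.
  have -> : 5 * cabs s ^+ 2 * expR (cabs s) * u ^+ 2 = 5 * (cabs s ^+ 2 * u ^+ 2) * expR (cabs s) by ring.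
  apply: ler_wpM2l; first by apply: mulr_ge0 => //; apply: mulr_ge0; exact: sqr_ge0.
  by rewrite ler_expR ler_piMr ?cabs_ge0.
have key (a : R) : 0 < a -> a <= 1 -> cabs ((cexp (s * ofR a) - 1) * F - ofR a) <= K * a ^+ 2.
  move=> a0 a1; have [E I'] := lap_shift a measurable_h0 h0_ge0 IF.
  have ms : measurable_fun [set: R] (fun u => h0 (u - a)).
    by apply: (measurableT_comp measurable_h0); exact: measurable_funB.
  have D : lap (\1_(`]0%R, a]%classic)) s = (cexp (s * ofR a) - 1) * F.
    rewrite mulrBl mul1r -E -lapB //; [|exact: measurable_h0|exact: Lint_norm|].
      by apply: eq_lap => u; rewrite h0_shift.
    by apply: Lint_norm => // u; exact: h0_ge0.
  have mi : measurable_fun [set: R] (\1_(`]0%R, a]%classic) : R -> R) by exact: measurable_indic.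
  have Ii : rintegrable setT (\1_(`]0%R, a]%classic) : R -> R) by exact: integrable_indic_itv.
  have Ai : rint setT (\1_(`]0%R, a]%classic) : R -> R) = a.
    rewrite /rint /Rintegral integral_indic// setIT.
    rewrite [X in fine X](_ : _ = (a - 0)%:E); first by rewrite subr0.
    apply: etrans (@lebesgue_measure_itv R (Interval (BRight 0%R) (BRight a))) _.
    by rewrite /= lte_fin a0 EFinB.
  have Li : Lint (fun u => `|\1_(`]0%R, a]%classic) u : R|) (cRe s).
    apply: eq_Lint (LintD I' (LintZ (-1) IF)) => u.
    by rewrite mulN1r h0_shift// ger0_norm.
  rewrite -D -{2}Ai -cint_ofR /lap -cintB; last 3 first.
  - exact: measurableT.
  - exact: lap_integrable.
  - exact: cintegrable_ofR.
  have -> : K * a ^+ 2 = K * a * rint setT (\1_(`]0%R, a]%classic) : R -> R).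
    by rewrite Ai expr2 mulrA.
  rewrite -(rintZ (K * a) measurableT Ii).
  apply: cabs_cint_le => //.
  - apply: cintegrableB => //; [exact: lap_integrable | exact: cintegrable_ofR].
  - exact: rintegrableZ.
  move=> u _; rewrite -[X in _ - X]mulr1 -mulrBr cabsM cabs_ofR indicE mem_setE in_itv /=.
  have [/andP[u0 ua]|_] := boolP (0 < u <= a); last by rewrite normr0 mul0r mulr0.
  rewrite normr1 mul1r mulr1.
  have -> : cexp (s * ofR u) - 1 = (cexp (s * ofR u) - 1 - s * ofR u) + s * ofR u by ring.
  have u1 := le_trans ua a1.
  apply: le_trans (cabsD _ _) _; rewrite cabsM cabs_ofR (gtr0_norm u0).
  apply: le_trans (lerD (expb _ (ltW u0) u1) (lexx _)) _.
  have -> : K * a = 5 * cabs s ^+ 2 * expR (cabs s) * a + cabs s * a by rewrite /K; ring.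
  apply: lerD; last by rewrite ler_wpM2l ?cabs_ge0.
  apply: (ler_wpM2l c5).
  by rewrite expr2 -[leRHS]mulr1 ler_pM ?(ltW u0).
pose K' := (5 * cabs s ^+ 2 * expR (cabs s)) * cabs F + K.
have K'0 : 0 <= K' by apply: addr_ge0 => //; apply: mulr_ge0; [exact: c5 | exact: cabs_ge0].
have fin (a : R) : 0 < a -> a <= 1 -> cabs (s * F - 1) <= K' * a.
  move=> a0 a1; rewrite -(ler_pM2r a0) -mulrA -expr2.
  rewrite -{1}(gtr0_norm a0) -cabs_ofR -cabsM.
  have -> : (s * F - 1) * ofR a = ((cexp (s * ofR a) - 1) * F - ofR a) -
     (cexp (s * ofR a) - 1 - s * ofR a) * F by ring.
  apply: le_trans (cabsB _ _) _; rewrite cabsM.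
  have h1 := key a a0 a1; have h2 := expb a (ltW a0) a1.
  have := ler_wpM2r (cabs_ge0 F) h2; rewrite /K'; lra.
apply: (mulfI sn0); rewrite divff//; apply/eqP; rewrite -subr_eq0 -cabs_eq0.
apply/eqP/le_anti; rewrite cabs_ge0 andbT; apply/ler_addgt0Pr => e e0; rewrite add0r.
have d0 : 0 < K' + e by rewrite ltr_wpDl.
apply: le_trans (fin (e / (K' + e)) _ _) _; first by rewrite divr_gt0.
  by rewrite ler_pdivrMr// mul1r lerDr.
by rewrite mulrCA ler_piMr ?(ltW e0)// ler_pdivrMr// mul1r lerDl ltW.
Qed.

(** The transform of this profile is the beta integral [B(s, n + 1)]. *)
Definition beta_profile n u : R := h0 u * (1 - expR u) ^+ n.

Lemma measurable_beta_profile n : measurable_fun [set: R] (beta_profile n).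
Proof.
apply: measurable_funM; first exact: measurable_h0.
by apply: measurable_funX; apply: measurable_funB.
Qed.

Lemma onem_expR u : u <= 0 -> 0 <= 1 - expR u <= 1.
Proof.
by move=> u0; rewrite subr_ge0 lerBlDr lerDl expR_ge0 andbT -[leRHS]expR0 ler_expR.
Qed.

Lemma beta_profile_ge0 n u : 0 <= beta_profile n u.
Proof.
rewrite /beta_profile /h0; have [u0|_] := leP u 0; last by rewrite mul0r.
by rewrite mul1r exprn_ge0//; have /andP[] := onem_expR u0.
Qed.

Lemma beta_profile_le n u : beta_profile n u <= h0 u.
Proof.
rewrite /beta_profile /h0; have [u0|_] := leP u 0; last by rewrite mul0r.
by rewrite mul1r; have /andP[p1 p2] := onem_expR u0; exact: exprn_ile1.
Qed.

Lemma Lint_beta_profile n (sg : R) : 0 < sg -> Lint (beta_profile n) sg.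
Proof.
move=> sg0; apply: Lint_le (Lint_h0 sg0); [exact: measurable_beta_profile|exact: beta_profile_ge0|exact: beta_profile_le].
Qed.

Lemma addn_neq0 s (k : nat) : 0 < cRe s -> s + k%:R != 0.
Proof.
move=> s0; apply/eqP => /(congr1 (@cRe R)); rewrite cReD cRe_nat cRe0.
by have := ler0n R k; lra.
Qed.

(** Induction on [n] from [B(s, n + 1) = B(s, n) - B(s + 1, n)]. *)
Lemma lap_beta_profile n s : 0 < cRe s -> lap (beta_profile n) s = n`!%:R / \prod_(0 <= k < n.+1) (s + k%:R).
Proof.
elim: n s => [|n IH] s s0.
  rewrite big_nat1 addr0 fact0 mul1r -lap_h0//; apply: eq_lap => u.
  by rewrite /beta_profile expr0 mulr1.
have s1 : 0 < cRe (s + 1) by rewrite cReD cRe1; lra.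
have E : lap (beta_profile n.+1) s = lap (beta_profile n) s - lap (beta_profile n) (s + 1).
  rewrite -(rmorph1 (@ofR R)) -lap_exp -lapB.
  - by apply: eq_lap => u; rewrite /beta_profile exprSr mul1r; ring.
  - exact: measurable_beta_profile.
  - by apply: measurable_funM; [exact: measurable_beta_profile | exact: measurable_expRM].
  - by apply: Lint_norm; [exact: beta_profile_ge0 | exact: Lint_beta_profile].
  - apply: Lint_norm; first by move=> u; rewrite mulr_ge0 ?beta_profile_ge0 ?expR_ge0.
    by apply: Lint_exp; apply: Lint_beta_profile; lra.
rewrite E !IH//.
have -> : \prod_(0 <= k < n.+1) (s + 1 + k%:R) = \prod_(0 <= k < n.+1) (s + k.+1%:R).
  by apply: eq_bigr => k _; rewrite -natr1; ring.
rewrite [\prod_(0 <= k < n.+2) _]big_nat_recr//= [\prod_(0 <= k < n.+1) (s + k%:R)]big_nat_recl//.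
rewrite big_nat_recr//=.
set Q := \prod_(0 <= i < n) _.
have Q0 : Q != 0 by rewrite /Q prodf_seq_neq0; apply/allP => k _; rewrite /= addn_neq0.
have a0 := addn_neq0 0 s0; rewrite addr0 in a0.
have b0 := addn_neq0 n.+1 s0.
rewrite factS natrM addr0; move: b0; set w := s + n.+1%:R => b0.
have -> : n.+1%:R = w - s by rewrite /w addrC addKr.
by field; rewrite Q0 b0 a0.
Qed.

(** In the variable [exp u], Euler's integrand for the Gamma function. *)
Definition gumbel u : R := expR (- expR u).

Lemma measurable_gumbel : measurable_fun [set: R] gumbel.
Proof. by apply: measurableT_comp => //; apply: measurableT_comp. Qed.

Lemma gumbel_ge0 u : 0 <= gumbel u. Proof. exact: expR_ge0. Qed.

(** The exponential [expR u] beats any multiple of [u] on the right, which makes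
    the product decay on both sides. *)
Lemma gumbel_le (sg u : R) : 0 <= sg -> gumbel u * expR (sg * u) <= expR (4 * sg ^+ 2) * expR (- (sg * `|u|)).
Proof.
move=> s0; rewrite /gumbel -!expRD ler_expR; have [u0|u0] := leP 0 u.
  rewrite ger0_norm//; have := sqr_le_expR u0; have := sqr_ge0 (u / 2 - 2 * sg); nra.
rewrite ltr0_norm// mulrN opprK; have := expR_ge0 u; have := sqr_ge0 sg; lra.
Qed.

Lemma Lint_gumbel (sg : R) : 0 < sg -> Lint gumbel sg.
Proof.
move=> s0; apply: (Lint_of_decay s0 measurable_gumbel gumbel_ge0) => u; exact: gumbel_le (ltW s0).
Qed.

(** The beta profile translated so that its transform is Gauss's product. *)
Definition gauss_profile n u : R := beta_profile n.+1 (u - ln n.+1%:R).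

Lemma measurable_gauss_profile n : measurable_fun [set: R] (gauss_profile n).
Proof. by apply: (measurableT_comp (measurable_beta_profile _)); exact: measurable_funB. Qed.

Lemma gauss_profile_ge0 n u : 0 <= gauss_profile n u. Proof. exact: beta_profile_ge0. Qed.

Lemma gauss_profileE n u : gauss_profile n u = h0 (u - ln n.+1%:R) * (1 - expR u / n.+1%:R) ^+ n.+1.
Proof. by rewrite /gauss_profile /beta_profile expRD expRN lnK// posrE. Qed.

(** The inequality [(1 - y / n) ^ n <= exp (- y)] gives the domination needed to
    pass from Gauss's products to Euler's integral. *)
Lemma gauss_profile_le n u : gauss_profile n u <= gumbel u.
Proof.
rewrite gauss_profileE /h0 subr_le0; have [u0|_] := leP u (ln n.+1%:R); last by rewrite mul0r gumbel_ge0.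
have p : 0 <= 1 - expR u / n.+1%:R.
  by rewrite subr_ge0 ler_pdivrMr// mul1r -[leRHS]lnK ?posrE// ler_expR.
have -> : gumbel u = expR (- (expR u / n.+1%:R)) ^+ n.+1.
  by rewrite -expRM_natl mulrN mulrC divfK.
by rewrite mul1r lerXn2r ?nnegrE ?expR_ge0// onem_ub.
Qed.

(** Squeeze [1 - y] between [exp (- y / (1 - y))] and [exp (- y)]. *)
Lemma cvg_powR_expR (N : nat -> nat) (y : nat -> R) (l : R) :
  (forall n, 0 <= y n) -> y n @[n --> \oo] --> 0 -> (N n)%:R * y n @[n --> \oo] --> l ->
  (1 - y n) ^+ N n @[n --> \oo] --> expR (- l).
Proof.
move=> y0 yl Nl.
have near1 : \forall n \near \oo, y n < 1.
  move/(@cvgRP _ _ \oo): yl => /(_ _ ltr01); apply: filterS => n.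
  by rewrite subr0 ger0_norm.
apply: (@squeeze_cvgr _ _ _ _ (fun n => expR (- ((N n)%:R * y n / (1 - y n)))) (fun n => expR (- ((N n)%:R * y n)))).
- near=> n; have y1 : y n < 1 by near: n.
  have p : 0 <= 1 - y n by rewrite subr_ge0 ltW.
  apply/andP; split.
    have -> : - ((N n)%:R * y n / (1 - y n)) = (N n)%:R * - (y n / (1 - y n)) by ring.
    by rewrite expRM_natl lerXn2r ?nnegrE ?expR_ge0// onem_lb.
  have -> : - ((N n)%:R * y n) = (N n)%:R * - y n by ring.
  by rewrite expRM_natl lerXn2r ?nnegrE ?expR_ge0// onem_ub.
- apply: continuous_cvg; first exact: continuous_expR.
  apply: cvgN; rewrite -[X in _ --> X]divr1; apply: cvgM => //.
  apply: cvgV; first exact: oner_neq0.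
  by rewrite -[X in _ --> X]subr0; apply: cvgB => //; exact: cvg_cst.
- by apply: continuous_cvg; [exact: continuous_expR | exact: cvgN].
Unshelve. all: by end_near. Qed.

Lemma cvg_gauss_profile u : gauss_profile n u @[n --> \oo] --> gumbel u.
Proof.
have P : (1 - expR u / n.+1%:R) ^+ n.+1 @[n --> \oo] --> gumbel u.
  apply: (@cvg_powR_expR (fun n => n.+1) (fun n => expR u / n.+1%:R)).
  - by move=> n; rewrite divr_ge0 ?expR_ge0.
  - rewrite -[X in _ --> X](mulr0 (expR u)); apply: cvgM; [exact: cvg_cst | exact: cvg_harmonic].
  - rewrite (_ : (fun _ => _) = (fun=> expR u)); first exact: cvg_cst.
    by apply/funext => n; rewrite mulrC divfK.
apply: cvg_trans P; apply: near_eq_cvg; near=> n; rewrite gauss_profileE /h0 subr_le0.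
rewrite (_ : u <= ln n.+1%:R) ?mul1r//.
rewrite -ler_expR lnK ?posrE//; near: n.
by exists (Num.truncn (expR u)) => // n /= nu; rewrite (le_trans (ltW (truncnS_gt _)))// ler_nat.
Unshelve. all: by end_near. Qed.

Definition gauss (n : nat) s : CC R :=
  n`!%:R * cpow n%:R s / \prod_(0 <= k < n.+1) (s + k%:R).

Lemma lap_gauss_profile n s : 0 < cRe s -> lap (gauss_profile n) s = gauss n.+1 s.
Proof.
move=> s0.
have [-> _] := lap_shift (ln n.+1%:R) (measurable_beta_profile n.+1) (@beta_profile_ge0 n.+1) (Lint_beta_profile n.+1 s0).
by rewrite lap_beta_profile// /gauss /cpow; ring.
Qed.

Lemma cvg_gauss s : 0 < cRe s -> gauss n s @[n --> \oo] --> lap gumbel s.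
Proof.
move=> s0; rewrite -(cvg_shiftS (fun n => gauss n s)).
have : lap (gauss_profile n) s @[n --> \oo] --> lap gumbel s.
  apply: (@cvg_lap_dominated _ _ _ gumbel).
  - exact: measurable_gauss_profile.
  - exact: measurable_gumbel.
  - by move=> n u; rewrite ger0_norm ?gauss_profile_ge0// gauss_profile_le.
  - by move=> u; rewrite ger0_norm ?gumbel_ge0.
  - exact: cvg_gauss_profile.
  - exact: Lint_gumbel.
by apply: cvg_trans; apply: near_eq_cvg; near=> n; rewrite lap_gauss_profile.
Unshelve. all: by end_near. Qed.

(** Gauss's product is the transform of a profile dominated by Euler's
    integrand, to which it converges. *)
Lemma GammaE s : 0 < cRe s -> Gamma s = lap gumbel s.
Proof. by move=> s0; apply/cvg_lim => //; exact: cvg_gauss. Qed.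

Lemma wLint_half h s : (forall sg, 0 < sg -> Lint h sg) -> 0 < cRe s ->
  wLint h (cRe s) (cRe s / 2).
Proof. by move=> H s0; split; apply: H; lra. Qed.

Lemma is_derive_lap_gumbel s : 0 < cRe s ->
  is_derive s (1 : CC R) (lap gumbel) (lap (fun u => u * gumbel u) s).
Proof.
move=> s0; apply: (is_derive_lap (divr_gt0 s0 (ltr0n R 2))); [exact: measurable_gumbel|exact: gumbel_ge0|].
by apply: wLint_half => // sg; exact: Lint_gumbel.
Qed.

Lemma near_cRe_gt0 s : 0 < cRe s -> \forall w \near s, 0 < cRe w.
Proof.
move=> s0; apply/nbhsCP; exists (cRe s) => // w ws.
have := normRe_le (w - s); rewrite cReB => h; have := le_lt_trans h ws.
by rewrite ltr_norml => /andP[h1 _]; lra.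
Qed.

Lemma is_derive_Gamma s : 0 < cRe s ->
  is_derive s (1 : CC R) (@Gamma R) (lap (fun u => u * gumbel u) s).
Proof.
move=> s0; apply: is_derive_nbhsC (is_derive_lap_gumbel s0).
by apply: filterS (near_cRe_gt0 s0) => w w0; rewrite GammaE.
Qed.

Lemma is_derive_prod_inv N s : 0 < cRe s ->
  is_derive s (1 : CC R) (fun s => (\prod_(0 <= k < N) (s + k%:R))^-1)
    (- (\prod_(0 <= k < N) (s + k%:R))^-1 * \sum_(0 <= k < N) (s + k%:R)^-1).
Proof.
move=> s0; elim: N => [|N IH].
  rewrite !big_geq// mulr0.
  rewrite (_ : (fun _ => _) = (fun=> 1)); first exact: is_derive_cst.
  by apply/funext => z; rewrite big_geq// invr1.
have dl := is_deriveDC (is_derive_idC s) (is_derive_cstC N%:R s).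
have dm := is_deriveMC IH (@is_deriveVC R (fun z => z + N%:R) s _ (addn_neq0 N s0) dl).
rewrite (_ : (fun s => (\prod_(0 <= k < N.+1) (s + k%:R))^-1) =
  (fun s => (\prod_(0 <= k < N) (s + k%:R))^-1 * (s + N%:R)^-1)); last first.
  by apply/funext => z; rewrite big_nat_recr//= invfM.
have E : (\prod_(0 <= k < N.+1) (s + k%:R))^-1 =
    (\prod_(0 <= k < N) (s + k%:R))^-1 * (s + N%:R)^-1 by rewrite big_nat_recr//= invfM.
apply: is_derive_eq dm _; rewrite E [\sum_(0 <= k < N.+1) _]big_nat_recr//=.
move: (\prod_(0 <= k < N) _)^-1 (\sum_(0 <= k < N) _) => P S.
by field; apply: addn_neq0.
Qed.

Definition digam (n : nat) s : CC R :=
  ofR (ln n%:R) - \sum_(0 <= k < n.+1) (s + k%:R)^-1.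

Lemma is_derive_gauss n s : 0 < cRe s ->
  is_derive s (1 : CC R) (gauss n) (gauss n s * digam n s).
Proof.
move=> s0; have d1 := is_derive_prod_inv n.+1 s0.
have d2 : is_derive s (1 : CC R) (fun s => cexp (ofR (ln n%:R) * s)) (cexp (ofR (ln n%:R) * s) * ofR (ln n%:R)).
  by apply: is_derive_scaleC; exact: is_derive_cexp.
have dm := is_deriveMC (is_deriveMC (is_derive_cstC n`!%:R s) d2) d1.
rewrite (_ : gauss n = (fun s => n`!%:R * cexp (ofR (ln n%:R) * s) *
  (\prod_(0 <= k < n.+1) (s + k%:R))^-1)); last first.
  by apply/funext => z; rewrite /gauss /cpow (mulrC z).
apply: is_derive_eq dm _; rewrite /digam.
move: (\prod_(0 <= k < n.+1) _)^-1 (\sum_(0 <= k < n.+1) _) => P S; ring.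
Qed.

(** Both [gauss] and its derivative converge, so its logarithmic derivative,
    which is explicit, converges to the digamma function. *)
Lemma cvg_digam s : 0 < cRe s -> Gamma s != 0 ->
  digam n s @[n --> \oo] --> logderiv (@Gamma R) s.
Proof.
move=> s0 g0; rewrite /logderiv (is_derive_derive1C (is_derive_Gamma s0)).
rewrite -(cvg_shiftS (fun n => digam n s)).
have sh := divr_gt0 s0 (ltr0n R 2).
have wn n : wLint (gauss_profile n) (cRe s) (cRe s / 2).
  apply: wLint_half => // sg sg0; apply: Lint_le (Lint_gumbel sg0).
  - exact: measurable_gauss_profile.
  - exact: gauss_profile_ge0.
  - exact: gauss_profile_le.
have E n : lap (fun u => u * gauss_profile n u) s = gauss n.+1 s * digam n.+1 s.
  have dg : is_derive s (1 : CC R) (lap (gauss_profile n)) (gauss n.+1 s * digam n.+1 s).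
    apply: is_derive_nbhsC (is_derive_gauss n.+1 s0).
    by apply: filterS (near_cRe_gt0 s0) => w w0; rewrite lap_gauss_profile.
  have dl := is_derive_lap sh (measurable_gauss_profile n) (@gauss_profile_ge0 n) (wn n).
  by rewrite -(is_derive_derive1C dl) (is_derive_derive1C dg).
have gn0 n : gauss n s != 0.
  rewrite /gauss; apply: mulf_neq0.
    by apply: mulf_neq0; [rewrite pnatr_eq0 -lt0n fact_gt0 | exact: cexp_neq0].
  rewrite invr_eq0; by rewrite prodf_seq_neq0; apply/allP => k _; rewrite /= addn_neq0.
have -> : (fun n => digam n.+1 s) = (fun n => lap (fun u => u * gauss_profile n u) s * (gauss n.+1 s)^-1).
  by apply/funext => n; rewrite E mulrAC divff ?mul1r.
apply: cvgM; last first.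
  by apply: cvgV => //; rewrite (cvg_shiftS (fun n => gauss n s)) GammaE//; exact: cvg_gauss.
apply: (@cvg_lap_dominated _ _ _ (fun u => `|u * gumbel u|)).
- by move=> n; apply: measurable_funM => //; exact: measurable_gauss_profile.
- by apply: measurable_funM => //; exact: measurable_gumbel.
- move=> n u; rewrite (normrM u (gauss_profile n u)) (normrM u (gumbel u)) (ger0_norm (gauss_profile_ge0 _ _)) (ger0_norm (gumbel_ge0 _)).
  by rewrite ler_wpM2l// gauss_profile_le.
- by [].
- by move=> u; apply: cvgM; [exact: cvg_cst | exact: cvg_gauss_profile].
- apply: (Lint_mulu sh measurable_gumbel gumbel_ge0); apply: wLint_half => // sg; exact: Lint_gumbel.
Qed.

End GammaFunction.

(** * The theta identity, after Polya *)

Section Tannery.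
Context {R : realType}.

(** Tannery's theorem. A long partial sum of [g] leaves a small tail, which
    bounds, uniformly in [m], what the other terms contribute to either side. *)
Lemma tannery (f : nat -> nat -> R) (F g : nat -> R) (N : nat -> nat) :
  (forall k, f m k @[m --> \oo] --> F k) -> (forall k, 0 <= g k) ->
  (\forall m \near \oo, forall k, (k < N m)%N -> `|f m k| <= g k) ->
  (forall K, \forall m \near \oo, (K <= N m)%N) ->
  cvgn (series g) ->
  \sum_(0 <= k < N m) f m k @[m --> \oo] --> limn (series F).
Proof.
move=> fF g0 fg NK cg.
have Fg k : `|F k| <= g k.
  have c1 : `|f m k| @[m --> \oo] --> `|F k| by apply: cvg_norm; exact: fF.
  have c2 : g k @[m --> \oo] --> g k by exact: cvg_cst.
  apply: (ler_cvg_to c1 c2).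
  near=> m; have H : forall k, (k < N m)%N -> `|f m k| <= g k by near: m.
  by apply: H; near: m; exact: NK.
have cF : cvgn (series F).
  by apply: normed_cvg; exact: (@series_le_cvg _ (fun k => `|F k|) g (fun k => normr_ge0 _) g0 Fg cg).
set s := limn (series g); set L := limn (series F).
have mg : {homo series g : n m / (n <= m)%N >-> n <= m}.
  by apply: nondecreasing_series => n _ _; exact: g0.
have gs n : series g n <= s by exact: nondecreasing_cvgn_le.
have tail (h : nat -> R) n m : (forall k, (k < m)%N -> `|h k| <= g k) -> (n <= m)%N ->
    `|\sum_(0 <= k < m) h k - \sum_(0 <= k < n) h k| <= s - series g n.
  move=> hg nm; rewrite (big_cat_nat (n := n)) //= addrAC subrr add0r.
  apply: le_trans (ler_norm_sum _ _ _) _.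
  apply: (@le_trans _ _ (\sum_(n <= k < m) g k)).
    by rewrite !big_seq; apply: ler_sum => k; rewrite mem_index_iota => /andP[_ km]; exact: hg.
  by have := gs m; rewrite /series /= (big_cat_nat (n := n) (p := m)) //=; lra.
have FL n : `|L - series F n| <= s - series g n.
  have c1 : `|series F m - series F n| @[m --> \oo] --> `|L - series F n|.
    by apply: cvg_norm; apply: cvgB; [exact: cF | exact: cvg_cst].
  have c2 : s - series g n @[m --> \oo] --> s - series g n by exact: cvg_cst.
  apply: (ler_cvg_to c1 c2); near=> m; apply: tail => //; near: m; exact: nbhs_infty_ge.
apply/(@cvgRP _ _ \oo) => e e0.
have e4 : 0 < e / 4 by rewrite divr_gt0.
have [n nP] : exists n, s - series g n < e / 4.
  have /(@cvgRP _ _ \oo)/(_ _ e4) H : series g n @[n --> \oo] --> s by exact: cg.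
  have [n _ nP] := H; exists n; have := nP n (leqnn n).
  by rewrite /= ltr_norml => /andP[h _]; lra.
have c3 : \sum_(0 <= k < n) f m k @[m --> \oo] --> series F n.
  rewrite /series /=; elim: (n) => [|n' IH].
    rewrite (_ : (fun _ => _) = (fun=> 0)); first by rewrite big_geq//; exact: cvg_cst.
    by apply/funext => m; rewrite big_geq.
  rewrite (_ : (fun _ => _) = (fun m => \sum_(0 <= k < n') f m k + f m n')); last first.
    by apply/funext => m; rewrite big_nat_recr.
  by rewrite big_nat_recr//=; apply: cvgD; [exact: IH | exact: fF].
move/(@cvgRP _ _ \oo): c3 => /(_ _ e4) c3.
near=> m.
have H1 : forall k, (k < N m)%N -> `|f m k| <= g k by near: m.
have nN : (n <= N m)%N by near: m; exact: NK.
have H2 : `|\sum_(0 <= k < n) f m k - series F n| < e / 4 by near: m.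
have H3 := tail (f m) n (N m) H1 nN.
have H4 := FL n.
have -> : \sum_(0 <= k < N m) f m k - L = (\sum_(0 <= k < N m) f m k - \sum_(0 <= k < n) f m k)
  + (\sum_(0 <= k < n) f m k - series F n) - (L - series F n) by ring.
apply: le_lt_trans (ler_normB _ _) _; apply: le_lt_trans (lerD (ler_normD _ _) (lexx _)) _.
by lra.
Unshelve. all: by end_near. Qed.

End Tannery.

Section RootsOfUnity.
Context {R : realType}.

Definition rot (x : R) : CC R := cexp (im R * ofR x).

Lemma rotD x y : rot (x + y) = rot x * rot y.
Proof. by rewrite /rot rmorphD mulrDr cexpD. Qed.
Lemma rotX x n : rot x ^+ n = rot (n%:R * x).
Proof. by rewrite /rot cexpX; congr cexp; rewrite rmorphM rmorph_nat; ring. Qed.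
Lemma cRe_rot x : cRe (rot x) = cos x.
Proof. by rewrite cRe_cexp !cE !(mul0r, mul1r, mulr0, subr0, expR0, add0r, addr0). Qed.
Lemma cIm_rot x : cIm (rot x) = sin x.
Proof. by rewrite cIm_cexp !cE !(mul0r, mul1r, mulr0, subr0, expR0, add0r, addr0). Qed.
Lemma rot_2pi : rot (2 * pi) = 1.
Proof.
by apply: ceqP; rewrite ?cRe_rot ?cIm_rot !cE -mulr_natl ?mulr_natl ?cos2pi ?sin2pi.
Qed.
Lemma rot_2pin n : rot (n%:R * (2 * pi)) = 1.
Proof. by rewrite -rotX rot_2pi expr1n. Qed.
Lemma rot_cos x : rot (- x) + rot x = ofR (2 * cos x).
Proof.
by apply: ceqP; rewrite ?cReD ?cImD ?cRe_rot ?cIm_rot ?cRe_ofR ?cIm_ofR ?cosN ?sinN; ring.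
Qed.

Variable m : nat.
Hypothesis m0 : (0 < m)%N.
Let mR0 : (m%:R : R) != 0. Proof. by rewrite pnatr_eq0 -lt0n. Qed.

Definition root1 : CC R := rot (2 * pi / m%:R).

Lemma root1_m : root1 ^+ m = 1.
Proof. by rewrite /root1 rotX mulrC divfK// rot_2pi. Qed.

Lemma root1_neq1 d : (0 < d < m)%N -> root1 ^+ d != 1.
Proof.
move=> /andP[d0 dm]; rewrite /root1 rotX; apply/eqP => /(congr1 (@cRe R)).
pose x : R := d%:R * pi / m%:R.
have -> : d%:R * (2 * pi / m%:R) = x + x by rewrite /x; field; exact: mR0.
rewrite cRe_rot cRe1 cosD -!expr2 cos2sin2 => E.
have : 0 < sin x.
  apply: sin_gt0_pi; have p0 := pi_gt0 R; apply/andP; split.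
    by rewrite /x divr_gt0 ?mulr_gt0 ?ltr0n.
  by rewrite /x ltr_pdivrMr ?ltr0n// mulrC ltr_pM2l// ltr_nat.
move=> s0; have s2 : 0 < sin x ^+ 2 by rewrite exprn_gt0.
by lra.
Qed.

Lemma sum_root1 e : \sum_(0 <= j < m) (root1 ^+ e) ^+ j = if (m %| e)%N then m%:R else 0.
Proof.
case: ifPn => me.
  have -> : root1 ^+ e = 1 by rewrite -(divnK me) mulnC exprM root1_m expr1n.
  by rewrite (eq_bigr (fun=> 1)) => [|j _]; rewrite ?expr1n// big_const_nat iter_addr addr0 subn0.
have w1 : root1 ^+ e != 1.
  rewrite (divn_eq e m) exprD mulnC exprM root1_m expr1n mul1r root1_neq1//.
  by rewrite ltn_mod m0 lt0n andbT.
have := subrX1 (root1 ^+ e) m; rewrite -exprM mulnC exprM root1_m expr1n subrr.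
move=> /esym/eqP; rewrite mulf_eq0 subr_eq0 (negbTE w1) /= => /eqP.
by rewrite big_mkord.
Qed.

(** Binomial expansion of [2 cos] as a sum of two opposite rotations. The
    exponent [- n] is written [m.-1 * n], which is the same modulo [m]. *)
Lemma cos_pow n (j : nat) : ofR ((2 * cos (pi * j%:R / m%:R)) ^+ (2 * n)) =
  \sum_(0 <= l < (2 * n).+1) 'C(2 * n, l)%:R * (root1 ^+ (l + (m.-1) * n)) ^+ j.
Proof.
set th := pi * j%:R / m%:R; rewrite rmorphXn /= -rot_cos exprDn big_mkord.
apply: eq_bigr => l _; rewrite mulr_natl; congr (_ *+ _).
rewrite /root1 !rotX -rotD.
have ll : (l <= 2 * n)%N by rewrite -ltnS.
have -> : j%:R * ((l + m.-1 * n)%:R * (2 * pi / m%:R)) =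
    ((2 * n - l)%:R * - th + l%:R * th) + (j * n)%:R * (2 * pi).
  rewrite natrB// !natrD !natrM -subn1 natrB// /th; field.
  exact: mR0.
by rewrite [RHS]rotD rot_2pin mulr1.
Qed.

(** Averaging over the roots of unity keeps the exponents divisible by [m]. *)
Lemma sum_cos_pow n : \sum_(0 <= j < m) (2 * cos (pi * j%:R / m%:R)) ^+ (2 * n) =
  m%:R * (\sum_(0 <= l < (2 * n).+1 | (m %| l + m.-1 * n)%N) 'C(2 * n, l))%:R :> R.
Proof.
apply: (@ofR_inj R); rewrite rmorph_sum /=.
rewrite (eq_bigr _ (fun j _ => cos_pow n j)) exchange_big /=.
rewrite rmorphM !rmorph_nat natr_sum mulr_sumr [RHS]big_mkcond /=.
apply: eq_bigr => l _; rewrite -mulr_sumr sum_root1.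
by case: ifP; rewrite ?mulr0// mulrC.
Qed.

Lemma sum_multiples (F : nat -> nat) N :
  (\sum_(0 <= d < N * m | m %| d.+1) F d.+1 = \sum_(0 <= k < N) F (k.+1 * m))%N.
Proof.
elim: N => [|N IH]; first by rewrite mul0n !big_geq.
rewrite big_nat_recr//= -IH (big_cat_nat (n := N * m)) //=; last by rewrite leq_mul.
congr (_ + _)%N; rewrite mulSn addnC.
rewrite -{1}[(N * m)%N]add0n big_addn addnC addnK.
case: (m) m0 => // m' _; rewrite big_mkcond big_nat_recr//= big1_seq ?add0n; last first.
  move=> i; rewrite mem_index_iota /= => im.
  by rewrite -addSn dvdn_addl ?dvdn_mull// gtnNdvd.
by rewrite -addSn dvdn_add// dvdn_mull.
Qed.

(** The surviving indices are [n] plus a multiple of [m], symmetric about [n]. *)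
Lemma sum_bin n :
  (\sum_(0 <= l < (2 * n).+1 | m %| l + m.-1 * n) 'C(2 * n, l) =
   'C(2 * n, n) + 2 * \sum_(0 <= k < n) 'C(2 * n, n + k.+1 * m))%N.
Proof.
have E d : (m %| d + n + m.-1 * n)%N = (m %| d)%N.
  by rewrite -addnA -mulSn prednK// dvdn_addl// dvdn_mulr.
have H2 : (\sum_(0 <= k < n) 'C(2 * n, n + k.+1 * m) =
    \sum_(0 <= d < n | m %| d.+1) 'C(2 * n, n + d.+1))%N.
  rewrite -(sum_multiples (fun d => 'C(2 * n, n + d))) (big_cat_nat (n := n)) //=; last by rewrite leq_pmulr.
  rewrite [X in (_ + X)%N]big1_seq ?addn0// => d; rewrite mem_index_iota => /andP[_ /andP[nd _]].
  by rewrite bin_small// mul2n -addnn ltn_add2l.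
rewrite H2 (big_cat_nat (n := n.+1)) //=; last by rewrite ltnS mul2n -addnn leq_addr.
rewrite big_mkcond big_nat_recr//= -big_mkcond -mulSn prednK// dvdn_mulr//.
rewrite addnAC addnC; congr (_ + _)%N.
rewrite [RHS]mul2n -addnn addnC; congr (_ + _)%N.
  rewrite -{1}[n.+1]add0n big_addn.
  have -> : ((2 * n).+1 - n.+1 = n)%N by rewrite subSS mul2n -addnn addnK.
  by apply: eq_big => [d|d _]; [rewrite addnS -addSn E | rewrite addnS -addSn addnC].
rewrite big_nat_rev /= big_nat_cond [RHS]big_nat_cond.
apply: eq_big => [d|d /andP[dn _]].
  apply: andb_id2l => /= dn.
  rewrite add0n; have dn' : (d.+1 <= n)%N by [].
  have D : (m %| (n - d.+1) + m.-1 * n + d.+1)%N.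
    by rewrite addnAC subnK// -mulSn prednK// dvdn_mulr.
  by apply/idP/idP => H; [rewrite (dvdn_addr _ H) in D | rewrite (dvdn_addl _ H) in D].
rewrite add0n -bin_sub; last by rewrite mul2n -addnn (leq_trans (leq_subr _ _))// leq_addr.
by congr ('C(_, _)); rewrite mul2n -addnn -addnBA ?leq_subr// subKn.
Qed.

End RootsOfUnity.

Section CentralBinomial.
Context {R : realType}.
Implicit Types n d D : nat.

Definition cbin n : R := 'C(2 * n, n)%:R / 4 ^+ n.
Definition rbin n d : R := 'C(2 * n, n + d)%:R / 'C(2 * n, n)%:R.

Lemma bin_mid_gt0 n : (0 < 'C(2 * n, n))%N.
Proof. by rewrite bin_gt0 mul2n -addnn leq_addr. Qed.

Lemma bin_midR_gt0 n : 0 < 'C(2 * n, n)%:R :> R.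
Proof. by rewrite ltr0n bin_mid_gt0. Qed.

Lemma bin_midS n : (n.+1 * 'C(2 * n.+1, n.+1) = 2 * (2 * n).+1 * 'C(2 * n, n))%N.
Proof.
have E1 : (2 * n.+1 * 'C((2 * n).+1, n) = n.+1 * 'C(2 * n.+1, n.+1))%N.
  by rewrite -mul_bin_diag mulnS.
have E2 : ((2 * n).+1 * 'C(2 * n, n) = n.+1 * 'C((2 * n).+1, n))%N.
  have -> : (n.+1 = (2 * n).+1 - n)%N by rewrite mul2n -addnn -addSn addnK.
  by rewrite -mul_bin_down.
by rewrite -E1 -!mulnA E2.
Qed.

Lemma cbinS n : cbin n.+1 = cbin n * (2 * n%:R + 1) / (2 * n%:R + 2).
Proof.
have /(congr1 (fun k : nat => (k%:R : R))) := bin_midS n.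
rewrite /cbin !natrM -[n.+1%:R]natr1 -[(2 * n).+1%:R]natr1 natrM => E.
have n0 : (0 <= n%:R :> R) by [].
have p4 : (4 : R) ^+ n != 0 by rewrite expf_neq0.
have n1 : (n%:R + 1 : R) != 0 by rewrite natr1.
have -> : ('C(2 * n.+1, n.+1)%:R : R) = 2 * (2 * n%:R + 1) * 'C(2 * n, n)%:R / (n%:R + 1).
  by apply: (mulfI n1); rewrite E; field.
rewrite exprS; field; rewrite p4 /=.
by rewrite (_ : 2 * n%:R + 2 = 2 * (n%:R + 1)) ?mulf_neq0//; ring.
Qed.

(** Wallis: [n * cbin n ^ 2] increases, and stays below the decreasing sequence
    [(n + 1 / 2) * cbin n ^ 2]. The value of the limit will be forced by the
    theta identity itself. *)
Lemma cvg_cbin : exists V : R, n%:R * cbin n ^+ 2 @[n --> \oo] --> V.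
Proof.
have ub n : (n%:R + 1 / 2) * cbin n ^+ 2 <= 1 / 2.
  elim: n => [|n IH]; first by rewrite /cbin muln0 bin0 expr0 divr1 expr1n mulr1 add0r.
  apply: le_trans IH; rewrite cbinS -natr1.
  have n0 : (0 <= n%:R :> R) by [].
  have c0 : 0 <= cbin n ^+ 2 by exact: sqr_ge0.
  rewrite -[cbin n * _ / _]mulrA; move: (cbin n) c0 => c c0.
  rewrite exprMn mulrCA [leRHS]mulrC ler_wpM2l//.
  rewrite expr_div_n mulrA ler_pdivrMr; last by rewrite exprn_gt0//; lra.
  nra.
exists (limn (fun n => n%:R * cbin n ^+ 2)).
apply: nondecreasing_is_cvgn.
  apply/nondecreasing_seqP => n.
  rewrite cbinS -natr1.
  have n0 : (0 <= n%:R :> R) by [].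
  have c0 : 0 <= cbin n ^+ 2 by exact: sqr_ge0.
  rewrite -[cbin n * _ / _]mulrA; move: (cbin n) c0 => c c0.
  have H : n%:R <= (n%:R + 1) * ((2 * n%:R + 1) / (2 * n%:R + 2)) ^+ 2 :> R.
    rewrite expr_div_n mulrA ler_pdivlMr; last by rewrite exprn_gt0//; lra.
    nra.
  by rewrite exprMn [leRHS]mulrCA mulrC; apply: ler_wpM2l c0 _ _ H.
exists (1 / 2) => _ [n _ <-]; apply: le_trans (ub n).
by rewrite ler_wpM2r ?sqr_ge0// lerDl.
Qed.

Lemma rbin0 n : rbin n 0 = 1.
Proof. by rewrite /rbin addn0 divff// gt_eqF// bin_midR_gt0. Qed.

Lemma rbin_ge0 n d : 0 <= rbin n d.
Proof. by rewrite /rbin divr_ge0. Qed.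

Lemma rbin_small n d : (n < d)%N -> rbin n d = 0.
Proof. by move=> nd; rewrite /rbin bin_small ?mul0r// mul2n -addnn ltn_add2l. Qed.

Lemma rbinS n d : (d <= n)%N ->
  rbin n d.+1 = rbin n d * (1 - (2 * d%:R + 1) / (n%:R + d%:R + 1)).
Proof.
move=> dn; have /(congr1 (fun k : nat => (k%:R : R))) := mul_bin_left (2 * n) (n + d).
have -> : (2 * n - (n + d) = n - d)%N by rewrite mul2n -addnn subnDl.
rewrite !natrM natrB// -natr1 natrD => E.
have p1 : (n%:R + d%:R + 1 : R) != 0 by rewrite -natrD natr1.
have p2 : ('C(2 * n, n)%:R : R) != 0 by rewrite gt_eqF// bin_midR_gt0.
rewrite /rbin addnS.
have -> : ('C(2 * n, (n + d).+1)%:R : R) = (n%:R - d%:R) * 'C(2 * n, n + d)%:R / (n%:R + d%:R + 1).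
  by apply: (mulfI p1); rewrite E; field.
by field; rewrite p1 p2.
Qed.

(** Each ratio is at most an exponential, and the odd numbers [2 d + 1] in the
    exponents add up to a square. *)
Lemma rbin_ub n d D : (0 < n)%N -> (d <= D)%N -> (d <= n)%N ->
  rbin n d <= expR (- (d%:R ^+ 2 / (n%:R + D%:R))).
Proof.
move=> n0; elim: d => [|d IH] dD dn; first by rewrite rbin0 expr0n mul0r oppr0 expR0.
rewrite rbinS ?(ltnW dn)//.
have n1 : (0 < n%:R :> R) by rewrite ltr0n.
have dD1 : (d%:R + 1 <= D%:R :> R) by rewrite natr1 ler_nat.
have d0 : (0 <= d%:R :> R) by [].
apply: (@le_trans _ _ (expR (- (d%:R ^+ 2 / (n%:R + D%:R))) * expR (- ((2 * d%:R + 1) / (n%:R + D%:R))))).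
  apply: ler_pM; [exact: rbin_ge0 | | exact: IH (ltnW dD) (ltnW dn) |].
    rewrite subr_ge0 ler_pdivrMr; last by lra.
    have dn1 : (d%:R + 1 <= n%:R :> R) by rewrite natr1 ler_nat.
    by lra.
  apply: le_trans (onem_ub _) _; rewrite ler_expR lerN2.
  by rewrite ler_pM2l ?lef_pV2 ?posrE; lra.
rewrite -expRD ler_expR -natr1 le_eqVlt; apply/orP; left; apply/eqP; field.
by rewrite gt_eqF//; lra.
Qed.

(** As for the upper bound, from the lower bound of [1 - y] by an exponential. *)
Lemma rbin_lb n d D : (D < n)%N -> (d <= D)%N ->
  expR (- (d%:R ^+ 2 / (n%:R - D%:R))) <= rbin n d.
Proof.
move=> Dn; elim: d => [|d IH] dD; first by rewrite rbin0 expr0n mul0r oppr0 expR0.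
rewrite rbinS; last by rewrite ltnW// (ltn_trans dD).
have dD1 : (d%:R + 1 <= D%:R :> R) by rewrite natr1 ler_nat.
have Dn1 : (D%:R + 1 <= n%:R :> R) by rewrite natr1 ler_nat.
have d0 : (0 <= d%:R :> R) by [].
apply: (@le_trans _ _ (expR (- (d%:R ^+ 2 / (n%:R - D%:R))) * expR (- ((2 * d%:R + 1) / (n%:R - D%:R))))).
  rewrite -expRD ler_expR -natr1 le_eqVlt; apply/orP; left; apply/eqP; field.
  by rewrite gt_eqF//; lra.
apply: ler_pM; rewrite ?expR_ge0//; first exact: IH (ltnW dD).
apply: le_trans (onem_lb _ _).
- rewrite ler_expR lerN2.
  have -> : (2 * d%:R + 1) / (n%:R + d%:R + 1) / (1 - (2 * d%:R + 1) / (n%:R + d%:R + 1)) =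
      (2 * d%:R + 1) / (n%:R - d%:R) :> R.
    by field; rewrite !gt_eqF//; lra.
  by rewrite ler_pM2l ?lef_pV2 ?posrE; lra.
- by rewrite divr_ge0//; lra.
- by rewrite ltr_pdivrMr; lra.
Qed.

End CentralBinomial.

Section ThetaIdentity.
Context {R : realType}.
Implicit Types n m M : nat.

(** The finite form of the theta identity: both sides evaluate, up to a power of
    2, the sum of the powers of [2 cos] over the angles [pi j / m]. *)
Lemma cos_sum M n : let m := (2 * M).+1 in
  m%:R * cbin n * (1 + 2 * \sum_(0 <= k < n) rbin n (k.+1 * m)) =
  1 + 2 * \sum_(0 <= j < M) cos (pi * j.+1%:R / m%:R) ^+ (2 * n) :> R.
Proof.
move=> m; have m0 : (0 < m)%N by [].
have mR : (m%:R : R) != 0 by rewrite pnatr_eq0.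
have p4 : (4 : R) ^+ n != 0 by rewrite expf_neq0.
have := @sum_cos_pow R m m0 n; rewrite sum_bin// natrD natrM natr_sum => E.
pose g j : R := cos (pi * j%:R / m%:R) ^+ (2 * n).
have E1 : \sum_(0 <= j < m) g j = m%:R * cbin n * (1 + 2 * \sum_(0 <= k < n) rbin n (k.+1 * m)).
  have -> : \sum_(0 <= j < m) g j = (4 ^+ n)^-1 * \sum_(0 <= j < m) (2 * cos (pi * j%:R / m%:R)) ^+ (2 * n).
    rewrite mulr_sumr; apply: eq_bigr => j _; rewrite /g exprMn exprM.
    by rewrite [2 ^+ (2 * n)]exprM (_ : (2 : R) ^+ 2 = 4) ?mulKf//; ring.
  rewrite E /rbin -mulr_suml /cbin; field; rewrite p4 /=.
  by rewrite gt_eqF// bin_midR_gt0.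
rewrite -E1 /m big_nat_recl// {1}/g mulr0 mul0r cos0 expr1n; congr (_ + _).
(* As [m] is odd, the indices [j] and [m - j], of opposite cosines, pair up. *)
rewrite (big_cat_nat (n := M)) //=; last by rewrite mul2n -addnn leq_addr.
rewrite mulr2n mulrDl mul1r; congr (_ + _).
rewrite -{1}[M]add0n big_addn mul2n -addnn addnK big_nat_rev /=.
rewrite !big_nat; apply: eq_bigr => j /andP[_ jM].
rewrite /g /m add0n addnn -mul2n.
have -> : pi * (M - j.+1 + M).+1%:R / (2 * M).+1%:R = pi - pi * j.+1%:R / (2 * M).+1%:R :> R.
  have -> : ((M - j.+1 + M).+1 = (2 * M).+1 - j.+1)%N.
    by rewrite addnBAC// subnSK ?ltn_addr// subSS mul2n -addnn.
  have jM2 : (j.+1 <= (2 * M).+1)%N by rewrite ltnS mul2n -addnn (leq_trans (ltnW jM))// leq_addr.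
  by rewrite natrB// mulrBr mulrBl mulfK.
by rewrite cosB cospi sinpi mul0r addr0 mulN1r exprM sqrrN -exprM.
Qed.

(** The theta series without its central term and its symmetric half. *)
Definition gsum (y : R) : R := limn (series (fun k => expR (- (k.+1%:R ^+ 2 * y)))).

Lemma cvg_series_expR (c : R) : 0 < c -> cvgn (series (fun k => expR (- (c * k.+1%:R)))).
Proof.
move=> c0.
have -> : (fun k => expR (- (c * k.+1%:R))) = geometric (expR (- c)) (expR (- c)) :> (nat -> R).
  apply/funext => k; rewrite /= -exprS -expRM_natl; congr expR; ring.
apply: is_cvg_geometric_series; rewrite ger0_norm ?expR_ge0//.
by rewrite -expR0 ltr_expR oppr_lt0.
Qed.

(** Halving the angle twice reaches the range where [sin x >= x - x ^ 2] is
    enough. *)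
Lemma sin_lb (x : R) : 0 <= x -> x <= pi / 2 -> x / 8 <= sin x.
Proof.
move=> x0 xp; have p2 : x <= 2 by apply: le_trans xp (ltW (pihalf_lt2 R)).
have S y : 0 <= y -> y <= 1 -> 0 <= sin y -> sin y <= sin (y + y).
  move=> y0 y1 s0; rewrite sinD.
  have := cos_lb y; have : y ^+ 2 <= 1 by rewrite expr_le1.
  move: (cos y) (sin y) s0 => c s s0; nra.
have s4 : x / 8 <= sin (x / 4).
  have := sinB_le (x / 4); rewrite ler_norml => /andP[h _]; nra.
have h1 : sin (x / 4) <= sin (x / 4 + x / 4) by apply: S; lra.
have h2 : sin (x / 2) <= sin (x / 2 + x / 2).
  by apply: S; try lra; rewrite (_ : x / 2 = x / 4 + x / 4); lra.
have e1 : x / 4 + x / 4 = x / 2 by field.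
have e2 : x / 2 + x / 2 = x by field.
by rewrite e1 in h1; rewrite e2 in h2; lra.
Qed.

Variable a : R.
Hypothesis a0 : 0 < a.

Let mm M : nat := (2 * M).+1.
Let nn M : nat := Num.truncn (a * (mm M)%:R ^+ 2).
Let e M : R := (mm M)%:R^-1.
Let x M : R := (nn M)%:R * e M ^+ 2.

Let mm_gt0 M : 0 < (mm M)%:R :> R. Proof. by rewrite ltr0n. Qed.
Let e_gt0 M : 0 < e M. Proof. by rewrite invr_gt0. Qed.
Let mmE M : (mm M)%:R = (e M)^-1 :> R. Proof. by rewrite invrK. Qed.
Let e_le1 M : e M <= 1. Proof. by rewrite invf_le1// ler1n. Qed.
Let nnE M : (nn M)%:R = x M / e M ^+ 2.
Proof. by rewrite /x mulfK// expf_neq0// gt_eqF. Qed.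

Let cvg_e : e M @[M --> \oo] --> 0.
Proof.
apply: (@squeeze_cvgr _ _ _ _ (fun=> 0) harmonic).
- near=> M; rewrite ltW//= /e lef_pV2 ?posrE ?ltr0n// ler_nat /mm ltnS mul2n -addnn leq_addr//.
- exact: cvg_cst.
- exact: cvg_harmonic.
Unshelve. all: by end_near. Qed.

Let cvg_x : x M @[M --> \oo] --> a.
Proof.
apply: (@squeeze_cvgr _ _ _ _ (fun M => a - e M ^+ 2) (fun=> a)).
- near=> M; have /(@Num.Theory.truncn_itv R) : 0 <= a * (mm M)%:R ^+ 2.
    by rewrite mulr_ge0 ?ltW// exprn_gt0.
  rewrite -/(nn M) -natr1 => /andP[h1 h2].
  have e2 : 0 < e M ^+ 2 by rewrite exprn_gt0.
  have em : (mm M)%:R ^+ 2 * e M ^+ 2 = 1 by rewrite -exprMn mulfV ?expr1n// gt_eqF.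
  apply/andP; split.
    rewrite lerBlDr; have := ler_wpM2r (ltW e2) (ltW h2).
    by rewrite -mulrA em mulr1 mulrDl mul1r.
  by have := ler_wpM2r (ltW e2) h1; rewrite -mulrA em mulr1.
- rewrite -[X in _ --> X]subr0; apply: cvgB; first exact: cvg_cst.
  rewrite -[X in _ --> X](mul0r 0); under eq_fun do rewrite expr2.
  by apply: cvgM; exact: cvg_e.
- exact: cvg_cst.
Unshelve. all: by end_near. Qed.

Let x_half : \forall M \near \oo, a / 2 < x M.
Proof.
have a2 : 0 < a / 2 by rewrite divr_gt0.
move/(@cvgRP _ _ \oo): cvg_x => /(_ _ a2); apply: filterS => M.
by rewrite ltr_norml => /andP[h _]; lra.
Qed.

Let x_le M : x M <= a.
Proof.
have /(@Num.Theory.truncn_itv R)/andP[h1 _] : 0 <= a * (mm M)%:R ^+ 2.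
  by rewrite mulr_ge0 ?ltW// exprn_gt0.
have e2 : 0 < e M ^+ 2 by rewrite exprn_gt0.
have em : (mm M)%:R ^+ 2 * e M ^+ 2 = 1 by rewrite -exprMn mulfV ?expr1n// gt_eqF.
by have := ler_wpM2r (ltW e2) h1; rewrite -mulrA em mulr1.
Qed.

Let nn_oo K : \forall M \near \oo, (K <= nn M)%N.
Proof.
have K0 : 0 < a / 2 / (K%:R + 1) by rewrite !divr_gt0// ltr_wpDl.
move/(@cvgRP _ _ \oo): cvg_e => /(_ _ K0) H.
near=> M.
have xh : a / 2 < x M by near: M.
have : `|e M - 0| < a / 2 / (K%:R + 1) by near: M.
rewrite subr0 gtr0_norm// ltr_pdivlMr ?ltr_wpDl// => h.
rewrite -(ler_nat R) nnE ler_pdivlMr ?exprn_gt0//.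
have e2 : e M ^+ 2 <= e M by rewrite expr2 ler_piMl ?e_le1 ?(ltW (e_gt0 M)).
have KK : (0 <= K%:R :> R) by [].
have h2 : K%:R * e M ^+ 2 <= K%:R * e M by rewrite ler_wpM2l.
by have := e_gt0 M; lra.
Unshelve. all: by end_near. Qed.

Let cvg_rsum : 1 + 2 * \sum_(0 <= k < nn M) rbin (nn M) (k.+1 * mm M) @[M --> \oo] -->
  1 + 2 * gsum a^-1.
Proof.
apply: cvgD; first exact: cvg_cst.
apply: cvgMr.
have a2 : 0 < (2 * a)^-1 by rewrite invr_gt0 mulr_gt0.
apply: (@tannery R (fun M k => rbin (nn M) (k.+1 * mm M)) _
  (fun k => expR (- ((2 * a)^-1 * k.+1%:R))) nn) => //.
- move=> k.
  have ck : k.+1%:R * e M @[M --> \oo] --> 0.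
    by rewrite -[X in _ --> X](mulr0 k.+1%:R); apply: cvgMr; exact: cvg_e.
  have cE (s : R) : expR (- (k.+1%:R ^+ 2 * (x M + s * (k.+1%:R * e M))^-1)) @[M --> \oo] -->
      expR (- (k.+1%:R ^+ 2 * a^-1)).
    apply: continuous_cvg; first exact: continuous_expR.
    apply: cvgN; apply: cvgMr; apply: cvgV; first by rewrite gt_eqF.
    rewrite -[X in _ --> X]addr0; apply: cvgD; first exact: cvg_x.
    by rewrite -[X in _ --> X](mulr0 s); apply: cvgMr.
  (* The signs [-1] and [1] are those of the lower and upper bounds of [rbin]. *)
  apply: (squeeze_cvgr _ (cE (-1)) (cE 1)).
  have a2' : 0 < a / 2 by rewrite divr_gt0.
  move/(@cvgRP _ _ \oo): ck => /(_ _ a2') H.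
  near=> M.
  have xh : a / 2 < x M by near: M.
  have ke : k.+1%:R * e M < a / 2.
    have : `|k.+1%:R * e M - 0| < a / 2 by near: M.
    by rewrite subr0 ltr_norml => /andP[].
  have ke0 : 0 < k.+1%:R * e M by rewrite mulr_gt0.
  have em : e M != 0 by rewrite gt_eqF.
  have dn : (k.+1 * mm M < nn M)%N.
    rewrite -(ltr_nat R) natrM mmE nnE -subr_gt0.
    have -> : x M / e M ^+ 2 - k.+1%:R / e M = (x M - k.+1%:R * e M) / e M ^+ 2 by field.
    by rewrite divr_gt0 ?exprn_gt0//; lra.
  have E (s : R) : x M + s * (k.+1%:R * e M) != 0 ->
      k.+1%:R ^+ 2 * (x M + s * (k.+1%:R * e M))^-1 =
      (k.+1 * mm M)%:R ^+ 2 / ((nn M)%:R + s * (k.+1 * mm M)%:R).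
    move=> h; rewrite natrM mmE nnE.
    have -> : x M / e M ^+ 2 + s * (k.+1%:R / e M) = (x M + s * (k.+1%:R * e M)) / e M ^+ 2 by field.
    by move: (e M) em (x M + _) h => z z0 y y0; field; rewrite y0 z0.
  rewrite !E; try (by rewrite gt_eqF//; lra).
  rewrite mulN1r mul1r; apply/andP; split; first exact: rbin_lb.
  by apply: rbin_ub => //; [exact: leq_ltn_trans dn | exact: ltnW].
- near=> M => k _; rewrite ger0_norm ?rbin_ge0//.
  have [dn|dn] := leqP (k.+1 * mm M) (nn M); last by rewrite rbin_small// expR_ge0.
  have d0 : (0 < k.+1 * mm M)%N by [].
  have n0 : (0 < nn M)%N by exact: leq_trans dn.
  apply: le_trans (rbin_ub n0 dn dn) _; rewrite ler_expR lerN2.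
  have k1 : 1 <= k.+1%:R :> R by rewrite ler1n.
  have x0 : 0 < x M by rewrite /x mulr_gt0 ?ltr0n// exprn_gt0.
  have em : e M != 0 by rewrite gt_eqF.
  have -> : (k.+1 * mm M)%:R ^+ 2 / ((nn M)%:R + (nn M)%:R) = k.+1%:R ^+ 2 * (2 * x M)^-1 :> R.
    rewrite natrM mmE nnE; move: (e M) em (x M) (lt0r_neq0 x0) => z z0 y y0.
    have -> : y / z ^+ 2 + y / z ^+ 2 = 2 * y / z ^+ 2 by ring.
    by field; rewrite y0 z0.
  rewrite mulrC; apply: ler_pM; [by [] | exact: (ltW a2) | |].
    by rewrite expr2 ler_peMl.
  by have xa := x_le M; rewrite lef_pV2 ?posrE; lra.
- exact: cvg_series_expR.
Unshelve. all: by end_near. Qed.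

Let cvg_csum : 1 + 2 * \sum_(0 <= j < M) cos (pi * j.+1%:R / (mm M)%:R) ^+ (2 * nn M) @[M --> \oo] -->
  1 + 2 * gsum (pi ^+ 2 * a).
Proof.
have p0 := pi_gt0 R.
apply: cvgD; first exact: cvg_cst.
apply: cvgMr.
have a2 : 0 < a / 128 by rewrite divr_gt0.
apply: (@tannery R (fun M j => cos (pi * j.+1%:R / (mm M)%:R) ^+ (2 * nn M)) _
  (fun k => expR (- (a / 128 * k.+1%:R))) id) => //.
- move=> j; set c := pi * j.+1%:R.
  rewrite (_ : (fun M => _) = (fun M => (1 - sin (c * e M) ^+ 2) ^+ nn M)); last first.
    by apply/funext => M; rewrite exprM cos2sin2.
  have cs0 : sin (c * e M) @[M --> \oo] --> 0.
    rewrite -(sin0 R); apply: continuous_cvg; first exact: continuous_sin.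
    by rewrite -[X in _ --> X](mulr0 c); apply: cvgMr; exact: cvg_e.
  have cs1 : sin (c * e M) / e M @[M --> \oo] --> c.
    apply: (@squeeze_cvgr _ _ _ _ (fun M => c - c ^+ 2 * e M) (fun M => c + c ^+ 2 * e M)).
    + near=> M; have := sinB_le (c * e M); rewrite ler_norml => /andP[h1 h2].
      have E1 : (c - c ^+ 2 * e M) * e M = c * e M - (c * e M) ^+ 2 by ring.
      have E2 : (c + c ^+ 2 * e M) * e M = c * e M + (c * e M) ^+ 2 by ring.
      by apply/andP; split; [rewrite ler_pdivlMr// E1; lra | rewrite ler_pdivrMr// E2; lra].
    + rewrite -[X in _ --> X]subr0; apply: cvgB; first exact: cvg_cst.
      by rewrite -[X in _ --> X](mulr0 (c ^+ 2)); apply: cvgMr; exact: cvg_e.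
    + rewrite -[X in _ --> X]addr0; apply: cvgD; first exact: cvg_cst.
      by rewrite -[X in _ --> X](mulr0 (c ^+ 2)); apply: cvgMr; exact: cvg_e.
  rewrite (_ : j.+1%:R ^+ 2 * (pi ^+ 2 * a) = a * (c * c)); last by rewrite /c; ring.
  apply: (@cvg_powR_expR R nn).
  + by move=> M; exact: sqr_ge0.
  + rewrite -[X in _ --> X](mul0r 0); under eq_fun do rewrite expr2.
    by apply: cvgM; exact: cs0.
  + rewrite (_ : (fun M => _) = (fun M => x M * (sin (c * e M) / e M * (sin (c * e M) / e M)))); last first.
      by apply/funext => M; rewrite nnE; field; rewrite gt_eqF.
    by apply: cvgM; [exact: cvg_x | apply: cvgM].
- near=> M => j jM.
  have xh : a / 2 < x M by near: M.
  have e0 := e_gt0 M.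
  pose th := pi * j.+1%:R * e M.
  have th0 : 0 <= th by rewrite /th !mulr_ge0// ltW.
  have thp : th <= pi / 2.
    rewrite /th -mulrA ler_pM2l// ler_pdivrMr// mulrC ler_pdivlMr//.
    rewrite -natrM ler_nat /mm mulnC (leq_trans _ (leqnSn _))// leq_mul2l /=; exact: jM.
  have sl := sin_lb th0 thp.
  have j1 : 1 <= j.+1%:R :> R by rewrite ler1n.
  have -> : cos (pi * j.+1%:R / (mm M)%:R) ^+ (2 * nn M) = (1 - sin th ^+ 2) ^+ nn M.
    by rewrite exprM cos2sin2.
  have s1 : 0 <= 1 - sin th ^+ 2 by rewrite -cos2sin2 sqr_ge0.
  rewrite ger0_norm ?exprn_ge0//.
  apply: (@le_trans _ _ (expR (- sin th ^+ 2) ^+ nn M)).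
    by apply: lerXn2r; rewrite ?nnegrE ?expR_ge0 ?onem_ub.
  rewrite -expRM_natl ler_expR mulrN lerN2.
  apply: (@le_trans _ _ ((nn M)%:R * (th / 8) ^+ 2)); last first.
    have t8 : 0 <= th / 8 by rewrite divr_ge0.
    by rewrite ler_wpM2l// lerXn2r ?nnegrE ?t8 ?(le_trans t8 sl) ?sl.
  rewrite nnE /th.
  have -> : x M / e M ^+ 2 * (pi * j.+1%:R * e M / 8) ^+ 2 = x M / 64 * (pi ^+ 2 * j.+1%:R ^+ 2).
    by move: (e M) (lt0r_neq0 e0) (x M) => z z0 y; field.
  apply: ler_pM; rewrite ?(ltW a2)//; first lra.
  have pp : 1 <= pi ^+ 2 :> R by have := pi_ge2 R => pi2; nra.
  nra.
- by move=> K; exact: nbhs_infty_ge.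
- exact: cvg_series_expR.
Unshelve. all: by end_near. Qed.

(** With [m] odd and [n] close to [a * m ^ 2], the binomial side converges to a
    theta series at [1 / a] and the cosine side to one at [pi ^ 2 * a], by
    Tannery's theorem. Squaring replaces the central binomial coefficient by the
    monotone Wallis sequence. *)
Lemma gsum_identity (V : R) : n%:R * cbin n ^+ 2 @[n --> \oo] --> V ->
  (1 + 2 * gsum (pi ^+ 2 * a)) ^+ 2 = V / a * (1 + 2 * gsum a^-1) ^+ 2 :> R.
Proof.
move=> cV.
have nnoo : nn M @[M --> \oo] --> \oo by apply/cvgnyPge => K; exact: nn_oo.
have cv : (nn M)%:R * cbin (nn M) ^+ 2 @[M --> \oo] --> V by exact: (cvg_comp _ _ nnoo cV).
have l1 : (1 + 2 * \sum_(0 <= j < M) cos (pi * j.+1%:R / (mm M)%:R) ^+ (2 * nn M)) ^+ 2 @[M --> \oo] -->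
    (1 + 2 * gsum (pi ^+ 2 * a)) ^+ 2.
  under eq_fun do rewrite expr2.
  by rewrite expr2; apply: cvgM; exact: cvg_csum.
have l2 : (1 + 2 * \sum_(0 <= j < M) cos (pi * j.+1%:R / (mm M)%:R) ^+ (2 * nn M)) ^+ 2 @[M --> \oo] -->
    V / a * (1 + 2 * gsum a^-1) ^+ 2.
  have l3 : ((nn M)%:R * cbin (nn M) ^+ 2) * (x M)^-1 *
     (1 + 2 * \sum_(0 <= k < nn M) rbin (nn M) (k.+1 * mm M)) ^+ 2 @[M --> \oo] -->
     V / a * (1 + 2 * gsum a^-1) ^+ 2.
    apply: cvgM; last first.
      under eq_fun do rewrite expr2.
      by rewrite expr2; apply: cvgM; exact: cvg_rsum.
    apply: cvgM; first exact: cv.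
    by apply: cvgV; [rewrite gt_eqF | exact: cvg_x].
  apply: cvg_trans l3; apply: near_eq_cvg; near=> M.
  have xh : a / 2 < x M by near: M.
  rewrite -cos_sum -/(mm M); move: (1 + _) (cbin (nn M)) => A c.
  have x0 : x M != 0 by rewrite gt_eqF// (lt_trans _ xh)// divr_gt0.
  rewrite nnE mmE; move: (e M) (lt0r_neq0 (e_gt0 M)) (x M) x0 => z z0 y y0.
  by field; rewrite y0 z0.
by rewrite (cvg_unique _ l1 l2).
Unshelve. all: by end_near. Qed.

End ThetaIdentity.

Section Theta.
Context {R : realType}.

(** The theta function at [expR u] is [1 + 2 * wsum u]. *)
Definition wsum (u : R) : R := gsum (pi * expR u).

Lemma cvgn_wsum (u : R) : cvgn (series (fun k => expR (- (k.+1%:R ^+ 2 * (pi * expR u))))).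
Proof.
apply: (@series_le_cvg _ _ (fun k => expR (- (pi * expR u * k.+1%:R)))).
- by move=> k; exact: expR_ge0.
- by move=> k; exact: expR_ge0.
- move=> k; have k1 : 1 <= k.+1%:R :> R by rewrite ler1n.
  have c0 : 0 <= pi * expR u :> R by rewrite mulr_ge0 ?pi_ge0 ?expR_ge0.
  rewrite ler_expR lerN2 mulrC ler_wpM2r// expr2 ler_peMl//; exact: le_trans ler01 _.
- by apply: cvg_series_expR; rewrite mulr_gt0 ?pi_gt0 ?expR_gt0.
Qed.

Lemma wsum_ge0 u : 0 <= wsum u.
Proof.
apply: limr_ge; first exact: cvgn_wsum.
by apply: nearW => n; apply: sumr_ge0 => k _; exact: expR_ge0.
Qed.

(** The theta identity [gsum_identity] at [a = exp u / pi]. At [u = 0] both sides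
    have the same theta value, whence [V * pi = 1]. *)
Lemma wsumN u : 1 + 2 * wsum (- u) = expR (u / 2) * (1 + 2 * wsum u).
Proof.
have p0 := pi_gt0 R.
have [V cV] := @cvg_cbin R.
have H v : (1 + 2 * wsum v) ^+ 2 = V * pi * expR (- v) * (1 + 2 * wsum (- v)) ^+ 2.
  have a0 : 0 < expR v / pi by rewrite divr_gt0 ?expR_gt0.
  have := gsum_identity a0 cV; rewrite /wsum expRN.
  have e0 : expR v != 0 by rewrite gt_eqF// expR_gt0.
  have p1 : (pi : R) != 0 by rewrite gt_eqF.
  have -> : pi ^+ 2 * (expR v / pi) = pi * expR v.
    by rewrite mulrCA expr2 mulfK// mulrC.
  by move=> ->; rewrite !invf_div [V * (_ / _)]mulrA.
have w0 v : 0 < 1 + 2 * wsum v by have := wsum_ge0 v; lra.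
(* At [u = 0] the identity compares a non zero number with itself. *)
have Vp : V * pi = 1.
  have := H 0; rewrite oppr0 expR0 mulr1 => E.
  have w2 : (1 + 2 * wsum 0) ^+ 2 != 0 by rewrite expf_neq0// gt_eqF.
  by apply: (mulIf w2); rewrite -E mul1r.
have := H (- u); rewrite Vp mul1r !opprK => E.
apply/eqP; rewrite -(eqrXn2 (n := 2))// ?ltW ?mulr_gt0 ?expR_gt0//.
rewrite E exprMn; apply/eqP; congr (_ * _).
by rewrite expr2 -expRD; congr expR; field.
Qed.

End Theta.

(** * The completed zeta function *)

Section ThetaTransform.
Context {R : realType}.
Implicit Types (s z : CC R).

Lemma ofR_half : ofR (1 / 2) = 2^-1 :> CC R.
Proof. by rewrite rmorphM rmorph1 fmorphV rmorph_nat mul1r. Qed.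

Lemma ofR_Nhalf : ofR (- (1 / 2)) = - 2^-1 :> CC R.
Proof. by rewrite -ofR_half; apply: ceqP; rewrite !cE ?oppr0. Qed.

(** The partial sums of [wsum]; each term is a translate of [gumbel]. *)
Definition wpart (N : nat) (u : R) : R :=
  series (fun k => expR (- (k.+1%:R ^+ 2 * (pi * expR u)))) N.

Definition h1 (u : R) : R := (u < 0 :> R)%R%:R.
Definition wpos (u : R) : R := h0 (- u) * wsum u.
Definition wneg (u : R) : R := h1 u * wsum u.

Lemma cvg_wpart u : wpart N u @[N --> \oo] --> wsum u.
Proof.
exact: (@cvgn_wsum R u).
Qed.

Lemma wpart_ge0 N u : 0 <= wpart N u.
Proof. by apply: sumr_ge0 => k _; exact: expR_ge0. Qed.

Lemma wpart_le N u : wpart N u <= wsum u.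
Proof.
apply: (nondecreasing_cvgn_le (u_ := fun N => wpart N u)).
  by apply: nondecreasing_series => k _ _; exact: expR_ge0.
by apply/cvg_ex; exists (wsum u); exact: cvg_wpart.
Qed.

Lemma measurable_wpart N : measurable_fun [set: R] (wpart N).
Proof.
apply: (eq_measurable_fun (fun u => \sum_(0 <= k < N) expR (- (k.+1%:R ^+ 2 * (pi * expR u))))) => //.
apply: measurable_sum => k.
apply: continuous_measurable_fun => u.
apply: continuous_comp; last exact: continuous_expR.
apply: cvgN; apply: cvgMr; apply: cvgMr; exact: continuous_expR.
Qed.

Lemma measurable_wsum : measurable_fun [set: R] (@wsum R).
Proof.
apply: (@measurable_fun_cvg _ _ _ _ wpart) => [N|u _]; first exact: measurable_wpart.
exact: cvg_wpart.
Qed.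

Lemma h1E u : h1 u = 1 - h0 (- u).
Proof. by rewrite /h1 /h0 oppr_le0 ltNge; case: (0 <= u); rewrite /= ?subrr ?subr0. Qed.

Lemma h1_ge0 u : 0 <= h1 u.
Proof. by rewrite /h1 ler0n. Qed.

Lemma measurable_h0N : measurable_fun [set: R] (fun u : R => h0 (- u)).
Proof. exact: (measurableT_comp measurable_h0 (@oppr_measurable R setT)). Qed.

Lemma measurable_h1 : measurable_fun [set: R] h1.
Proof.
rewrite (_ : h1 = (fun u => 1 - h0 (- u))); last by apply/funext => u; exact: h1E.
by apply: measurable_funB => //; exact: measurable_h0N.
Qed.

Lemma Lint_h1 (sg : R) : 0 < sg -> Lint h1 sg.
Proof.
move=> s0; apply: (Lint_le measurable_h1 h1_ge0 _ (Lint_h0 s0)) => u.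
by rewrite /h1 /h0 ler_nat; case: ltP => // /ltW ->.
Qed.

Lemma lap_h1 s : 0 < cRe s -> lap h1 s = s^-1.
Proof.
move=> s0; rewrite -lap_h0//; apply: (eq_lap_point (a := 0)) => [||u u0].
- exact: measurable_h1.
- exact: measurable_h0.
- by rewrite /h1 /h0 lt_neqAle u0.
Qed.

Lemma measurable_wpos : measurable_fun [set: R] wpos.
Proof. by apply: measurable_funM; [exact: measurable_h0N | exact: measurable_wsum]. Qed.

Lemma measurable_wneg : measurable_fun [set: R] wneg.
Proof. by apply: measurable_funM; [exact: measurable_h1 | exact: measurable_wsum]. Qed.

Lemma wpos_ge0 u : 0 <= wpos u.
Proof. by rewrite mulr_ge0 ?h0_ge0 ?wsum_ge0. Qed.

Lemma wneg_ge0 u : 0 <= wneg u.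
Proof. by rewrite mulr_ge0 ?h1_ge0 ?wsum_ge0. Qed.

Lemma wsum_split u : wsum u = wpos u + wneg u.
Proof. by rewrite /wpos /wneg h1E; ring. Qed.

(** Comparison with a geometric series of ratio at most [1 / 2]. *)
Lemma wsum_le (u : R) : 0 <= u -> wsum u <= 2 * gumbel u.
Proof.
move=> u0; have eu : 1 <= expR u by rewrite -expR0 ler_expR.
set q := gumbel u; have q0 : 0 <= q by exact: gumbel_ge0.
have q2 : q <= 1 / 2.
  rewrite /q /gumbel expRN div1r lef_pV2 ?posrE ?expR_gt0//.
  by apply: le_trans (expR_ge1Dx _); lra.
have p1 : 1 <= pi :> R by have := pi_ge2 R; lra.
have tq k : expR (- (k.+1%:R ^+ 2 * (pi * expR u))) <= q ^+ k.+1.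
  rewrite /q /gumbel -expRM_natl ler_expR mulrN lerN2.
  have k1 : 1 <= k.+1%:R :> R by rewrite ler1n.
  apply: ler_pM; rewrite ?ler0n ?expR_ge0//.
    by rewrite expr2 ler_peMl ?ler0n.
  by rewrite ler_peMl ?expR_ge0.
apply: limr_le; first exact: (cvgP _ (@cvg_wpart u)).
apply: nearW => N; rewrite /series /=.
suff : \sum_(0 <= k < N) expR (- (k.+1%:R ^+ 2 * (pi * expR u))) <= 2 * q - 2 * q ^+ N.+1.
  by have := exprn_ge0 N.+1 q0; lra.
elim: N => [|N IH]; first by rewrite big_geq// expr1 subrr.
rewrite big_nat_recr//= [q ^+ N.+2]exprS.
have h := tq N; have x0 := exprn_ge0 N.+1 q0.
have : 2 * (q * q ^+ N.+1) <= q ^+ N.+1 by rewrite mulrA ler_piMl//; lra.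
by lra.
Qed.

Lemma Lint_wpos (sg : R) : Lint wpos sg.
Proof.
have a0 : 0 < `|sg| + 1 by rewrite ltr_wpDl.
apply: (@Lint_of_decay _ _ (2 * expR (4 * (`|sg| + 1) ^+ 2)) (`|sg| + 1)) => // [||u].
- exact: measurable_wpos.
- exact: wpos_ge0.
- rewrite /wpos /h0 oppr_le0; case: (leP 0 u) => u0; last first.
    by rewrite !mul0r mulr_ge0 ?mulr_ge0 ?expR_ge0.
  rewrite mul1r; apply: (@le_trans _ _ (2 * (gumbel u * expR ((`|sg| + 1) * u)))).
    rewrite mulrA; apply: ler_pM; rewrite ?wsum_ge0 ?expR_ge0 ?wsum_le//.
    by rewrite ler_expR ler_wpM2r//; have := ler_norm sg; lra.
  by rewrite -mulrA ler_wpM2l// gumbel_le// ltW.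
Qed.

(** The theta identity moves the negative half line to the positive one, where
    the series decays. *)
Lemma wnegE u : wneg u = h1 u * wsum (- u) * expR (- (1 / 2) * u)
  + (1 / 2) * (h1 u * expR (- (1 / 2) * u)) - (1 / 2) * h1 u.
Proof.
rewrite /wneg; have := wsumN (- u); rewrite opprK.
have -> : - u / 2 = - (1 / 2) * u by field.
move: (wsum u) (wsum (- u)) (h1 u) (expR _) => w y h x E.
have -> : w = (x * (1 + 2 * y) - 1) / 2 by rewrite -E; field.
by field.
Qed.

Let wA u : R := h1 u * wsum (- u) * expR (- (1 / 2) * u).
Let wA0 u : R := wpos (- u) * expR (- (1 / 2) * u).
Let wB u : R := h1 u * expR (- (1 / 2) * u).

Let measurable_wsumN : measurable_fun [set: R] (fun u : R => wsum (- u)).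
Proof. exact: (measurableT_comp measurable_wsum (@oppr_measurable R setT)). Qed.

Let measurable_wA : measurable_fun [set: R] wA.
Proof.
apply: measurable_funM; last exact: measurable_expRM.
by apply: measurable_funM; [exact: measurable_h1 | exact: measurable_wsumN].
Qed.

Let measurable_wposN : measurable_fun [set: R] (fun u : R => wpos (- u)).
Proof. exact: (measurableT_comp measurable_wpos (@oppr_measurable R setT)). Qed.

Let measurable_wA0 : measurable_fun [set: R] wA0.
Proof. by apply: measurable_funM; [exact: measurable_wposN | exact: measurable_expRM]. Qed.

Let measurable_wB : measurable_fun [set: R] wB.
Proof. by apply: measurable_funM; [exact: measurable_h1 | exact: measurable_expRM]. Qed.

Let wA_ge0 u : 0 <= wA u.
Proof. by rewrite !mulr_ge0 ?h1_ge0 ?wsum_ge0 ?expR_ge0. Qed.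
Let wB_ge0 u : 0 <= wB u.
Proof. by rewrite !mulr_ge0 ?h1_ge0 ?expR_ge0. Qed.

Let wA_le u : wA u <= wA0 u.
Proof.
rewrite /wA /wA0 /wpos opprK ler_wpM2r ?expR_ge0// ler_wpM2r ?wsum_ge0//.
by rewrite /h1 /h0 ler_nat; case: ltP => // /ltW ->.
Qed.

Let Lint_wposN (sg : R) : Lint (fun u => wpos (- u)) sg.
Proof.
have [_] := lap_opp (s := ofR (- sg)) measurable_wpos wpos_ge0 (Lint_wpos _).
by rewrite cRe_ofR opprK.
Qed.

Let Lint_wA (sg : R) : Lint wA sg.
Proof.
apply: (Lint_le measurable_wA wA_ge0 wA_le).
by apply: Lint_exp; exact: Lint_wposN.
Qed.

Let Lint_wB (sg : R) : 1 / 2 < sg -> Lint wB sg.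
Proof. by move=> s2; apply: Lint_exp; apply: Lint_h1; lra. Qed.

Let lap_wA s : lap wA s = lap wpos (2^-1 - s).
Proof.
transitivity (lap wA0 s).
  apply: (eq_lap_point (a := 0)) => [||u u0]; [exact: measurable_wA | exact: measurable_wA0 |].
  by rewrite /wA /wA0 /wpos opprK /h1 /h0 lt_neqAle u0.
rewrite /wA0 lap_exp.
have [E _] := lap_opp (s := 2^-1 - s) measurable_wpos wpos_ge0 (Lint_wpos _).
rewrite ofR_Nhalf -[s - _]opprB; exact: E.
Qed.

Let lap_wB s : 1 / 2 < cRe s -> lap wB s = (s - 2^-1)^-1.
Proof.
move=> s2; rewrite /wB lap_exp.
have -> : s + ofR (- (1 / 2)) = s - 2^-1.
  by rewrite ofR_Nhalf.
have half : cRe (2^-1 : CC R) = 1 / 2.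
  by rewrite -ofR_half.
by rewrite lap_h1// cReB half; lra.
Qed.

Let Lint_wneg (sg : R) : 1 / 2 < sg -> Lint wneg sg.
Proof.
move=> s2; apply: (Lint_le measurable_wneg wneg_ge0 _ (LintD (Lint_wA sg) (LintZ (1 / 2) (Lint_wB s2)))) => u.
by rewrite wnegE -/(wA u) -/(wB u) gerBl mulr_ge0 ?h1_ge0.
Qed.

Lemma Lint_wsum (sg : R) : 1 / 2 < sg -> Lint (@wsum R) sg.
Proof.
move=> s2; apply: eq_Lint (LintD (Lint_wpos sg) (Lint_wneg s2)) => u.
by rewrite wsum_split.
Qed.

(** Riemann's formula. The transforms of the two exponentials left by the theta
    identity on the negative half line are the polar terms. *)
Lemma lap_wsum s : 1 / 2 < cRe s ->
  lap (@wsum R) s = lap wpos s + lap wpos (2^-1 - s) + (2 * s - 1)^-1 - (2 * s)^-1.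
Proof.
move=> s2; have s0 : 0 < cRe s by lra.
have h12 : 0 <= 1 / 2 :> R by [].
have m1 : measurable_fun [set: R] (fun u => (1 / 2) * wB u) by exact: measurable_funM.
have m2 : measurable_fun [set: R] (fun u => (1 / 2) * h1 u).
  by apply: measurable_funM => //; exact: measurable_h1.
have m3 : measurable_fun [set: R] (fun u => wA u + (1 / 2) * wB u) by exact: measurable_funD.
have L1 := Lint_norm wB_ge0 (Lint_wB s2).
have L2 : Lint (fun u => `|(1 / 2) * wB u|) (cRe s).
  by apply: Lint_norm; [move=> u; rewrite mulr_ge0 | exact: LintZ (Lint_wB s2)].
have L3 := Lint_norm wA_ge0 (Lint_wA (cRe s)).
have L4 := Lint_norm h1_ge0 (Lint_h1 s0).
have L5 : Lint (fun u => `|(1 / 2) * h1 u|) (cRe s).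
  by apply: Lint_norm; [move=> u; rewrite mulr_ge0 ?h1_ge0 | exact: LintZ (Lint_h1 s0)].
have L6 : Lint (fun u => `|wA u + (1 / 2) * wB u|) (cRe s).
  apply: Lint_norm; first by move=> u; rewrite addr_ge0// mulr_ge0.
  exact: LintD (Lint_wA (cRe s)) (LintZ (1 / 2) (Lint_wB s2)).
rewrite (eq_lap (g := fun u => wpos u + wneg u)); last exact: wsum_split.
rewrite (lapD measurable_wpos measurable_wneg (Lint_norm wpos_ge0 (Lint_wpos _)) (Lint_norm wneg_ge0 (Lint_wneg s2))).
rewrite (eq_lap (h := wneg) (g := fun u => (wA u + (1 / 2) * wB u) - (1 / 2) * h1 u)); last exact: wnegE.
rewrite (lapB m3 m2 L6 L5) (lapD measurable_wA m1 L3 L2) (lapZ _ measurable_wB L1) (lapZ _ measurable_h1 L4).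
rewrite lap_wA lap_wB// lap_h1//.
rewrite ofR_half.
have h2 : (2 : CC R) != 0 by rewrite pnatr_eq0.
have -> : (2 * s - 1)^-1 = 2^-1 * (s - 2^-1)^-1 by rewrite -invfM mulrBr mulfV.
by rewrite invfM; ring.
Qed.

End ThetaTransform.

Section Zeta.
Context {R : realType}.
Implicit Types (s z : CC R).

Lemma cRe_half s : cRe (s / 2) = cRe s / 2.
Proof. by rewrite -ofR_half !cE; ring. Qed.

Lemma two_neq0 : (2 : CC R) != 0.
Proof. by rewrite pnatr_eq0. Qed.

Lemma Lint_wpart N (sg : R) : 1 / 2 < sg -> Lint (wpart N) sg.
Proof.
by move=> s2; apply: (Lint_le (@measurable_wpart R N) (wpart_ge0 N) (wpart_le N) (Lint_wsum s2)).
Qed.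

(** Each term of the theta series is a translate of [gumbel], so its transform is
    a term of the Dirichlet series times a common factor. *)
Lemma lap_wpart N s : 1 < cRe s ->
  lap (wpart N) (s / 2) =
  cpow pi (- s / 2) * lap (@gumbel R) (s / 2) * \sum_(1 <= n < N.+1) cpow n%:R (- s).
Proof.
move=> s1; have s2 : 1 / 2 < cRe (s / 2) by rewrite cRe_half; lra.
have s0 : 0 < cRe (s / 2) by lra.
elim: N => [|N IH].
  rewrite big_geq// mulr0 (eq_lap (g := fun u => 0 * gumbel u)).
    rewrite lapZ ?rmorph0 ?mul0r//; first exact: measurable_gumbel.
    by apply: Lint_norm; [exact: gumbel_ge0 | exact: Lint_gumbel].
  by move=> u; rewrite /wpart /series /= big_geq// mul0r.
set a : R := - (ln pi + 2 * ln N.+1%:R).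
have [ls Ls] := lap_shift a (@measurable_gumbel R) (@gumbel_ge0 R) (Lint_gumbel s0).
rewrite (eq_lap (g := fun u => wpart N u + gumbel (u - a))); last first.
  move=> u; rewrite /wpart /series /= big_nat_recr//=; congr (_ + _).
  rewrite /gumbel /a opprK expRD expRD lnK ?posrE ?pi_gt0//.
  rewrite mulr_natl mulr2n expRD lnK ?posrE ?ltr0n//; congr expR; ring.
have mh : measurable_fun [set: R] (fun u => gumbel (u - a)).
  apply: (measurableT_comp (@measurable_gumbel R)).
  by apply: continuous_measurable_fun => u; apply: cvgB; [exact: cvg_id | exact: cvg_cst].
rewrite (lapD (@measurable_wpart R N) mh (Lint_norm (wpart_ge0 N) (Lint_wpart N s2))
  (Lint_norm (fun u => gumbel_ge0 _) Ls)).
rewrite IH ls [X in _ = _ * X]big_nat_recr//= mulrDr; congr (_ + _).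
have -> : cexp (s / 2 * ofR a) = cpow pi (- s / 2) * cpow N.+1%:R (- s).
  rewrite /cpow -cexpD; congr cexp; rewrite /a rmorphN rmorphD rmorphM rmorph_nat.
  by have h2 := two_neq0; field.
by ring.
Qed.

Lemma zeta_lap (f : CC R -> CC R) s : is_zeta f -> 1 < cRe s ->
  cpow pi (- s / 2) * lap (@gumbel R) (s / 2) * f s = lap (@wsum R) (s / 2).
Proof.
move=> [_ fz] s1; have s2 : 1 / 2 < cRe (s / 2) by rewrite cRe_half; lra.
have c1 : lap (wpart N) (s / 2) @[N --> \oo] --> lap (@wsum R) (s / 2).
  apply: (@cvg_lap_dominated _ _ _ (@wsum R)).
  - exact: measurable_wpart.
  - exact: measurable_wsum.
  - by move=> n u; rewrite ger0_norm ?wpart_ge0// wpart_le.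
  - by move=> u; rewrite ger0_norm ?wsum_ge0.
  - exact: cvg_wpart.
  - exact: Lint_wsum.
have c2 : lap (wpart N) (s / 2) @[N --> \oo] --> cpow pi (- s / 2) * lap (@gumbel R) (s / 2) * f s.
  under eq_fun do rewrite lap_wpart//.
  apply: cvgM; first exact: cvg_cst.
  by rewrite (cvg_shiftS (fun N => \sum_(1 <= n < N) cpow n%:R (- s))); exact: fz.
exact: (cvg_unique (@norm_hausdorff _ (CC R)) c2 c1).
Qed.

(** The completed zeta function, in a form visibly defined off 0 and 1 and
    invariant under [s -> 1 - s]. *)
Definition Lam s : CC R :=
  lap (@wpos R) (s / 2) + lap (@wpos R) ((1 - s) / 2) + (s - 1)^-1 - s^-1.

Lemma derivable_lap_wpos s : derivable (lap (@wpos R)) s 1.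
Proof.
apply/derivableCP; eexists.
apply: (is_derive_lap ltr01 (@measurable_wpos R) (@wpos_ge0 R)).
by split; exact: Lint_wpos.
Qed.

Lemma derivable_scaleC (f : CC R -> CC R) (b s : CC R) :
  derivable f (b * s) 1 -> derivable (fun w => f (b * w)) s 1.
Proof.
move=> /derivableCP[l fl]; apply/derivableCP; exists (l * b).
exact: is_derive_scaleC.
Qed.

Lemma derivable_Lam s : s != 0 -> s != 1 -> derivable Lam s 1.
Proof.
move=> s0 s1.
pose wq (u : R) := wpos u * expR (1 / 2 * u).
have mq : measurable_fun [set: R] wq.
  by apply: measurable_funM; [exact: measurable_wpos | exact: measurable_expRM].
have q0 u : 0 <= wq u by rewrite mulr_ge0 ?wpos_ge0 ?expR_ge0.
have dq z : derivable (lap wq) z 1.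
  apply/derivableCP; eexists; apply: (is_derive_lap ltr01 mq q0).
  by split; apply: Lint_exp; exact: Lint_wpos.
have -> : Lam = fun w => lap (@wpos R) (2^-1 * w) + lap wq (- 2^-1 * w) + (w - 1)^-1 - w^-1.
  apply/funext => w; rewrite /Lam /wq lap_exp ofR_half [2^-1 * w]mulrC.
  have -> : - 2^-1 * w + 2^-1 = (1 - w) / 2 by ring.
  exact: erefl.
apply: derivableBC.
  apply: derivableDC.
    apply: derivableDC.
      by apply: derivable_scaleC; exact: derivable_lap_wpos.
    by apply: derivable_scaleC; exact: dq.
  apply: derivableVC; first by rewrite subr_eq0.
  by apply: derivableBC; [exact: derivable_idC | exact: derivable_cstC].
by apply: derivableVC; [exact: s0 | exact: derivable_idC].
Qed.

Lemma cIm_neq0 s (x : R) : cIm s != 0 -> s != ofR x.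
Proof. by apply: contra_neq => ->; rewrite cIm_ofR. Qed.

Lemma derivable_zetaL (f : CC R -> CC R) s : is_zeta f -> 0 < cRe s -> s != 1 ->
  derivable (fun s => cpow pi (- s / 2) * lap (@gumbel R) (s / 2) * f s) s 1.
Proof.
move=> [df _] s0 s1.
have -> : (fun s => cpow pi (- s / 2) * lap (@gumbel R) (s / 2) * f s) =
    (fun s => cexp (- (2^-1 * ofR (ln pi)) * s) * lap (@gumbel R) (2^-1 * s) * f s).
  apply/funext => w; rewrite /cpow [w / 2]mulrC; congr (cexp _ * _ * _).
  by ring.
apply: derivableMC; last exact: df.
apply: derivableMC.
  by apply: derivable_scaleC; apply/derivableCP; eexists; exact: is_derive_cexp.
apply: derivable_scaleC; apply/derivableCP; eexists; apply: is_derive_lap_gumbel.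
by rewrite mulrC cRe_half; lra.
Qed.

(** Both sides agree to the right of 1, hence along the horizontal segment from
    there to [s], on which both are differentiable. *)
Lemma zeta_Lam (f : CC R -> CC R) s : is_zeta f -> 0 < cRe s -> cIm s != 0 ->
  cpow pi (- s / 2) * lap (@gumbel R) (s / 2) * f s = Lam s.
Proof.
move=> fz s0 si.
pose d z := cpow pi (- z / 2) * lap (@gumbel R) (z / 2) * f z - Lam z.
suff : d s = 0 by move=> /eqP; rewrite subr_eq0 => /eqP.
have i0 : 0 < `|cIm s| by rewrite normr_gt0.
(* The squares of half side [r] centred on the segment stay off both axes. *)
pose r : R := Num.min (cRe s) `|cIm s| / 2.
have m1 : Num.min (cRe s) `|cIm s| <= cRe s by rewrite ge_min lexx.
have m2 : Num.min (cRe s) `|cIm s| <= `|cIm s| by rewrite ge_min lexx orbT.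
have r0 : 0 < r by rewrite divr_gt0// lt_min s0.
have rR : r < cRe s.
  by rewrite /r; lra.
have rI : r < `|cIm s|.
  by rewrite /r; lra.
pose x1 := Num.max (cRe s) 2.
rewrite (zcE s); apply: (@unique_continuation R d (cRe s) x1 (cIm s) r r0).
- by rewrite le_max lexx.
- move=> x /andP[xs _] p /and4P[p1 _ p3 p4].
  have pR : 0 < cRe p by lra.
  have pI : cIm p != 0.
    apply: contraL rI => /eqP pi0; rewrite pi0 in p3 p4.
    by rewrite -leNgt ler_norml; apply/andP; split; lra.
  have pn x' : p != ofR x' by exact: cIm_neq0.
  apply/derivableCP; apply: derivableBC.
    by apply: derivable_zetaL => //; exact: (pn 1).
  by apply: derivable_Lam; [exact: (pn 0) | exact: (pn 1)].
- apply/nbhsCP; exists (1 / 2) => [|z zx]; first by rewrite divr_gt0.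
  have z1 : 1 < cRe z.
    have := normRe_le (z - zc x1 (cIm s)); rewrite cReB cRe_zc => h.
    have := le_lt_trans h zx; rewrite ltr_norml => /andP[h1 _].
    have : 2 <= x1 by rewrite le_max lexx orbT.
    by lra.
  rewrite /d (zeta_lap fz z1) lap_wsum; last by rewrite cRe_half; lra.
  have h2 := two_neq0.
  rewrite /Lam mulrBl mul1r [2 * (z / 2)]mulrC divfK//.
  by rewrite subrr.
Qed.

Lemma cRe_ofRM (x : R) z : cRe (ofR x * z) = x * cRe z.
Proof. by rewrite cReM cRe_ofR cIm_ofR mul0r subr0. Qed.

Lemma cIm_ofRM (x : R) z : cIm (ofR x * z) = x * cIm z.
Proof. by rewrite cImM cRe_ofR cIm_ofR mul0r addr0. Qed.

Lemma lap_conj (h : R -> R) s : measurable_fun [set: R] h -> (forall u, 0 <= h u) ->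
  Lint h (cRe s) -> lap h (cconj s) = cconj (lap h s).
Proof.
move=> mh h0 Lh; have [_ I2] := lap_integrable0 mh h0 Lh.
have E1 u : cRe (cconj s * ofR u) = cRe (s * ofR u) by rewrite !cE; ring.
have E2 u : cIm (cconj s * ofR u) = - cIm (s * ofR u) by rewrite !cE; ring.
apply: ceqP; rewrite ?cRe_conj ?cIm_conj /lap ?cRe_cint ?cIm_cint.
  by apply: eq_rint => u _; rewrite [LHS]cRe_ofRM [RHS]cRe_ofRM !cRe_cexp E1 E2 cosN.
rewrite -mulN1r -(rintZ (-1) measurableT I2); apply: eq_rint => u _.
by rewrite [in LHS]cIm_ofRM [X in _ = _ * X]cIm_ofRM !cIm_cexp E1 E2 sinN; ring.
Qed.

(** On the critical line [1 - s] is the conjugate of [s]. *)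
Lemma Lam_real (y : R) : y != 0 -> cIm (Lam (zc (1 / 2) y)) = 0.
Proof.
move=> y0; set s := zc (1 / 2) y.
have E : (1 - s) / 2 = cconj (s / 2).
  rewrite -ofR_half; apply: ceqP; rewrite !cE ?cRe_zc ?cIm_zc; lra.
rewrite /Lam E lap_conj; [|exact: measurable_wpos|exact: wpos_ge0|exact: Lint_wpos].
have rs : cRe s = 1 / 2 by rewrite cRe_zc.
have is' : cIm s = y by rewrite cIm_zc.
clearbody s.
rewrite !(cImB, cImD, cImN) cIm_conj !cIm_inv !sqr_cabs !(cReB, cImB, cRe1, cIm1) rs is'.
have -> : 1 / 2 - 1 = - (1 / 2) :> R by field.
by rewrite sqrrN subr0; ring.
Qed.

(** Either some function has the defining property of zeta, and the chosen one
    is continued by [Lam], or zeta is the zero function and 0 serves. *)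
Lemma completed_zeta : exists L : CC R -> CC R,
  [/\ forall s, 0 < cRe s -> cIm s != 0 -> derivable L s 1,
      forall y : R, y != 0 -> cIm (L (zc (1 / 2) y)) = 0 &
      forall s, 0 < cRe s -> cIm s != 0 ->
        cpow pi (- s / 2) * Gamma (s / 2) * zeta s = L s].
Proof.
have [fz|nz] := pselect (exists f : CC R -> CC R, is_zeta f).
  exists Lam; split => [s _ si|y y0|s s0 si].
  - by apply: derivable_Lam; [exact: (cIm_neq0 0 si) | exact: (cIm_neq0 1 si)].
  - exact: Lam_real.
  - rewrite GammaE; last by rewrite cRe_half divr_gt0.
    apply: zeta_Lam => //.
    by rewrite /zeta; exact: (@xgetPex _ (fun=> 0) [set f | is_zeta f]).
exists (fun=> 0); split => [s _ _|y _|s _ _]; [exact: derivable_cstC | by [] |].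
rewrite /zeta xgetPN ?mulr0// => f fz; apply: nz; exists f; exact: fz.
Qed.

Lemma near_upper s : 0 < cRe s -> cIm s != 0 ->
  \forall w \near s, 0 < cRe w /\ cIm w != 0.
Proof.
move=> s0 si; have i0 : 0 < `|cIm s| by rewrite normr_gt0.
apply/nbhsCP; exists (Num.min (cRe s) `|cIm s|); first by rewrite lt_min s0.
move=> w; rewrite lt_min => /andP[w1 w2]; split.
  have := le_lt_trans (normRe_le _) w1; rewrite cReB ltr_norml => /andP[h _]; lra.
apply: contraL w2 => /eqP w0; rewrite -leNgt.
by apply: le_trans (normIm_le _); rewrite cImB w0 sub0r normrN.
Qed.

Lemma Zcompl_xi : exists L : CC R -> CC R,
  [/\ forall s, 0 < cRe s -> cIm s != 0 -> derivable L s 1,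
      forall y : R, y != 0 -> cIm (L (zc (1 / 2) y)) = 0 &
      forall s, 0 < cRe s -> cIm s != 0 ->
        Zcompl s = L s /\ xi s = 2^-1 * s * (s - 1) * L s].
Proof.
have [L [dL rL eL]] := completed_zeta; exists L; split; [exact: dL | exact: rL |].
move=> s s0 si; split.
  apply: (regular_value_continuous (g := L)).
    exact: (continuous_derivableC (dL s s0 si)).
  by apply: filterS (near_upper s0 si) => w [w0 wi] _; rewrite eL.
apply: (regular_value_continuous (g := fun s => 2^-1 * s * (s - 1) * L s)).
  apply: continuous_derivableC; apply: derivableMC; last exact: dL.
  apply: derivableMC.
    by apply: derivableMC; [exact: derivable_cstC | exact: derivable_idC].
  by apply: derivableBC; [exact: derivable_idC | exact: derivable_cstC].
apply: filterS (near_upper s0 si) => w [w0 wi] _.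
by rewrite -eL//; ring.
Qed.

End Zeta.

(** * Digamma and Hurwitz-Lerch differences on the critical line *)

Section ReciprocalSums.
Context {R : realType}.
Implicit Types (w x y : R).

Definition qroot x : R := Num.sqrt (Num.sqrt x).

Lemma qroot_ge0 x : 0 <= qroot x.
Proof. exact: sqrtr_ge0. Qed.

Lemma qroot_gt0 x : 0 < x -> 0 < qroot x.
Proof. by move=> x0; rewrite !sqrtr_gt0. Qed.

Lemma qrootX4 x : 0 <= x -> qroot x ^+ 4 = x.
Proof. by move=> x0; rewrite (exprM _ 2 2) !sqr_sqrtr// sqrtr_ge0. Qed.

Lemma qroot_le x y : x <= y -> qroot x <= qroot y.
Proof. by move=> xy; rewrite !ler_wsqrtr. Qed.

Lemma qrootM x y : 0 <= x -> qroot (x * y) = qroot x * qroot y.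
Proof. by move=> x0; rewrite /qroot sqrtrM// sqrtrM// sqrtr_ge0. Qed.

Lemma decayE w : decay w = (qroot (1 + `|w|))^-1 ^+ 3.
Proof. by []. Qed.

Definition quart (n : nat) : R := n%:R + 1 / 4.

Lemma quart_gt0 n : 0 < quart n.
Proof. by rewrite ltr_wpDl// divr_gt0. Qed.

Lemma quart_ge n : 1 / 4 <= quart n.
Proof. by rewrite lerDr. Qed.

Lemma quartS n : quart n.+1 = quart n + 1.
Proof. by rewrite /quart -natr1; ring. Qed.

(** If [p] and [r] are the fourth roots of [a + 1] and [a], then
    [(p - r) (p + r) (p ^ 2 + r ^ 2) = 1], so that [p ^ (- 5)] is at most four times
    [1 / r - 1 / p]. *)
Lemma quart_telescope n : (quart n.+1 * qroot (quart n.+1))^-1 <=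
  4 * ((qroot (quart n))^-1 - (qroot (quart n.+1))^-1).
Proof.
have E : qroot (quart n.+1) ^+ 4 = qroot (quart n) ^+ 4 + 1.
  by rewrite !qrootX4 ?(ltW (quart_gt0 _))// quartS.
have rp : qroot (quart n) <= qroot (quart n.+1) by apply: qroot_le; rewrite quartS lerDl.
have r0 := qroot_gt0 (quart_gt0 n); have p0 := qroot_gt0 (quart_gt0 n.+1).
rewrite -{1}[quart n.+1]qrootX4 ?(ltW (quart_gt0 _))//.
move: (qroot (quart n)) (qroot (quart n.+1)) E rp r0 p0 => r p E rp r0 p0.
have A : 1 <= 4 * (p - r) * p ^+ 3.
  (* The factorization of [p ^ 4 - r ^ 4]. *)
  have E1 : 1 = (p - r) * ((p + r) * (p ^+ 2 + r ^+ 2)) by lra.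
  rewrite [leLHS]E1; have -> : 4 * (p - r) * p ^+ 3 = (p - r) * ((p + p) * (p ^+ 2 + p ^+ 2)) by ring.
  apply: ler_wpM2l; first by rewrite subr_ge0.
  have r2 : r ^+ 2 <= p ^+ 2 by rewrite lerXn2r// nnegrE ltW.
  by apply: ler_pM; rewrite ?addr_ge0 ?exprn_ge0 ?lerD2l// ltW.
have r1 : r != 0 by rewrite gt_eqF.
have p1 : p != 0 by rewrite gt_eqF.
have -> : 4 * (r^-1 - p^-1) = (4 * (p - r) * p ^+ 3) * (r * p ^+ 4)^-1 by field; rewrite r1 p1.
apply: (@le_trans _ _ ((r * p ^+ 4)^-1)).
  rewrite lef_pV2 ?posrE ?mulr_gt0 ?exprn_gt0// mulrC.
  by rewrite ler_wpM2l// exprn_ge0// ltW.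
by rewrite ler_peMl// invr_ge0 mulr_ge0 ?exprn_ge0 ?ltW.
Qed.

Lemma sum_quart n : \sum_(0 <= k < n) (quart k * qroot (quart k))^-1 <=
  (quart 0 * qroot (quart 0))^-1 + 4 * (qroot (quart 0))^-1.
Proof.
have H m : \sum_(0 <= k < m.+1) (quart k * qroot (quart k))^-1 <=
    (quart 0 * qroot (quart 0))^-1 + 4 * (qroot (quart 0))^-1 - 4 * (qroot (quart m))^-1.
  elim: m => [|m IH]; first by rewrite big_nat1; lra.
  by rewrite big_nat_recr//=; have := quart_telescope m; lra.
have P m : 0 <= 4 * (qroot (quart m))^-1 by rewrite mulr_ge0// invr_ge0 qroot_ge0.
case: n => [|n]; last by have := H n; have := P n; lra.
by rewrite big_geq// addr_ge0// invr_ge0 mulr_ge0 ?qroot_ge0 ?(ltW (quart_gt0 _)).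
Qed.

Lemma sum_quart2 n : \sum_(0 <= k < n) (quart k ^+ 2)^-1 <= 20.
Proof.
have H m : \sum_(0 <= k < m.+1) (quart k ^+ 2)^-1 <= 20 - (quart m)^-1.
  elim: m => [|m IH].
    rewrite big_nat1 /quart add0r; have -> : (1 / 4 : R)^-1 = 4 by rewrite invf_div divr1.
    have -> : ((1 / 4 : R) ^+ 2)^-1 = 16 by rewrite -exprVn invf_div divr1; ring.
    by lra.
  rewrite big_nat_recr//=.
  have q0 := quart_gt0 m; have q1 := quart_gt0 m.+1.
  have : (quart m.+1 ^+ 2)^-1 <= (quart m)^-1 - (quart m.+1)^-1.
    have -> : (quart m)^-1 - (quart m.+1)^-1 = (quart m * quart m.+1)^-1.
      by rewrite quartS in q1 *; field; rewrite !gt_eqF.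
    rewrite lef_pV2 ?posrE ?mulr_gt0 ?exprn_gt0// expr2 ler_wpM2r ?ltW//.
    by rewrite quartS ltrDl.
  by lra.
case: n => [|n]; first by rewrite big_geq.
by apply: le_trans (H n) _; rewrite gerBl invr_ge0 ltW// quart_gt0.
Qed.

(** The modulus is at least [(a + |w|) / 3] with [a = quart n]; a fourth root of it
    is spent on [a], to make the series over [n] converge, and the remaining
    three on [1 + |w|]. *)
Lemma cabs_quart n w : (cabs (zc (quart n) (w / 2)))^-1 <= 12 * (qroot (quart n))^-1 * decay w.
Proof.
have a0 := quart_gt0 n; have a4 := quart_ge n.
have w0 := normr_ge0 w.
set a := quart n in a0 a4 *; pose X := a + `|w|.
have X0 : 0 < X by rewrite ltr_wpDr.
have bX : X / 3 <= cabs (zc a (w / 2)).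
  rewrite -ler_sqr ?nnegrE ?cabs_ge0 ?divr_ge0 ?(ltW X0)//.
  rewrite sqr_cabs cRe_zc cIm_zc !expr_div_n /X.
  have -> : w ^+ 2 = `|w| ^+ 2 by rewrite real_normK// num_real.
  by have := sqr_ge0 (2 * a - `|w|); nra.
have q1 : qroot a <= qroot X by apply: qroot_le; rewrite lerDl.
have q2 : qroot (1 + `|w|) * qroot (1 / 4) <= qroot X.
  by rewrite -qrootM ?addr_ge0//; apply: qroot_le; rewrite /X; lra.
have c4 : qroot (1 / 4) ^+ 4 = 1 / 4 by rewrite qrootX4.
have c0 : 0 < qroot (1 / 4) by rewrite qroot_gt0// divr_gt0.
have c1 : qroot (1 / 4) <= 1.
  by have := qroot_le (_ : 1 / 4 <= 1); rewrite /qroot !sqrtr1; apply; lra.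
have c3 : 1 / 4 <= qroot (1 / 4) ^+ 3.
  by have := ler_piMl (exprn_ge0 3 (ltW c0)) c1; rewrite -exprS c4.
have s0 : 0 < qroot (1 + `|w|) by rewrite qroot_gt0// ltr_pwDl.
have qa := qroot_gt0 a0.
have main : qroot a * qroot (1 + `|w|) ^+ 3 / 12 <= cabs (zc a (w / 2)).
  apply: le_trans bX.
  have -> : X = qroot X * qroot X ^+ 3 by rewrite -exprS qrootX4// ltW.
  have h3 : qroot (1 + `|w|) ^+ 3 * (1 / 4) <= qroot X ^+ 3.
    apply: (@le_trans _ _ ((qroot (1 + `|w|) * qroot (1 / 4)) ^+ 3)).
      by rewrite exprMn ler_wpM2l ?exprn_ge0 ?(ltW s0).
    by rewrite lerXn2r ?nnegrE ?qroot_ge0 ?mulr_ge0 ?(ltW s0) ?(ltW c0).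
  have : qroot a * (qroot (1 + `|w|) ^+ 3 * (1 / 4)) <= qroot X * qroot X ^+ 3.
    by apply: ler_pM; rewrite ?(ltW qa)// mulr_ge0 ?exprn_ge0 ?(ltW s0).
  by lra.
have -> : 12 * (qroot a)^-1 * decay w = (qroot a * qroot (1 + `|w|) ^+ 3 / 12)^-1.
  by rewrite decayE exprVn; field; rewrite !gt_eqF// exprn_gt0.
have p1 : 0 < qroot a * qroot (1 + `|w|) ^+ 3 / 12 by rewrite divr_gt0// mulr_gt0// exprn_gt0.
by rewrite lef_pV2 ?posrE ?p1 ?(lt_le_trans p1 main).
Qed.

Definition Krec : R := 12 * ((quart 0 * qroot (quart 0))^-1 + 4 * (qroot (quart 0))^-1).

Lemma Krec_ge0 : 0 <= Krec.
Proof.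
rewrite mulr_ge0// addr_ge0// ?mulr_ge0 ?invr_ge0 ?mulr_ge0 ?qroot_ge0//.
exact: ltW (quart_gt0 0).
Qed.

(** The estimate behind the decay of the digamma and Lerch differences. *)
Lemma sum_reciprocal N w :
  \sum_(0 <= n < N) (quart n)^-1 * (cabs (zc (quart n) (w / 2)))^-1 <= Krec * decay w.
Proof.
apply: (@le_trans _ _ (\sum_(0 <= n < N) (quart n * qroot (quart n))^-1 * (12 * decay w))).
  apply: ler_sum => n _; rewrite invfM.
  have -> : (quart n)^-1 * (qroot (quart n))^-1 * (12 * decay w) =
    (quart n)^-1 * (12 * (qroot (quart n))^-1 * decay w) by ring.
  by rewrite ler_wpM2l ?invr_ge0 ?(ltW (quart_gt0 _)) ?cabs_quart.
rewrite -mulr_suml /Krec; have d0 := decay_ge0 w; have := sum_quart N.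
move: (\sum_(_ <= _ < _) _) => S SK.
by rewrite [12 * (_ + _)]mulrC -mulrA ler_wpM2r ?mulr_ge0.
Qed.

End ReciprocalSums.

Section Digamma.
Context {R : realType}.
Implicit Types (w y : R) (s z : CC R).

Lemma quarterE : (1 / 4 : CC R) = ofR (1 / 4).
Proof. by rewrite rmorphM rmorph1 fmorphV rmorph_nat. Qed.

Lemma quarter_zc w : 1 / 4 + im R * ofR w / 2 = zc (1 / 4) (w / 2).
Proof.
rewrite quarterE /zc; congr (_ + _); rewrite -mulrA; congr (_ * _).
by rewrite rmorphM fmorphV rmorph_nat.
Qed.

Lemma quarter_zcD y (n : nat) : zc (1 / 4) y + n%:R = zc (quart n) y.
Proof. by rewrite /zc /quart rmorphD rmorph_nat; ring. Qed.

Lemma zc0 (x : R) : zc x 0 = ofR x.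
Proof. by rewrite /zc rmorph0 mulr0 addr0. Qed.

(** Euler's integrand is at least [exp (- 1)] on the negative axis. *)
Lemma Gamma_real_neq0 (x : R) : 0 < x -> Gamma (ofR x) != 0 :> CC R.
Proof.
move=> x0; have xR : 0 < cRe (ofR x) by [].
rewrite GammaE//; suff : 0 < cRe (lap gumbel (ofR x)) by apply: contraTN => /eqP ->; rewrite ltxx.
have e0 : 0 <= expR (-1) :> R by exact: expR_ge0.
have Re h : cRe (lap h (ofR x)) = rint setT (fun u => h u * expR (x * u)).
  rewrite /lap cRe_cint; apply: eq_rint => u _.
  by rewrite -rmorphM cexp_ofR -rmorphM.
have L0 : Lint (fun u => expR (-1) * h0 u) x by apply: LintZ; exact: Lint_h0.
apply: (@lt_le_trans _ _ (cRe (lap (fun u => expR (-1) * h0 u) (ofR x)))).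
  rewrite lapZ; [|exact: measurable_h0|by apply: Lint_norm; [exact: h0_ge0|exact: Lint_h0]].
  rewrite lap_h0// -fmorphV -rmorphM cRe_ofR mulr_gt0 ?expR_gt0// invr_gt0//.
rewrite !Re; apply: (le_rint measurableT L0 (Lint_gumbel x0)) => u _.
rewrite ler_wpM2r ?expR_ge0// /h0 /gumbel; case: (leP u 0) => u0; last by rewrite mulr0 expR_ge0.
by rewrite mulr1 ler_expR lerN2 -expR0 ler_expR.
Qed.

(** Compared with the value at [1 / 4], Gauss's product at [1 / 4 + i y] loses the
    factors [a / |a + i y|], with [a = k + 1 / 4], whose product is bounded below
    since the series of the [1 / a ^ 2] converges. *)
Lemma Gamma_quarter_neq0 y : Gamma (zc (1 / 4) y) != 0.
Proof.
set s := zc (1 / 4) y; have s0 : 0 < cRe s by rewrite cRe_zc divr_gt0.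
have q0 : 0 < cRe (ofR (1 / 4) : CC R) by rewrite cRe_ofR divr_gt0.
have c1 : cabs (gauss n s) @[n --> \oo] --> cabs (Gamma s).
  by apply: cvg_cabs; rewrite GammaE//; exact: cvg_gauss.
have c2 : expR (- (20 * y ^+ 2)) * cabs (gauss n (ofR (1 / 4))) @[n --> \oo] -->
    expR (- (20 * y ^+ 2)) * cabs (Gamma (ofR (1 / 4))).
  by apply: cvgMr; apply: cvg_cabs; rewrite GammaE//; exact: cvg_gauss.
have le n : expR (- (20 * y ^+ 2)) * cabs (gauss n (ofR (1 / 4))) <= cabs (gauss n s).
  have G z : cabs (gauss n z) = n`!%:R * expR (cRe z * ln n%:R) *
      (\prod_(0 <= k < n.+1) cabs (z + k%:R))^-1.
    by rewrite /gauss cabsM cabsV cabs_prod cabsM cabs_nat cabs_cpow.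
  rewrite !G cRe_zc cRe_ofR.
  rewrite mulrCA ler_wpM2l ?mulr_ge0 ?cabs_ge0 ?expR_ge0//.
  have E k : cabs (ofR (1 / 4) + k%:R : CC R) = quart k.
    by rewrite -zc0 quarter_zcD zc0 cabs_ofR gtr0_norm ?quart_gt0.
  under eq_bigr do rewrite E.
  under [in leRHS]eq_bigr do rewrite quarter_zcD.
  apply: (@le_trans _ _ (\prod_(0 <= k < n.+1) (expR (- (y ^+ 2 / quart k ^+ 2)) * (quart k)^-1))).
    rewrite big_split /= -prodfV ler_wpM2r ?prodr_ge0//.
      by move=> k _; rewrite invr_ge0 ltW// quart_gt0.
    rewrite -expR_sum ler_expR sumrN lerN2 -mulr_sumr mulrC ler_wpM2r ?sqr_ge0//.
    exact: sum_quart2.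
  rewrite -prodfV; apply: ler_prod => k _.
  have a0 := @quart_gt0 R k.
  have b2 := sqr_cabs (zc (quart k) y); rewrite cRe_zc cIm_zc in b2.
  have ab : quart k <= cabs (zc (quart k) y).
    by rewrite -[leLHS](cRe_zc _ y); exact: cRe_le.
  rewrite mulr_ge0 ?expR_ge0 ?invr_ge0 ?(ltW a0)//=.
  have b0 : 0 < cabs (zc (quart k) y) by exact: lt_le_trans ab.
  rewrite expRN -invfM lef_pV2 ?posrE ?mulr_gt0 ?expR_gt0//.
  apply: (@le_trans _ _ ((1 + y ^+ 2 / quart k ^+ 2) * quart k)); last first.
    by rewrite ler_wpM2r ?(ltW a0) ?expR_ge1Dx.
  have -> : (1 + y ^+ 2 / quart k ^+ 2) * quart k = cabs (zc (quart k) y) ^+ 2 / quart k.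
    by rewrite b2; field; rewrite gt_eqF.
  by rewrite expr2 ler_pdivlMr// ler_wpM2l// ltW.
rewrite -cabs_gt0; apply: (@lt_le_trans _ _ (expR (- (20 * y ^+ 2)) * cabs (Gamma (ofR (1 / 4))))).
  by rewrite mulr_gt0 ?expR_gt0// cabs_gt0 Gamma_real_neq0// divr_gt0.
by apply: (ler_cvg_to c2 c1); apply: nearW.
Qed.

Lemma inv_quart_diff w (n : nat) :
  (ofR (quart n))^-1 - (zc (quart n) (w / 2))^-1 =
  im R * ofR w / 2 * ((ofR (quart n))^-1 * (zc (quart n) (w / 2))^-1).
Proof.
have a0 : ofR (quart n) != 0 :> CC R.
  by rewrite -(cabs_gt0 (ofR (quart n))) cabs_ofR normr_gt0 gt_eqF ?quart_gt0.
have b0 : zc (quart n) (w / 2) != 0.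
  rewrite -(cabs_gt0 (zc _ _)) (lt_le_trans (quart_gt0 n))//.
  by rewrite -[leLHS](cRe_zc _ (w / 2)); exact: cRe_le.
have -> : im R * ofR w / 2 = zc (quart n) (w / 2) - ofR (quart n).
  by rewrite /zc addrAC subrr add0r rmorphM fmorphV rmorph_nat mulrA.
by move: (zc _ _) (ofR _) b0 a0 => b a b0 a0; field; rewrite a0 b0.
Qed.

Lemma cabs_half_im w : cabs (im R * ofR w / 2) = `|w| / 2.
Proof. by rewrite !cabsM cabsV cabs_im cabs_ofR cabs_nat mul1r. Qed.

Lemma sum_quart_diff (x : R) N w : 0 <= x <= 1 ->
  cabs (\sum_(0 <= n < N) ((ofR (quart n))^-1 - (zc (quart n) (w / 2))^-1) * ofR x ^+ n) <=
  `|w| / 2 * (Krec * decay w).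
Proof.
move=> /andP[x0 x1]; apply: le_trans (cabs_sum _ _ _) _.
apply: (@le_trans _ _ (`|w| / 2 * \sum_(0 <= n < N) (quart n)^-1 * (cabs (zc (quart n) (w / 2)))^-1)).
  rewrite mulr_sumr; apply: ler_sum => n _.
  rewrite inv_quart_diff cabsM [cabs (im R * _ / _ * _)]cabsM cabs_half_im [cabs (_^-1 * _^-1)]cabsM.
  rewrite !cabsV cabs_ofR (gtr0_norm (quart_gt0 n)) cabsX cabs_ofR (ger0_norm x0).
  by rewrite ler_piMr ?mulr_ge0 ?invr_ge0 ?cabs_ge0 ?(ltW (quart_gt0 n))// exprn_ile1.
by rewrite ler_wpM2l ?divr_ge0// sum_reciprocal.
Qed.

(** Gauss's expressions of the two digamma values differ by the finite sums of
    [sum_quart_diff]. *)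
Lemma psi_diff_le w : cabs (logderiv (@Gamma R) (1 / 4) - logderiv (@Gamma R) (zc (1 / 4) (w / 2)))
  <= `|w| / 2 * (Krec * decay w).
Proof.
have s0 y : 0 < cRe (zc (1 / 4) y) by rewrite cRe_zc divr_gt0.
have D y : digam n (zc (1 / 4) y) @[n --> \oo] --> logderiv (@Gamma R) (zc (1 / 4) y).
  by apply: cvg_digam; [exact: s0 | exact: Gamma_quarter_neq0].
rewrite quarterE -(zc0 (1 / 4)).
have c : cabs (digam n (zc (1 / 4) 0) - digam n (zc (1 / 4) (w / 2))) @[n --> \oo] -->
    cabs (logderiv (@Gamma R) (zc (1 / 4) 0) - logderiv (@Gamma R) (zc (1 / 4) (w / 2))).
  by apply: cvg_cabs; apply: cvgB; exact: D.
have c2 : (fun _ : nat => `|w| / 2 * (Krec * decay w)) @ \oo --> `|w| / 2 * (Krec * decay w).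
  exact: cvg_cst.
apply: (ler_cvg_to c c2); apply: nearW => n.
have -> : digam n (zc (1 / 4) 0) - digam n (zc (1 / 4) (w / 2)) =
    \sum_(0 <= k < n.+1) ((zc (1 / 4) (w / 2) + k%:R)^-1 - (zc (1 / 4) 0 + k%:R)^-1).
  by rewrite sumrB /digam; ring.
rewrite (eq_bigr (fun k => - (((ofR (quart k))^-1 - (zc (quart k) (w / 2))^-1) * ofR 1 ^+ k))).
  rewrite sumrN cabsN; apply: sum_quart_diff; rewrite ler01 lexx //.
by move=> k _; rewrite !quarter_zcD zc0 rmorph1 expr1n mulr1 opprB.
Qed.

End Digamma.

Section LerchBound.
Context {R : realType}.
Implicit Types (w : R) (s z : CC R).

Lemma cvg_sumC (u : nat -> CC R) (v : nat -> R) : (forall n, cabs (u n) <= v n) ->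
  cvgn (series v) -> exists l : CC R, \sum_(0 <= n < N) u n @[N --> \oo] --> l.
Proof.
move=> uv cv; have v0 n : 0 <= v n by exact: le_trans (cabs_ge0 _) (uv n).
have H (p : CC R -> R) : (forall z, `|p z| <= cabs z) -> cvgn (series (fun n => p (u n))).
  move=> pz; apply: normed_cvg.
  exact: (@series_le_cvg _ (fun n => `|p (u n)|) v (fun n => normr_ge0 _) v0 (fun n => le_trans (pz _) (uv n)) cv).
pose lr := limn (series (fun n => cRe (u n))); pose li := limn (series (fun n => cIm (u n))).
exists (zc lr li); apply: cvg_cReIm.
  rewrite cRe_zc; under eq_fun do rewrite raddf_sum; exact: (H _ (@normRe_le R)).
by rewrite cIm_zc; under eq_fun do rewrite raddf_sum; exact: (H _ (@normIm_le R)).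
Qed.

Lemma Lerch_arg w : 1 / 2 * (1 / 2 + im R * ofR w) = zc (1 / 4) (w / 2) :> CC R.
Proof. by rewrite -quarter_zc; have h := @two_neq0 R; field. Qed.

Lemma cvg_Lerch (t y : R) : 0 < t ->
  \sum_(0 <= n < N) ((n%:R + zc (1 / 4) y) ^- 1 * ofR (expR (- 2 * t)) ^+ n) @[N --> \oo] -->
  Lerch (ofR (expR (- 2 * t))) 1 (zc (1 / 4) y).
Proof.
move=> t0; set x := expR (- 2 * t).
have x1 : x < 1 by rewrite -expR0 ltr_expR; lra.
have x0 : 0 <= x by exact: expR_ge0.
have [||l cl] := @cvg_sumC (fun n => (n%:R + zc (1 / 4) y) ^- 1 * ofR x ^+ n) (geometric 4 x).
- move=> n; rewrite expr1 addrC quarter_zcD cabsM cabsV cabsX cabs_ofR ger0_norm//=.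
  rewrite ler_wpM2r ?exprn_ge0//.
  have ab : 1 / 4 <= cabs (zc (quart n) y).
    by apply: le_trans (quart_ge n) _; rewrite -[leLHS](cRe_zc _ y); exact: cRe_le.
  rewrite -[4]invrK lef_pV2 ?posrE ?invr_gt0// ?(lt_le_trans _ ab) ?divr_gt0//; lra.
- by apply: is_cvg_geometric_series; rewrite ger0_norm.
rewrite /Lerch; have -> // := cvg_lim _ cl; exact: norm_hausdorff.
Qed.

Lemma Lerch_diff_le w (t : R) : 0 < t ->
  cabs (Lerch_diff (ofR w) t) <= `|w| / 2 * (Krec * decay w).
Proof.
move=> t0; rewrite /Lerch_diff Lerch_arg quarterE -(zc0 (1 / 4)).
have c : cabs (\sum_(0 <= n < N) ((n%:R + zc (1 / 4) 0) ^- 1 * ofR (expR (- 2 * t)) ^+ n) -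
      \sum_(0 <= n < N) ((n%:R + zc (1 / 4) (w / 2)) ^- 1 * ofR (expR (- 2 * t)) ^+ n)) @[N --> \oo] -->
    cabs (Lerch (ofR (expR (- 2 * t))) 1 (zc (1 / 4) 0) - Lerch (ofR (expR (- 2 * t))) 1 (zc (1 / 4) (w / 2))).
  by apply: cvg_cabs; apply: cvgB; exact: cvg_Lerch.
have c2 : (fun _ : nat => `|w| / 2 * (Krec * decay w)) @ \oo --> `|w| / 2 * (Krec * decay w).
  exact: cvg_cst.
apply: (ler_cvg_to c c2); apply: nearW => n; rewrite -sumrB.
rewrite (eq_bigr (fun k => ((ofR (quart k))^-1 - (zc (quart k) (w / 2))^-1) * ofR (expR (- 2 * t)) ^+ k)).
  apply: sum_quart_diff; apply/andP; split; first exact: expR_ge0.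
  by rewrite -[leRHS]expR0 ler_expR; lra.
by move=> k _; rewrite !expr1 ![k%:R + _]addrC !quarter_zcD zc0 mulrBl.
Qed.

(** The bound does not depend on [t], so it survives the limit at [0]. *)
Lemma Lerch_bracket_le w (t : R) : 0 <= t ->
  cabs (Lerch_bracket (ofR w) t) <= `|w| / 2 * (Krec * decay w).
Proof.
move=> t0; rewrite /Lerch_bracket; case: eqVneq => [_|tn]; last first.
  by apply: Lerch_diff_le; rewrite lt_neqAle eq_sym tn.
set F := Lerch_diff (ofR w) u @[u --> _].
have B0 : 0 <= `|w| / 2 * (Krec * decay w).
  by rewrite mulr_ge0 ?divr_ge0// mulr_ge0 ?Krec_ge0 ?decay_ge0.
(* The limit of a divergent family is 0. *)
have [cF|ncF] := pselect (cvg F); last by rewrite (dvgP ncF) cabs0.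
have c : cabs (Lerch_diff (ofR w) u) @[u --> 0^'+] --> cabs (lim F).
  by apply: cvg_cabs; exact: cF.
have c2 : (fun _ : R => `|w| / 2 * (Krec * decay w)) @ 0^'+ --> `|w| / 2 * (Krec * decay w).
  exact: cvg_cst.
apply: (ler_cvg_to c c2).
near=> u; apply: Lerch_diff_le; near: u; exact: nbhs_right_gt.
Unshelve. all: by end_near. Qed.

End LerchBound.

(** * Square-integrability *)

Section DecayBounds.
Context {R : realType}.
Implicit Types (f g : R -> CC R).

Definition bdd f := exists C : R, forall w, w != 0 -> cabs (f w) <= C.
(** The majorant [decay] up to a constant, away from the origin, where the formula
    for [frakP] is singular. *)
Definition bnd f := exists C : R, forall w, w != 0 -> cabs (f w) <= C * decay w.

Lemma bndD f g : bnd f -> bnd g -> bnd (fun w => f w + g w).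
Proof.
move=> [C fC] [D gD]; exists (C + D) => w w0; apply: le_trans (cabsD _ _) _.
by rewrite mulrDl lerD ?fC ?gD.
Qed.

Lemma bndM g f : bdd g -> bnd f -> bnd (fun w => g w * f w).
Proof.
move=> [C gC] [D fD]; exists (C * D) => w w0; rewrite (cabsM (g w)) -mulrA.
by apply: ler_pM; rewrite ?cabs_ge0 ?gC ?fD.
Qed.

Lemma bdd_cst (c : CC R) : bdd (fun=> c).
Proof. by exists (cabs c). Qed.

Lemma bndZ (c : CC R) f : bnd f -> bnd (fun w => c * f w).
Proof. exact: bndM (bdd_cst c). Qed.

Lemma bndB f g : bnd f -> bnd g -> bnd (fun w => f w - g w).
Proof.
move=> [C fC] [D gD]; exists (C + D) => w w0; apply: le_trans (cabsB _ _) _.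
by rewrite mulrDl lerD ?fC ?gD.
Qed.

Lemma bnd_sum (F : nat -> R -> CC R) (m n : nat) : (forall k, bnd (F k)) ->
  bnd (fun w => \sum_(m <= k < n) F k w).
Proof.
move=> bF; have [mn|nm] := leqP n m.
  by exists 0 => w _; rewrite big_geq// cabs0 mul0r.
elim: n nm => // n IH; rewrite ltnS leq_eqVlt => /predU1P[->|mn].
  by have [C FC] := bF n; exists C => w w0; rewrite big_nat1 FC.
have [C FC] := bndD (IH mn) (bF n); exists C => w w0.
by rewrite big_nat_recr ?FC// ltnW.
Qed.

Lemma invD_le_decay (w : R) : (1 + `|w|)^-1 <= decay w.
Proof.
have w1 : 1 <= 1 + `|w| by rewrite lerDl.
have q1 : 1 <= qroot (1 + `|w|) by have := qroot_le w1; rewrite {1}/qroot !sqrtr1.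
have q4 : qroot (1 + `|w|) ^+ 4 = 1 + `|w| by rewrite qrootX4// (le_trans ler01).
have w0 : 0 < 1 + `|w| by exact: lt_le_trans w1.
rewrite decayE exprVn lef_pV2 ?posrE ?exprn_gt0 ?qroot_gt0//.
by rewrite -[leRHS]q4 (exprS _ 3) ler_peMl// exprn_ge0// qroot_ge0.
Qed.

Lemma bnd_inv f (C : R) : 0 <= C ->
  (forall w, w != 0 -> cabs (f w) <= C * (1 + `|w|)^-1) -> bnd f.
Proof.
move=> C0 fC; exists C => w w0; apply: le_trans (fC w w0) _.
by rewrite ler_wpM2l// invD_le_decay.
Qed.

Lemma cabs_lin (w : R) : (1 + `|w|) / 2 <= cabs (1 - 2 * (im R * ofR w)).
Proof.
rewrite -ler_sqr ?nnegrE ?cabs_ge0 ?divr_ge0 ?addr_ge0// sqr_cabs.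
have -> : cRe (1 - 2 * (im R * ofR w)) = 1 by rewrite !cE; ring.
have -> : cIm (1 - 2 * (im R * ofR w)) = - 2 * w by rewrite !cE; ring.
have -> : (- 2 * w) ^+ 2 = 4 * `|w| ^+ 2 by rewrite real_normK ?num_real//; ring.
by have := normr_ge0 w; move: `|w| => a a0; nra.
Qed.

Lemma bnd_lin (c : CC R) : bnd (fun w => c / (1 - 2 * (im R * ofR w))).
Proof.
apply: bndZ; apply: (@bnd_inv _ 2) => // w _.
have p0 : 0 < (1 + `|w|) / 2 by rewrite divr_gt0// ltr_pwDl.
have -> : 2 * (1 + `|w|)^-1 = ((1 + `|w|) / 2)^-1 by rewrite invf_div.
rewrite cabsV lef_pV2 ?posrE ?cabs_lin//.
exact: lt_le_trans p0 (cabs_lin w).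
Qed.

Lemma bnd_linN (c : CC R) : bnd (fun w => c / (1 + 2 * (im R * ofR w))).
Proof.
have [C cC] := bnd_lin c; exists C => w w0; have := cC (- w).
rewrite oppr_eq0 w0 => /(_ isT); rewrite rmorphN !mulrN opprK.
by rewrite /decay normrN.
Qed.

(** The integral of [exp (i w u)] over [u] between [0] and [a]. *)
Definition phase (a w : R) : CC R := (cexp (im R * ofR w * ofR a) - 1) / (im R * ofR w).

Lemma cabs_phase (a w : R) : w != 0 -> cabs (phase a w) <= `|a| /\ cabs (phase a w) * `|w| <= 2.
Proof.
move=> w0; have n0 : 0 < `|w| by rewrite normr_gt0.
set N := cabs (cexp (im R * ofR w * ofR a) - 1).
have N2 : N <= 2.
  apply: le_trans (cabsB _ _) _; rewrite cabs_cexp cabs1.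
  have -> : cRe (im R * ofR w * ofR a) = 0 by rewrite !cE; ring.
  by rewrite expR0.
have NW : N <= `|a| * `|w|.
  rewrite -normrM -ler_sqr ?nnegrE ?cabs_ge0// sqr_cabs real_normK ?num_real//.
  have r0 : cRe (im R * ofR w * ofR a) = 0 by rewrite !cE; ring.
  have i0 : cIm (im R * ofR w * ofR a) = a * w by rewrite !cE; ring.
  rewrite cReB cImB cRe1 cIm1 cRe_cexp cIm_cexp r0 i0 expR0 !mul1r subr0.
  have -> : (cos (a * w) - 1) ^+ 2 + sin (a * w) ^+ 2 = 2 * (1 - cos (a * w)).
    have := cos2Dsin2 (a * w); move: (cos _) (sin _) => c s; lra.
  rewrite cosB1; have : sin (a * w / 2) ^+ 2 <= (a * w / 2) ^+ 2.
    rewrite -(real_normK (num_real (sin (a * w / 2)))) -(real_normK (num_real (a * w / 2))).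
    by rewrite lerXn2r ?nnegrE ?normr_ge0// sin_le_abs.
  by move: (sin _) => s; lra.
have E : cabs (phase a w) = N / `|w|.
  by rewrite /phase cabsM cabsV [cabs (im R * _)]cabsM cabs_im cabs_ofR mul1r.
by rewrite E ler_pdivrMr// divfK ?lt0r_neq0.
Qed.

Lemma bnd_phase a : bnd (phase a).
Proof.
apply: (@bnd_inv _ (`|a| + 2)); first by rewrite addr_ge0.
move=> w w0; have [h1 h2] := cabs_phase a w0.
by rewrite ler_pdivlMr ?ltr_pwDl// mulrDr mulr1 lerD.
Qed.

End DecayBounds.

Section CriticalLine.
Context {R : realType}.

Lemma half_line (w : R) : 2^-1 - im R * ofR w = zc (1 / 2) (- w).
Proof. by rewrite -ofR_half /zc rmorphN mulrN. Qed.

(** The derivative of [L] in the direction [i] is real since [L] is real on the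
    line. *)
Lemma cRe_derive_line (L : CC R -> CC R) (w : R) (l : CC R) : w != 0 ->
  (forall y : R, y != 0 -> cIm (L (zc (1 / 2) y)) = 0) ->
  is_derive (zc (1 / 2) w) (1 : CC R) L l -> cRe l = 0.
Proof.
move=> w0 rL /is_deriveCP dl; apply/eqP; rewrite -normr_le0; apply/ler_addgt0Pr => e e0.
rewrite add0r; have [d d0 dP] := dl e e0.
have n0 : 0 < `|w| by rewrite normr_gt0.
(* A step of at most half of [|w|] stays away from the real point of the line. *)
pose r : R := Num.min d `|w| / 2.
have m1 : Num.min d `|w| <= d by rewrite ge_min lexx.
have m2 : Num.min d `|w| <= `|w| by rewrite ge_min lexx orbT.
have r0 : 0 < r by rewrite divr_gt0// lt_min d0.
have rd : r < d by rewrite /r; lra.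
have rw : r <= `|w| / 2 by rewrite /r; lra.
clearbody r.
have cr : cabs (im R * ofR r) = r by rewrite cabsM cabs_im mul1r cabs_ofR gtr0_norm.
have := dP (im R * ofR r); rewrite cr => /(_ _) h.
have {}h : cabs (L (zc (1 / 2) w + im R * ofR r) - L (zc (1 / 2) w) - l * (im R * ofR r)) <= e * r.
  exact: h.
have wr : w + r != 0.
  apply/eqP => E; have wE : w = - r by lra.
  by move: rw; rewrite wE normrN (gtr0_norm r0); lra.
have sE : zc (1 / 2) w + im R * ofR r = zc (1 / 2) (w + r) by rewrite /zc rmorphD; ring.
have := le_trans (normIm_le _) h; rewrite sE !cImB !rL// subrr sub0r normrN.
have -> : cIm (l * (im R * ofR r)) = cRe l * r by rewrite !cE; ring.
by rewrite normrM (gtr0_norm r0) ler_pM2r.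
Qed.

Lemma Theta_le (w : R) : cabs (1 + Theta (ofR w)) <= 2.
Proof.
apply: le_trans (cabsD _ _) _; rewrite cabs1 /Theta cconj_ofR cabsM cabsV cabs_conj.
have [->|e0] := eqVneq (cabs (E_xi (ofR w))) 0; first by rewrite mul0r; lra.
by rewrite mulfV//; lra.
Qed.

(** With [P = s (s - 1) / 2], [X = xi s] and [D = xi' s], the number [X = P L] is
    real and [D = P' L + P L'] is imaginary, so [1 + Theta = 2 X / (X + D)] and
    both [|X|] and [|D|] are at most [|X + D|]. The product is therefore
    [2 P L' / (X + D)] with [P L' = D - (P' / P) X], and [|P' / P| <= 2]. A zero of
    [L] is cancelled by the factor [X]. *)
Lemma Theta_logderiv_le (w : R) : w != 0 ->
  cabs ((1 + Theta (ofR w)) * logderiv (@Zcompl R) (2^-1 - im R * ofR w)) <= 6.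
Proof.
move=> w0; have [L [dL rL ZL]] := @Zcompl_xi R.
rewrite /Theta cconj_ofR /E_xi half_line; set s := zc (1 / 2) (- w).
have rs : cRe s = 1 / 2 by rewrite cRe_zc.
have is' : cIm s = - w by rewrite cIm_zc.
have s0 : 0 < cRe s by rewrite rs divr_gt0.
have si : cIm s != 0 by rewrite is' oppr_eq0.
have /derivableCP[l Ll] := dL s s0 si.
have Nw : - w != 0 by rewrite oppr_eq0.
have l0 : cRe l = 0 by exact: (cRe_derive_line Nw rL Ll).
have L0 : cIm (L s) = 0 by exact: rL.
clearbody s.
have [Zs Xs] := ZL s s0 si.
have dZ : derive1 (@Zcompl R) s = l.
  apply: is_derive_derive1C; apply: is_derive_nbhsC Ll.
  by apply: filterS (near_upper s0 si) => z [z0 zi]; have [-> _] := ZL z z0 zi.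
pose a : CC R := 2^-1 * (s - 1) + 2^-1 * s.
have dX : derive1 (@xi R) s = a * L s + (2^-1 * s * (s - 1)) * l.
  apply: is_derive_derive1C.
  have D := is_deriveMC (is_deriveMC (is_deriveMC (is_derive_cstC 2^-1 s) (is_derive_idC s))
     (is_deriveBC (is_derive_idC s) (is_derive_cstC 1 s))) Ll.
  have E : ((0 * s + 2^-1 * 1) * (s - 1) + 2^-1 * s * (1 - 0)) * L s + 2^-1 * s * (s - 1) * l =
     a * L s + (2^-1 * s * (s - 1)) * l by rewrite /a; ring.
  rewrite -E; apply: is_derive_nbhsC D.
  by apply: filterS (near_upper s0 si) => z [z0 zi]; have [_ ->] := ZL z z0 zi.
rewrite /logderiv dZ dX Zs Xs.
pose p : R := - (1 / 4 + w ^+ 2) / 2; pose la := cRe (L s); pose m := cIm l.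
have pE : 2^-1 * s * (s - 1) = ofR p.
  by rewrite -ofR_half; apply: ceqP; rewrite !(cReM, cImM, cReB, cImB, cRe1, cIm1, cRe_ofR, cIm_ofR) rs is' /p; field.
have aE : a = - (im R * ofR w).
  rewrite /a -ofR_half; apply: ceqP;
    by rewrite !(cReN, cImN, cReD, cImD, cReM, cImM, cReB, cImB, cRe1, cIm1, cRe_ofR, cIm_ofR, cRe_im, cIm_im) rs is'; field.
have LE : L s = ofR la by apply: ceqP; rewrite ?cRe_ofR ?cIm_ofR.
have lE : l = im R * ofR m.
  by apply: ceqP; rewrite !(cReM, cImM, cRe_ofR, cIm_ofR, cRe_im, cIm_im) ?l0 /m; ring.
rewrite pE aE LE lE.
(* At a zero of [L] the logarithmic derivative is a division by 0, hence 0. *)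
have [la0|la0] := eqVneq la 0.
  by rewrite la0 rmorph0 invr0 !mulr0 cabs0.
set E := ofR p * ofR la + (- (im R * ofR w) * ofR la + ofR p * (im R * ofR m)).
have rE : cRe E = p * la by rewrite /E !cE; ring.
have iE : cIm E = p * m - w * la by rewrite /E !cE; ring.
clearbody E.
have p0 : 0 < - p by rewrite /p; have := sqr_ge0 w; lra.
have pw : `|w| <= 2 * `|p|.
  rewrite (@ltr0_norm _ p); last by rewrite -oppr_gt0.
  have -> : 2 * - p = 1 / 4 + `|w| ^+ 2 by rewrite /p real_normK ?num_real//; field.
  by have := sqr_ge0 (`|w| - 1 / 2); lra.
clearbody p.
have E0 : E != 0.
  apply/eqP => EE; move: rE; rewrite EE cRe0 => /esym/eqP; rewrite mulf_eq0 (negbTE la0) orbF => /eqP.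
  by move=> pz; rewrite pz oppr0 ltxx in p0.
have cE0 : 0 < cabs E by rewrite cabs_gt0.
have kE : 1 + cconj E / E = ofR (2 * (p * la)) / E.
  have -> : ofR (2 * (p * la)) = E + cconj E.
    by apply: ceqP; rewrite !(cReD, cImD, cRe_conj, cIm_conj, cRe_ofR, cIm_ofR) ?rE; ring.
  by rewrite mulrDl mulfV.
rewrite kE !cabsM !cabsV !cabs_ofR cabs_im mul1r !normrM.
have -> : `|2 : R| = 2 by rewrite ger0_norm.
have n0 : 0 < `|la| by rewrite normr_gt0.
have -> : 2 * (`|p| * `|la|) / cabs E * (`|m| / `|la|) = 2 * (`|p| * `|m|) / cabs E.
  by field; rewrite !gt_eqF.
rewrite ler_pdivrMr//.
have h1 : `|p| * `|la| <= cabs E by rewrite -normrM -rE normRe_le.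
have h2 : `|p| * `|m| <= cabs E + `|w| * `|la|.
  have -> : `|p| * `|m| = `|cIm E + w * la| by rewrite -normrM iE; congr `|_|; ring.
  by apply: le_trans (ler_normD _ _) _; rewrite normrM lerD2r normIm_le.
have h3 : `|w| * `|la| <= 2 * `|p| * `|la| by rewrite ler_wpM2r.
by lra.
Qed.

End CriticalLine.

Section MainBound.
Context {R : realType}.

Lemma cabs_inv2im (w : R) : cabs (1 / (2 * (im R * ofR w))) = (2 * `|w|)^-1.
Proof.
by rewrite div1r cabsV cabsM cabs_nat [cabs (im R * _)]cabsM cabs_im cabs_ofR mul1r.
Qed.

(** For the two differences divided by [2 i w]. *)
Lemma bnd_reciprocal (f : R -> CC R) (K : R) : 
  (forall w, cabs (f w) <= `|w| / 2 * (K * decay w)) ->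
  bnd (fun w => 1 / (2 * (im R * ofR w)) * f w).
Proof.
move=> fK; exists (K / 4) => w w0; rewrite [cabs (_ * f w)]cabsM cabs_inv2im.
have n0 : 0 < `|w| by rewrite normr_gt0.
rewrite mulrC ler_pdivrMr ?mulr_gt0//; apply: le_trans (fK w) _.
by rewrite le_eqVlt; apply/orP; left; apply/eqP; field.
Qed.

(** The digamma value is a constant minus a difference of size [|w| * decay w]; the
    constant is paired with the decay of [phase], the difference with the bound
    [2 / |w|] of [phase]. *)
Lemma bnd_phase_psi (a : R) (c : CC R) (f : R -> CC R) (K : R) :
  (forall w, cabs (f w) <= `|w| / 2 * (K * decay w)) ->
  bnd (fun w => phase a w * (c - f w)).
Proof.
move=> fK; have [C pC] := bnd_phase a.
exists (C * cabs c + K) => w w0; rewrite mulrBr.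
apply: le_trans (cabsB _ _) _; rewrite [cabs (phase a w * c)]cabsM [cabs (phase a w * f w)]cabsM.
have [_ h2] := cabs_phase a w0.
have c0 := cabs_ge0 c; have p0 := cabs_ge0 (phase a w); have f0 := cabs_ge0 (f w).
rewrite mulrDl lerD//.
  by rewrite -mulrA [cabs c * _]mulrC mulrA ler_wpM2r// pC.
have n0 : 0 < `|w| by rewrite normr_gt0.
have K0 : 0 <= K * decay w.
  by have := le_trans f0 (fK w); rewrite pmulr_rge0// divr_gt0.
apply: le_trans (ler_wpM2l p0 (fK w)) _.
have -> : cabs (phase a w) * (`|w| / 2 * (K * decay w)) =
  (cabs (phase a w) * `|w|) * (K * decay w / 2) by field.
apply: le_trans (ler_wpM2r _ h2) _; first by rewrite divr_ge0.
by lra.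
Qed.

Lemma bnd_frakP (t : R) : 0 <= t ->
  bnd (fun w => (1 + Theta (ofR w)) * frakP t (ofR w)).
Proof.
move=> t0.
pose k w := 1 + @Theta R (ofR w).
pose c : CC R := 1 / 2 * logderiv (@Gamma R) (1 / 4) - 1 / 2 * ofR (ln pi).
pose f w : CC R := 1 / 2 * (logderiv (@Gamma R) (1 / 4) - logderiv (@Gamma R) (zc (1 / 4) (w / 2))).
pose A1 w : CC R := 4 * (ofR (expR (t / 2)) - 1) / (1 - 2 * (im R * ofR w)).
pose A2 w : CC R := 4 * (ofR (expR (- t / 2)) - 1) / (1 + 2 * (im R * ofR w)).
pose A3 w : CC R := \sum_(1 <= n < (Num.truncn (expR t)).+1)
  ofR (vonMangoldt R n / Num.sqrt n%:R) * phase (t - ln n%:R) w.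
pose A6 w : CC R := 1 / (2 * (im R * ofR w)) *
  (logderiv (@Gamma R) (1 / 4) - logderiv (@Gamma R) (zc (1 / 4) (w / 2))).
pose A7 w : CC R := 1 / (2 * (im R * ofR w)) * (ofR (expR (- t / 2)) * Lerch_bracket (ofR w) t).
have bk : bdd k by exists 2 => w _; exact: Theta_le.
have bkZ : bdd (fun w => k w * logderiv (@Zcompl R) (2^-1 - im R * ofR w)).
  by exists 6 => w w0; exact: Theta_logderiv_le.
have fK w : cabs (f w) <= `|w| / 2 * (Krec * decay w).
  rewrite /f.
  have d := psi_diff_le w; have d0 := cabs_ge0 (logderiv (@Gamma R) (1 / 4) - logderiv (@Gamma R) (zc (1 / 4) (w / 2))).
  rewrite cabsM cabsM cabs1 cabsV cabs_nat.
  by lra.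
have b1 : bnd A1 by exact: bnd_lin.
have b2 : bnd A2 by exact: bnd_linN.
have b3 : bnd A3 by apply: bnd_sum => n; apply: bndZ; exact: bnd_phase.
have b6 : bnd A6 by apply: (bnd_reciprocal (K := Krec)) => w; exact: psi_diff_le.
have b7 : bnd A7.
  apply: (bnd_reciprocal (K := expR (- t / 2) * Krec)) => w.
  rewrite cabsM cabs_ofR (gtr0_norm (expR_gt0 _)).
  have -> : `|w| / 2 * (expR (- t / 2) * Krec * decay w) =
    expR (- t / 2) * (`|w| / 2 * (Krec * decay w)) by ring.
  by rewrite ler_wpM2l ?expR_ge0// Lerch_bracket_le.
have b5 := bnd_phase_psi t c fK.
have [C HC] := bndB (bndB (bndD (bndD (bndB (bndD (bndM bk b1) (bndM bk b2)) (bndM bk b3))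
  (bndM bkZ (bnd_phase t))) (bndM bk b5)) (bndM bk b6)) (bndM bk b7).
exists C => w w0; apply: le_trans (HC w w0).
rewrite le_eqVlt; apply/orP; left; apply/eqP; congr cabs.
rewrite /frakP quarter_zc /A1 /A2 /A3 /A6 /A7 /f /c -/(k w) /phase.
rewrite [im R * ofR t * ofR w]mulrAC.
have -> : 1 / 2 - im R * ofR w = 2^-1 - im R * ofR w by rewrite div1r.
by ring.
Qed.

End MainBound.

Theorem proposition1p1 (R : realType) (t : R) :
  in_L2 (fun x : R => frakS t (ofR x)).
Proof.
pose G z := im R * (1 + Theta z) / (2 * ofR (Num.sqrt pi)) * frakP `|t| z.
have [C HC] : bnd (fun w => G (ofR w)).
  have [C HC] := bndZ (im R / (2 * ofR (Num.sqrt pi))) (bnd_frakP (normr_ge0 t)).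
  exists C => w w0; apply: le_trans (HC w w0).
  by rewrite le_eqVlt; apply/orP; left; apply/eqP; congr cabs; rewrite /G; ring.
have C0 : 0 <= C.
  have := le_trans (cabs_ge0 _) (HC 1 (oner_neq0 _)).
  by rewrite pmulr_lge0// decay_gt0.
apply: (in_L2_decay (C := C)) => [||x].
- apply: measurable_regular_value => z w; rewrite -cReB; exact: normRe_le.
- apply: measurable_regular_value => z w; rewrite -cImB; exact: normIm_le.
- apply: (@regular_value_le R G (fun y => C * decay y)).
  + by move=> y; apply: cvgMr; exact: continuous_decay.
  + by move=> y; rewrite mulr_ge0// decay_ge0.
  + exact: HC.
Qed.
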